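(* Let $(G_n)_{n\in\mathbb{N}}$ be an increasing sequence of finite simple directed graphs with direct limit $G=\bigcup_{n\in\mathbb{N}}G_n$, where $G$ is simple and uniformly locally finite, and let $(c_j)_{j\in J}$ be velocities on the edges of $G$ with $m\le c_j\le M$ for all $j\in J$ and some constants $m,M>0$. Let $X_n=\mathrm{L}^1([0,1],\mathbb{C}^{|\mathrm{E}(G_n)|})$ and $X=\mathrm{L}^1([0,1],\ell^1(J))$, let $(A_n,\mathrm{D}(A_n))$ and $(A,\mathrm{D}(A))$ be the transport operators on $X_n$ and $X$ associated to $G_n$ and $G$, respectively (as defined in the context), and let $(T_n(t))_{t\ge0}$ and $(T(t))_{t\ge0}$ be the $C_0$-semigroups generated by them. Let $E_n:X_n\to X$ be the extension-by-zero operator and $P_n:X\to X_n$ the cut-off operator. Then for every $x\in X$ and $t\ge 0$, $$\lim_{n\to\infty}\left\|E_nT_n(t)P_nx-T(t)x\right\|=0,$$ uniformly for $t$ in bounded intervals.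
   Context: Graphs. A directed graph $G=(\mathrm{V}(G),\mathrm{E}(G))$ has at most countable vertex set $\mathrm{V}(G)=\{v_i: i\in I\}$ and edge set $\mathrm{E}(G)=\{e_j: j\in J\}\subseteq \mathrm{V}(G)\times \mathrm{V}(G)$, $I,J\subseteq\mathbb{N}$. For $e=(v_i,v_k)$, $v_i$ is the tail and $v_k$ the head; $e$ is outgoing from $v_i$ and incoming to $v_k$. $G$ is simple if it has no loops and no multiple edges connecting two vertices in the same direction. $G$ is uniformly locally finite if each vertex has only finitely many outgoing edges and the number of outgoing edges per vertex is uniformly bounded. A graph homomorphism $\varphi:G\to H$ is a map $\mathrm{V}(G)\to \mathrm{V}(H)$ such that $(v,w)\in \mathrm{E}(G)$ implies $(\varphi(v),\varphi(w))\in \mathrm{E}(H)$; if it is injective, $G$ is called a subgraph of $H$. An increasing (growing) sequence $(G_n)$ is one with injective graph homomorphisms $\varphi_n:G_n\to G_{n+1}$ for all $n$. Its direct limit (in the sense of category theory, with graph homomorphisms as arrows) is $G=\bigcup_n G_n$, where the $G_n$ are identified with subgraphs of $G$ via the injective canonical maps $\psi_n:G_n\to G$; thus $\mathrm{V}(G)=\bigcup_n \mathrm{V}(G_n)$ and $\mathrm{E}(G)=\bigcup_n \mathrm{E}(G_n)$. The edges of $G$ are labelled so that $\mathrm{E}(G_n)=\{e_1,\dots,e_{|\mathrm{E}(G_n)|}\}$ for every $n$. Transport operators. The line-graph adjacency matrix $\mathbb{B}=(\mathbb{B}_{ij})_{i,j\in J}$ of $G$ is defined by $\mathbb{B}_{ij}=1$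 if the head of $e_j$ equals the tail of $e_i$, and $\mathbb{B}_{ij}=0$ otherwise; by uniform local finiteness it is a bounded operator on $\ell^1(J)$. Put $C:=\mathrm{diag}(c_j)$ and $\mathbb{B}_C:=C^{-1}\mathbb{B}C$, which is bounded on $\ell^1(J)$. Let $X=\mathrm{L}^1([0,1],\ell^1(J))$ with norm $\|f\|=\int_0^1\|f(s)\|_{\ell^1}\,ds$ and define $$A:=\mathrm{diag}\left(c_j\frac{d}{dx}\right),\qquad \mathrm{D}(A):=\{f\in \mathrm{W}^{1,1}([0,1],\ell^1(J)) : f(1)=\mathbb{B}_Cf(0)\}.$$ The operator $(A_n,\mathrm{D}(A_n))$ on $X_n=\mathrm{L}^1([0,1],\mathbb{C}^{|\mathrm{E}(G_n)|})$ (with $\mathbb{C}^{|\mathrm{E}(G_n)|}$ carrying the $\ell^1$-norm) is defined in the same way, using the line-graph adjacency matrix of $G_n$ and the velocities $c_j$, $1\le j\le |\mathrm{E}(G_n)|$. It is known that $A$ and all $A_n$ generate $C_0$-semigroups. Connecting operators. $E_n(f_1,\dots,f_{|\mathrm{E}(G_n)|})=(f_1,\dots,f_{|\mathrm{E}(G_n)|},0,0,\dots)$ and $P_n(f_1,f_2,\dots)=(f_1,\dots,f_{|\mathrm{E}(G_n)|})$. *)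

(* Defs.v *)
From HB Require Import structures.
From mathcomp Require Import all_boot all_order all_algebra.
From mathcomp Require Import finmap complex.
From mathcomp Require Import all_classical all_reals all_analysis.
From mathcomp Require Import measurable_realfun.
From mathcomp.analysis.showcase Require summability.
Set Implicit Arguments. Unset Strict Implicit. Unset Printing Implicit Defensive.
Import Order.TTheory GRing.Theory Num.Theory.
Import numFieldNormedType.Exports.
Local Open Scope classical_set_scope.
Local Open Scope ring_scope.

Section RealNorm.
Context {R : realType} {V : normedZmodType R[i]}.
Implicit Types x y : V.

(* Norms of complex normed spaces take values in R[i]; [rnorm] is the same
   number seen in R. *)
Definition rnorm x : R := complex.Re `|x|.

Lemma rnormE x : `|x| = (rnorm x)%:C%C.
Proof. by rewrite /rnorm; apply/esym/RRe_real; rewrite normr_real. Qed.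

Lemma rnorm_ge0 x : 0 <= rnorm x.
Proof. by rewrite -ler0c -rnormE. Qed.

Lemma rnormD x y : rnorm (x + y) <= rnorm x + rnorm y.
Proof. by rewrite -lecR rmorphD /= -!rnormE ler_normD. Qed.

Lemma rnorm0 : rnorm (0 : V) = 0.
Proof. by rewrite /rnorm normr0. Qed.

Lemma rnorm_eq0 x : rnorm x = 0 -> x = 0.
Proof. by move=> x0; apply/normr0_eq0; rewrite rnormE x0. Qed.

Lemma rnormN x : rnorm (- x) = rnorm x.
Proof. by rewrite /rnorm normrN. Qed.
End RealNorm.

Lemma rnormZ {R : realType} {V : normedModType R[i]} (a : R[i]) (x : V) :
  rnorm (a *: x) = rnorm a * rnorm x.
Proof.
by apply/(@complexI R); rewrite rmorphM /= -!rnormE normrZ.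
Qed.

Lemma rnormM {R : realType} (a b : R[i]) : rnorm (a * b) = rnorm a * rnorm b.
Proof. by apply/(@complexI R); rewrite rmorphM /= -!rnormE normrM. Qed.

Section Ell1.
Context {R : realType} {J : choiceType}.
Implicit Types a b : J -> R[i].

Definition ell1_pred : {pred J -> R[i]} :=
  fun a => `[< summable setT (fun j => (rnorm (a j))%:E) >].

Lemma ell1P a : a \in ell1_pred <-> (\esum_(j in setT) (rnorm (a j))%:E < +oo)%E.
Proof.
have e : \esum_(j in setT) `|(rnorm (a j))%:E|%E = \esum_(j in setT) (rnorm (a j))%:E.
  by apply: eq_esum => j _; rewrite gee0_abs// lee_fin rnorm_ge0.
by split => [/asboolP|h]; [|apply/asboolP]; rewrite /summable e.
Qed.

Lemma esum_rnormZ (k : R[i]) a :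
  (\esum_(j in setT) (rnorm (k * a j))%:E <=
   (rnorm k)%:E * \esum_(j in setT) (rnorm (a j))%:E)%E.
Proof.
apply: ge_ereal_sup => _ [X [finX XI]] <-.
under eq_fsbigr do rewrite rnormM EFinM.
rewrite -ge0_mule_fsumr//; last by move=> j; rewrite lee_fin rnorm_ge0.
rewrite lee_wpmul2l ?lee_fin ?rnorm_ge0//.
by apply: ereal_sup_ubound; exists X.
Qed.

Lemma ell1_submod_closed : submod_closed ell1_pred.
Proof.
split.
  apply/ell1P; rewrite esum1// => j _.
  by rewrite rnorm0.
move=> k a b /ell1P fa /ell1P fb; apply/ell1P.
apply: (@le_lt_trans _ _ (\esum_(j in setT) ((rnorm (k * a j))%:E + (rnorm (b j))%:E))%E).
  by apply: le_esum => j _; rewrite -EFinD lee_fin rnormD.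
rewrite esumD; try by move=> *; rewrite lee_fin rnorm_ge0.
rewrite lte_add_pinfty// (le_lt_trans (esum_rnormZ _ _))//.
by rewrite lte_mul_pinfty// ?lee_fin ?rnorm_ge0.
Qed.

HB.instance Definition _ :=
  GRing.isSubmodClosed.Build _ _ ell1_pred ell1_submod_closed.

Record ell1 := Ell1 { ell1_fun :> J -> R[i] ; _ : ell1_fun \in ell1_pred }.

HB.instance Definition _ := [isSub of ell1 for ell1_fun].
HB.instance Definition _ := [Choice of ell1 by <:].
HB.instance Definition _ := [SubChoice_isSubLmodule of ell1 by <:].

Implicit Types u v : ell1.

Definition ell1_norm u : R := fine (\esum_(j in setT) (rnorm (u j))%:E).

Lemma ell1_normE u : (ell1_norm u)%:E = \esum_(j in setT) (rnorm (u j))%:E.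
Proof.
rewrite fineK// ge0_fin_numE; first by apply/ell1P; apply: valP.
by apply: esum_ge0 => j _; rewrite lee_fin rnorm_ge0.
Qed.

Lemma ell1_normD u v : (ell1_norm (u + v))%:C%C <= (ell1_norm u)%:C%C + (ell1_norm v)%:C%C.
Proof.
rewrite -rmorphD lecR -lee_fin EFinD !ell1_normE -esumD; last 2 first.
- by move=> *; rewrite lee_fin rnorm_ge0.
- by move=> *; rewrite lee_fin rnorm_ge0.
by apply: le_esum => j _; rewrite -EFinD lee_fin rnormD.
Qed.

Lemma ell1_normZ (k : R[i]) u :
  (ell1_norm (k *: u))%:C%C = `|k| * (ell1_norm u)%:C%C.
Proof.
have le (l : R[i]) w : ell1_norm (l *: w) <= rnorm l * ell1_norm w.
  by rewrite -lee_fin EFinM !ell1_normE esum_rnormZ.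
rewrite rnormE -rmorphM /=; congr (_%:C)%C; apply/eqP; rewrite eq_le le /=.
have [->|k0] := eqVneq k 0.
  rewrite rnorm0 mul0r -lee_fin ell1_normE; apply: esum_ge0 => j _.
  by rewrite lee_fin rnorm_ge0.
rewrite -{1}[u](scalerK k0).
have rk0 : 0 < rnorm k.
  by rewrite lt_neqAle rnorm_ge0 andbT eq_sym; apply: contra_neq k0 => /rnorm_eq0.
have rV : rnorm k^-1 = (rnorm k)^-1.
  apply: (@mulfI _ (rnorm k)); first by rewrite gt_eqF.
  by rewrite -rnormM mulfV// mulfV ?gt_eqF// /rnorm normr1.
by rewrite -ler_pdivlMl// -rV.
Qed.

Lemma ell1_norm0_eq0 u : (ell1_norm u)%:C%C = 0 -> u = 0.
Proof.
move=> /complexI u0; apply/val_inj/funext => j /=; apply/rnorm_eq0/eqP.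
rewrite eq_le rnorm_ge0 andbT -lee_fin -[0]u0 ell1_normE.
apply: esum_ge; exists [set j]; last by rewrite fsbig_set1.
by split => //; exact: finite_set1.
Qed.

HB.instance Definition _ := @Lmodule_isNormed.Build R[i] ell1
  (fun u => (ell1_norm u)%:C%C) ell1_normD ell1_normZ ell1_norm0_eq0.

Lemma rnorm_ell1E u : rnorm u = ell1_norm u.
Proof. by []. Qed.

End Ell1.
Arguments ell1 R J : clear implicits.

Section Ell1Maps.
Context {R : realType} {I J : choiceType} (i : I -> J)
  (inj_i : injective i).

Let reindex (a : J -> \bar R) : (forall j, 0 <= a j)%E ->
  \esum_(k in setT) a (i k) = \esum_(j in range i) a j.
Proof.
move=> a0; rewrite (@reindex_esum _ _ _ setT (range i) i)//.
by apply: inj_bij => x y _ _; exact: inj_i.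
Qed.

Definition restr_seq (a : J -> R[i]) : I -> R[i] := a \o i.

Lemma esum_restr_le (a : J -> R[i]) :
  (\esum_(k in setT) (rnorm (restr_seq a k))%:E <=
   \esum_(j in setT) (rnorm (a j))%:E)%E.
Proof.
rewrite (@reindex (fun j => (rnorm (a j))%:E)); last first.
  by move=> j; rewrite lee_fin rnorm_ge0.
rewrite esum_mkcond; apply: le_esum => j _.
by case: ifP => // _; rewrite lee_fin rnorm_ge0.
Qed.

Definition ext_seq (a : I -> R[i]) (j : J) : R[i] :=
  if pselect (exists k, i k = j) is left h then a (projT1 (cid h)) else 0.

Lemma ext_seqE a k : ext_seq a (i k) = a k.
Proof.
rewrite /ext_seq; case: pselect => [h|]; last by case; exists k.
by case: cid => l /= /inj_i ->.
Qed.

Lemma ext_seq0 a j : ~ range i j -> ext_seq a j = 0.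
Proof.
by rewrite /ext_seq; case: pselect => // h nij; case: nij; case: h => k <-; exists k.
Qed.

Lemma esum_ext (a : I -> R[i]) :
  \esum_(j in setT) (rnorm (ext_seq a j))%:E = \esum_(k in setT) (rnorm (a k))%:E.
Proof.
transitivity (\esum_(j in range i) (rnorm (ext_seq a j))%:E).
  rewrite [RHS]esum_mkcond; apply: eq_esum => j _; case: ifPn => //.
  by rewrite notin_setE => /ext_seq0 ->; rewrite rnorm0.
rewrite -(@reindex (fun j => (rnorm (ext_seq a j))%:E)); last first.
  by move=> j; rewrite lee_fin rnorm_ge0.
by apply: eq_esum => k _; rewrite ext_seqE.
Qed.

Lemma restr_ell1_subproof (u : ell1 R J) : restr_seq (ell1_fun u) \in ell1_pred.
Proof.
apply/ell1P/(le_lt_trans (esum_restr_le _)).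
by apply/ell1P; apply: valP.
Qed.

Lemma ext_ell1_subproof (u : ell1 R I) : ext_seq (ell1_fun u) \in ell1_pred.
Proof. by apply/ell1P; rewrite esum_ext; apply/ell1P; apply: valP. Qed.

(* Cut-off and extension by zero along the injection [i]. *)
Definition restr_ell1 (u : ell1 R J) : ell1 R I := Ell1 (restr_ell1_subproof u).
Definition ext_ell1 (u : ell1 R I) : ell1 R J := Ell1 (ext_ell1_subproof u).

Lemma restr_ell1_is_linear : linear restr_ell1.
Proof. by move=> k u v; apply/val_inj/funext. Qed.

Lemma ext_ell1_is_linear : linear ext_ell1.
Proof.
move=> k u v; apply/val_inj/funext => j /=; rewrite /ext_seq.
rewrite [RHS](_ : _ = k * ext_seq u j + ext_seq v j)//= /ext_seq.
by case: pselect => // _; rewrite mulr0 addr0.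
Qed.

HB.instance Definition _ := GRing.isLinear.Build R[i] (ell1 R J) (ell1 R I)
  *:%R restr_ell1 restr_ell1_is_linear.
HB.instance Definition _ := GRing.isLinear.Build R[i] (ell1 R I) (ell1 R J)
  *:%R ext_ell1 ext_ell1_is_linear.

Lemma rnorm_restr_ell1 u : rnorm (restr_ell1 u) <= rnorm u.
Proof. by rewrite !rnorm_ell1E -lee_fin !ell1_normE esum_restr_le. Qed.

Lemma rnorm_ext_ell1 u : rnorm (ext_ell1 u) = rnorm u.
Proof. by rewrite !rnorm_ell1E; apply/EFin_inj; rewrite !ell1_normE esum_ext. Qed.

Lemma rnorm_ext_ell1_le u : rnorm (ext_ell1 u) <= rnorm u.
Proof. by rewrite rnorm_ext_ell1. Qed.

End Ell1Maps.

Definition simple_fun {R : realType} {T : Type} (s : R -> T) :=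
  finite_set (range s) /\ forall y, measurable (s @^-1` [set y]).

Section StrongMeasurability.
Context {R : realType} {E : normedModType R[i]}.
Implicit Types f g s : R -> E.

(* The limit is required everywhere on D: every function that is an a.e. limit
   of simple functions is a.e. equal to such a function, so the classes modulo
   a.e. equality are the usual ones. *)
Definition strongly_measurable (D : set R) f :=
  exists s : nat -> R -> E, (forall n, simple_fun (s n)) /\
    forall x, D x -> s ^~ x @ \oo --> f x.

Lemma simple_fun_cst (y : E) : simple_fun (cst y : R -> E).
Proof.
split; first by apply: (@sub_finite_set _ _ [set y]); [move=> _ [x _ <-]|exact: finite_set1].
move=> z; rewrite preimage_cst; case: ifP => _; [exact: measurableT|exact: measurable0].
Qed.

Lemma simple_fun_preimage s (A : set E) : simple_fun s -> measurable (s @^-1` A).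
Proof.
move=> [fs ms].
rewrite (_ : s @^-1` A = \bigcup_(y in range s `&` A) (s @^-1` [set y])).
  by apply: fin_bigcup_measurable => //; exact: finite_setIl.
apply/seteqP; split => [x Ax|x [y [_ Ay] /= sxy]]; last by rewrite sxy.
by exists (s x) => //; split.
Qed.

Lemma simple_fun_comp (T : Type) (h : E -> T) s :
  simple_fun s -> simple_fun (h \o s).
Proof.
move=> ss; split.
  rewrite (_ : range _ = h @` range s); last by rewrite image_comp.
  by apply: finite_image; case: ss.
by move=> y; rewrite comp_preimage; exact: simple_fun_preimage.
Qed.

Lemma simple_fun_lin (k : R[i]) s t : simple_fun s -> simple_fun t ->
  simple_fun (k *: s + t).
Proof.
move=> ss st; have [fs ms] := ss; have [ft mt] := st; split.
  apply: (@sub_finite_set _ _ ((fun p => k *: p.1 + p.2) @` (range s `*` range t))).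
    by move=> _ [x _ <-]; exists (s x, t x) => //; split; exists x.
  by apply: finite_image; exact: finite_setX.
move=> y; rewrite (_ : _ @^-1` _ = \bigcup_(z in range s)
    (s @^-1` [set z] `&` t @^-1` [set y - k *: z])).
  by apply: fin_bigcup_measurable => // z _; exact: measurableI.
apply/seteqP; split => [x /= <-|x [z _ [/= sx tx]]].
  exists (s x) => //; split => //=.
  by change (t x = k *: s x + t x - k *: s x); rewrite addrC addKr.
by change (k *: s x + t x = y); rewrite sx tx addrC subrK.
Qed.

Lemma strongly_measurable_lin (D : set R) (k : R[i]) f g :
  strongly_measurable D f -> strongly_measurable D g ->
  strongly_measurable D (k *: f + g).
Proof.
move=> [s [ss sf]] [t [st tg]]; exists (fun n => k *: s n + t n); split.
  by move=> n; exact: simple_fun_lin.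
move=> x Dx; apply: cvgD; last exact: tg.
by apply: cvgZr; exact: sf.
Qed.

Lemma cvg_rnorm (u : nat -> E) (v : E) :
  u @ \oo --> v -> (fun n => rnorm (u n)) @ \oo --> rnorm v.
Proof.
move=> uv; apply/cvgrPdist_lt => e e0.
have e0' : 0 < (e%:C)%C :> R[i] by rewrite ltcR.
move/cvgrPdist_lt: uv => /(_ _ e0'); apply: filterS => n.
rewrite rnormE ltcR; apply: le_lt_trans.
rewrite ler_distlC; apply/andP; split.
  rewrite lerBlDl; have := rnormD (u n) (v - u n).
  by rewrite subrKC addrC.
rewrite -(rnormN (v - u n)) opprB.
by have := rnormD v (u n - v); rewrite subrKC.
Qed.

Lemma measurable_rnorm (D : set R) f : measurable D -> strongly_measurable D f ->
  measurable_fun D (fun x => rnorm (f x)).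
Proof.
move=> mD [s [ss sf]].
apply: (@measurable_fun_cvg _ _ _ _ (fun n x => rnorm (s n x))); last first.
  by move=> x Dx; apply: cvg_rnorm; exact: sf.
move=> n; apply: measurable_funS (@subsetT _ _) _ => // _ B mB; rewrite setTI.
by rewrite (_ : _ @^-1` B = s n @^-1` [set y | B (rnorm y)])//;
  exact: simple_fun_preimage.
Qed.

End StrongMeasurability.

Local Open Scope quotient_scope.

Section BochnerL1.
Context {R : realType} {E : normedModType R[i]}.
Local Notation mu := (@lebesgue_measure R).
Local Notation I01 := (`[0%R, 1%R]%classic : set R).
Implicit Types f g : R -> E.

Definition norm_integral f : \bar R := \int[mu]_(x in I01) (rnorm (f x))%:E.

Definition L1_pred : {pred R -> E} :=
  fun f => `[< strongly_measurable I01 f /\ (norm_integral f < +oo)%E >].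

Let mI01 : measurable (I01 : set R).
Proof. exact: measurable_itv. Qed.

Lemma measurable_rnormE f : strongly_measurable I01 f ->
  measurable_fun I01 (fun x => (rnorm (f x))%:E).
Proof. by move=> mf; apply/measurable_EFinP; exact: measurable_rnorm. Qed.

Lemma norm_integral_ge0 f : (0 <= norm_integral f)%E.
Proof. by apply: integral_ge0 => x _; rewrite lee_fin rnorm_ge0. Qed.

Lemma norm_integralZ (k : R[i]) f : strongly_measurable I01 f ->
  norm_integral (k *: f) = ((rnorm k)%:E * norm_integral f)%E.
Proof.
move=> mf; rewrite /norm_integral -ge0_integralZl_EFin ?rnorm_ge0//.
- by apply: eq_integral => x _; rewrite rnormZ EFinM.
- by move=> x _; rewrite lee_fin rnorm_ge0.
- exact: measurable_rnormE.
Qed.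

Lemma norm_integralD f g :
  strongly_measurable I01 f -> strongly_measurable I01 g ->
  (norm_integral (f + g)%R <= norm_integral f + norm_integral g)%E.
Proof.
move=> mf mg; rewrite /norm_integral -ge0_integralD//; last 4 first.
- by move=> x _; rewrite lee_fin rnorm_ge0.
- exact: measurable_rnormE.
- by move=> x _; rewrite lee_fin rnorm_ge0.
- exact: measurable_rnormE.
apply: ge0_le_integral => //.
- by move=> x _; rewrite lee_fin rnorm_ge0.
- by apply: measurable_rnormE; rewrite -[f]scale1r; exact: strongly_measurable_lin.
- by apply: emeasurable_funD; exact: measurable_rnormE.
- by move=> x _; rewrite -EFinD lee_fin rnormD.
Qed.

Lemma L1_submod_closed : submod_closed L1_pred.
Proof.
split.
  apply/asboolP; split.
    by exists (fun=> cst 0); split => [n|x _]; [exact: simple_fun_cst|exact: cvg_cst].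
  rewrite /norm_integral (eq_integral (cst 0%E)) ?integral0 ?ltry//.
  by move=> x _; rewrite rnorm0.
move=> k f g /asboolP[mf If] /asboolP[mg Ig]; apply/asboolP; split.
  exact: strongly_measurable_lin.
have mkf : strongly_measurable I01 (k *: f).
  rewrite -[k *: f]addr0; apply: strongly_measurable_lin => //.
  by exists (fun=> cst 0); split => [n|x _]; [exact: simple_fun_cst|exact: cvg_cst].
rewrite (le_lt_trans (norm_integralD mkf mg))// norm_integralZ//.
by rewrite lte_add_pinfty// lte_mul_pinfty// lee_fin rnorm_ge0.
Qed.

HB.instance Definition _ :=
  GRing.isSubmodClosed.Build _ _ L1_pred L1_submod_closed.

(* Bochner integrable functions on [0, 1]; the values outside [0, 1] are
   irrelevant. *)
Record L1fun := MkL1fun { L1fun_fun :> R -> E ; _ : L1fun_fun \in L1_pred }.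

HB.instance Definition _ := [isSub of L1fun for L1fun_fun].
HB.instance Definition _ := [Choice of L1fun by <:].
HB.instance Definition _ := [SubChoice_isSubLmodule of L1fun by <:].

Lemma L1fun_measurable (f : L1fun) : strongly_measurable I01 f.
Proof. by have /asboolP[] := valP f. Qed.

Lemma L1fun_lty (f : L1fun) : (norm_integral f < +oo)%E.
Proof. by have /asboolP[] := valP f. Qed.

Lemma L1fun_fineK (f : L1fun) : (fine (norm_integral f))%:E = norm_integral f.
Proof. by rewrite fineK// ge0_fin_numE ?L1fun_lty ?norm_integral_ge0. Qed.

Definition ae_null : {pred L1fun} :=
  fun f : L1fun => `[< {ae mu, forall x, I01 x -> f x = 0} >].



Lemma ae_null_submod_closed : submod_closed ae_null.
Proof.
split; first by apply/asboolP; exact: aeW.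
move=> k f g /asboolP f0 /asboolP g0; apply/asboolP.
apply: (@filterS2 _ _ (ae_filter_ringOfSetsType mu) _ _ _ _ f0 g0) => x {}f0 {}g0 Ix.
by change (k *: f x + g x = 0); rewrite f0// g0// scaler0 addr0.
Qed.

HB.instance Definition _ :=
  GRing.isSubmodClosed.Build _ _ ae_null ae_null_submod_closed.

Lemma ae_nullP (f : L1fun) : reflect (norm_integral f = 0)%E (f \in ae_null).
Proof.
apply: (iffP idP) => [/asboolP f0|f0].
  rewrite /norm_integral (ae_eq_integral (cst 0%E))// ?integral0//.
  - exact: (measurable_rnormE (L1fun_measurable f)).
  - apply: (@filterS _ _ (ae_filter_ringOfSetsType mu) _ _ _ f0) => x {}f0 Ix.
    by rewrite f0// rnorm0.
apply/asboolP.
have := (ae_eq_integral_abs mu mI01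
  (measurable_rnormE (L1fun_measurable f))).1.
have -> : (\int[mu]_(x in I01) `|(rnorm (f x))%:E|)%E = norm_integral f.
  by apply: eq_integral => x _; rewrite gee0_abs// lee_fin rnorm_ge0.
move=> /(_ f0); apply: (@filterS _ _ (ae_filter_ringOfSetsType mu)) => x h Ix.
by have [] := h Ix; exact: rnorm_eq0.
Qed.

(* L^1([0, 1], E): integrable functions modulo equality almost everywhere. *)
Definition L1 := @Quotient.quot L1fun ae_null.

HB.instance Definition _ := Choice.on L1.
HB.instance Definition _ := EqQuotient.on L1.
HB.instance Definition _ := GRing.Zmodule.on L1.

Definition L1_of (f : L1fun) : L1 := \pi_L1 f.

Lemma L1_ofP (f g : L1fun) : L1_of f = L1_of g <->
  {ae mu, forall x, I01 x -> f x = g x}.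
Proof.
have -> : (L1_of f = L1_of g) <-> (f - g \in ae_null).
  by rewrite Quotient.idealrBE; split => [/eqP|/eqP].
split => [/asboolP|h]; last apply/asboolP.
  apply: (@filterS _ _ (ae_filter_ringOfSetsType mu)) => x h Ix.
  by apply/eqP; rewrite -subr_eq0; apply/eqP; exact: h.
apply: (@filterS _ _ (ae_filter_ringOfSetsType mu) _ _ _ h) => x {}h Ix.
by change (f x - g x = 0); rewrite h// subrr.
Qed.

Lemma L1_reprK (q : L1) : L1_of (repr q) = q.
Proof. exact: reprK. Qed.

Lemma L1_ofD (f g : L1fun) : L1_of (f + g) = L1_of f + L1_of g.
Proof. by rewrite /L1_of !piE. Qed.


Lemma norm_integral_ae (f g : L1fun) : L1_of f = L1_of g ->
  norm_integral f = norm_integral g.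
Proof.
move/L1_ofP => fg; apply: ae_eq_integral => //.
- exact: (measurable_rnormE (L1fun_measurable f)).
- exact: (measurable_rnormE (L1fun_measurable g)).
apply: (@filterS _ _ (ae_filter_ringOfSetsType mu) _ _ _ fg) => x {}fg Ix.
by rewrite fg.
Qed.

Definition L1_scale (k : R[i]) (q : L1) : L1 := L1_of (k *: repr q).

Lemma L1_scale_of (k : R[i]) (f : L1fun) : L1_scale k (L1_of f) = L1_of (k *: f).
Proof.
have /L1_ofP h := L1_reprK (L1_of f); apply/L1_ofP.
apply: (@filterS _ _ (ae_filter_ringOfSetsType mu) _ _ _ h) => x {}h Ix.
by change (k *: (repr (L1_of f) : L1fun) x = k *: f x); rewrite h.
Qed.

Lemma L1_scaleA (a b : R[i]) (q : L1) :
  L1_scale a (L1_scale b q) = L1_scale (a * b) q.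
Proof. by rewrite -[q]L1_reprK !L1_scale_of scalerA. Qed.

Lemma L1_scale1 : left_id 1 L1_scale.
Proof. by move=> q; rewrite -[q]L1_reprK !L1_scale_of scale1r. Qed.

Lemma L1_scaleDr : right_distributive L1_scale +%R.
Proof.
move=> a p q; rewrite -[p]L1_reprK -[q]L1_reprK.
by rewrite -L1_ofD !L1_scale_of scalerDr L1_ofD.
Qed.

Lemma L1_scaleDl (q : L1) : {morph L1_scale^~ q : a b / a + b}.
Proof.
by move=> a b; rewrite -[q]L1_reprK !L1_scale_of scalerDl L1_ofD.
Qed.

HB.instance Definition _ := GRing.Zmodule_isLmodule.Build R[i] L1
  L1_scaleA L1_scale1 L1_scaleDr L1_scaleDl.

Lemma L1_ofZ (k : R[i]) (f : L1fun) : L1_of (k *: f) = k *: L1_of f.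
Proof. by rewrite -L1_scale_of. Qed.

Definition L1_norm (q : L1) : R := fine (norm_integral (repr q)).

Lemma L1_norm_of (f : L1fun) : (L1_norm (L1_of f))%:E = norm_integral f.
Proof. by rewrite L1fun_fineK; apply: norm_integral_ae; exact: L1_reprK. Qed.

Lemma L1_normD (p q : L1) :
  (L1_norm (p + q))%:C%C <= (L1_norm p)%:C%C + (L1_norm q)%:C%C.
Proof.
rewrite -rmorphD lecR -lee_fin EFinD -[p]L1_reprK -[q]L1_reprK -L1_ofD.
by rewrite !L1_norm_of norm_integralD//; exact: L1fun_measurable.
Qed.

Lemma L1_normZ (k : R[i]) (q : L1) :
  (L1_norm (k *: q))%:C%C = `|k| * (L1_norm q)%:C%C.
Proof.
rewrite rnormE -rmorphM /=; congr (_%:C)%C; apply/EFin_inj.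
rewrite EFinM -[q]L1_reprK -L1_ofZ !L1_norm_of norm_integralZ//.
exact: L1fun_measurable.
Qed.

Lemma L1_norm0_eq0 (q : L1) : (L1_norm q)%:C%C = 0 -> q = 0.
Proof.
rewrite -[q]L1_reprK => /complexI q0.
have /ae_nullP/asboolP h : norm_integral (repr q : L1fun) = 0%E.
  by rewrite -L1_norm_of q0.
have -> : 0 = L1_of 0 by rewrite /L1_of piE.
by apply/L1_ofP.
Qed.

HB.instance Definition _ := @Lmodule_isNormed.Build R[i] L1
  (fun q => (L1_norm q)%:C%C) L1_normD L1_normZ L1_norm0_eq0.

Lemma rnorm_L1 (f : L1fun) : (rnorm (L1_of f))%:E = norm_integral f.
Proof. exact: L1_norm_of. Qed.

End BochnerL1.

Arguments L1fun {R} E.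
Arguments L1 {R} E.

Section L1Map.
Context {R : realType} {E F : normedModType R[i]} (L : {linear E -> F})
  (cL : forall y, rnorm (L y) <= rnorm y).
Local Notation I01 := (`[0%R, 1%R]%classic : set R).

Lemma contraction_cvg (u : nat -> E) (v : E) :
  u @ \oo --> v -> (L \o u) @ \oo --> L v.
Proof.
move=> /cvgrPdist_lt uv; apply/cvgrPdist_lt => e /uv; apply: filterS => n.
apply: le_lt_trans; rewrite /= -linearB /=.
by rewrite (rnormE (L _)) (rnormE (v - u n)) lecR.
Qed.

Lemma L1_map_subproof (f : L1fun E) : L \o f \in L1_pred.
Proof.
have mLf : strongly_measurable I01 (L \o f).
  have [s [ss sf]] := L1fun_measurable f.
  exists (fun n => L \o s n); split => [n|x Ix]; first exact: simple_fun_comp.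
  exact: contraction_cvg (sf x Ix).
apply/asboolP; split => //; apply: le_lt_trans (L1fun_lty f).
apply: ge0_le_integral => //.
- by move=> x _; rewrite lee_fin rnorm_ge0.
- exact: (measurable_rnormE mLf).
- exact: (measurable_rnormE (L1fun_measurable f)).
- by move=> x _; rewrite lee_fin cL.
Qed.

Definition L1fun_map (f : L1fun E) : L1fun F := MkL1fun (L1_map_subproof f).

(* The operator f |-> L \o f induced on L^1 by a linear contraction L. *)
Definition L1_map (q : L1 E) : L1 F := L1_of (L1fun_map (repr q)).

Lemma L1_map_of (f : L1fun E) : L1_map (L1_of f) = L1_of (L1fun_map f).
Proof.
have /L1_ofP h := L1_reprK (L1_of f); apply/L1_ofP.
apply: (@filterS _ _ (ae_filter_ringOfSetsType _) _ _ _ h) => x {}h Ix.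
by change (L ((repr (L1_of f) : L1fun E) x) = L (f x)); rewrite h.
Qed.

End L1Map.

Section BochnerIntegral.
Context {R : realType} {E : normedModType R[i]}.
Local Notation mu := (@lebesgue_measure R).

Definition simple_integral (A : set R) (s : R -> E) : E :=
  \sum_(y \in range s) ((fine (mu (A `&` s @^-1` [set y])))%:C)%C *: y.

(* [bochner_integral A f v]: f is Bochner integrable on A, with integral v. *)
Definition bochner_integral (A : set R) (f : R -> E) (v : E) :=
  exists s : nat -> R -> E, [/\ forall n, simple_fun (s n),
    (\int[mu]_(x in A) (rnorm (f x - s n x))%:E)%E @[n --> \oo] --> 0%E &
    simple_integral A (s n) @[n --> \oo] --> v].

(* The elements of W^{1,1}([0, 1], E) are the (classes of) primitives of Bochner
   integrable functions: [u] is the absolutely continuous representative, for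
   which the values at 0 and 1 make sense, and [h] its weak derivative. *)
Definition W11_derivative (u h : L1fun E) :=
  forall x : R, 0 <= x <= 1 -> bochner_integral `[0, x] h (u x - u 0).

End BochnerIntegral.

Section Semigroups.
Context {R : realType} {X : normedModType R[i]}.
Implicit Types (T : R -> X -> X) (A : X -> X -> Prop).

Record C0_semigroup T : Prop := {
  C0_linear : forall t, 0 <= t -> linear (T t) ;
  C0_bounded : forall t, 0 <= t -> continuous (T t) ;
  C0_id : forall x, T 0 x = x ;
  C0_comp : forall s t, 0 <= s -> 0 <= t -> forall x, T (s + t) x = T s (T t x) ;
  C0_continuous : forall x, {within `[0, +oo[, continuous (T ^~ x)}
}.

(* Unbounded operators are given by their graphs: [A x y] means that x is in
   D(A) and that A x = y. *)
Definition generator T : X -> X -> Prop := fun x y =>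
  ((h^-1)%:C)%C *: (T h x - x) @[h --> 0^'+] --> y.

Definition generates A T :=
  C0_semigroup T /\ forall x y, A x y <-> generator T x y.

End Semigroups.

(* Edges are pairs of vertices, so there are no multiple edges. *)
Record digraph := Digraph { vertex :> countType ; arc : rel vertex }.

Definition edge (G : digraph) := {e : G * G | arc e.1 e.2}.

Definition tail (G : digraph) (e : edge G) : G := (val e).1.
Definition head (G : digraph) (e : edge G) : G := (val e).2.

Definition simple_digraph (G : digraph) := forall v : G, ~~ arc v v.

Definition finite_digraph (G : digraph) := finite_set [set: G].

Definition uniformly_locally_finite (G : digraph) :=
  exists k : nat, forall v : G, ([set e : edge G | tail e = v] #<= `I_k)%card.

Definition graph_hom (G H : digraph) (f : G -> H) :=
  forall v w, arc v w -> arc (f v) (f w).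

Record embedding (G H : digraph) := Embedding {
  embedding_fun :> G -> H ;
  embedding_hom : graph_hom embedding_fun ;
  embedding_inj : injective embedding_fun }.

Section EdgeMap.
Context (G H : digraph) (f : embedding G H).

Definition edge_map (e : edge G) : edge H :=
  exist _ (f (tail e), f (head e)) (embedding_hom f (valP e)).

Lemma edge_map_inj : injective edge_map.
Proof.
move=> e e' /(congr1 val) [] /embedding_inj tt /embedding_inj hh; apply/val_inj.
by rewrite [LHS]surjective_pairing [RHS]surjective_pairing; congr pair.
Qed.

End EdgeMap.

(* [psi] exhibits [G] as the direct limit of [Gs 0 -> Gs 1 -> ...] in the
   category of directed graphs and graph homomorphisms. *)
Definition direct_limit (Gs : nat -> digraph)
    (phi : forall n, embedding (Gs n) (Gs n.+1))
    (G : digraph) (psi : forall n, embedding (Gs n) G) :=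
  (forall n v, psi n.+1 (phi n v) = psi n v) /\
  forall (H : digraph) (chi : forall n, Gs n -> H),
    (forall n, graph_hom (chi n)) ->
    (forall n v, chi n.+1 (phi n v) = chi n v) ->
    exists! u : G -> H, graph_hom u /\ forall n v, u (psi n v) = chi n v.

Section Transport.
Context {R : realType} {G : digraph} (c : edge G -> R).

(* Edges are their own labels: l^1(J) is [ell1 R (edge G)], and for a finite
   graph with N edges it is C^N with the l^1-norm. *)
Definition line_adjacency (i j : edge G) : R[i] := (head j == tail i)%:R.

(* C^{-1} B C with C = diag(c_j) *)
Definition weighted_adjacency (i j : edge G) : R[i] :=
  (((c i)%:C)^-1 * line_adjacency i j * (c j)%:C)%C.

(* [matrix_apply M a b]: the matrix M maps the vector a to b, every row being
   an unconditionally convergent series. *)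
Definition matrix_apply (J : choiceType) (M : J -> J -> R[i]) (a b : J -> R[i]) :=
  forall i, summability.partial_sum (fun j => M i j * a j : R[i]^o)
    @ summability.totally --> (b i : R[i]^o).

(* diag(c_j d/dx) on {f in W^{1,1} | f(1) = (C^{-1} B C) f(0)} *)
Definition transport_op (f g : L1 (ell1 R (edge G))) :=
  exists u h k : L1fun (ell1 R (edge G)),
    [/\ f = L1_of u, W11_derivative u h,
        matrix_apply weighted_adjacency (u 0) (u 1), g = L1_of k &
        forall (x : R) j, 0 <= x <= 1 -> k x j = ((c j)%:C)%C * h x j].

End Transport.

Section ConnectingOperators.
Context {R : realType} {G H : digraph} (f : embedding G H).

Definition extension_op : L1 (ell1 R (edge G)) -> L1 (ell1 R (edge H)) :=
  L1_map (L := ext_ell1 (edge_map_inj (f := f)))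
    (rnorm_ext_ell1_le _).

Definition cutoff_op : L1 (ell1 R (edge H)) -> L1 (ell1 R (edge G)) :=
  L1_map (L := restr_ell1 (edge_map_inj (f := f))) (rnorm_restr_ell1 _).

End ConnectingOperators.

(* Main.v *)
Require Import Defs.
From mathcomp Require Import all_boot all_order all_algebra.
From mathcomp Require Import finmap complex.
From mathcomp Require Import all_classical all_reals all_analysis.
From mathcomp Require Import measurable_realfun ring lra.
From mathcomp.analysis.showcase Require summability.
Set Implicit Arguments. Unset Strict Implicit. Unset Printing Implicit Defensive.
Import Order.TTheory GRing.Theory Num.Theory.
Import numFieldNormedType.Exports.
Local Open Scope classical_set_scope.
Local Open Scope ring_scope.

(** The proof compares the two semigroups directly, by one energy estimate.

Fix n, let E extend functions on the edges of the n-th graph by zero, and let k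
bound the out-degrees in the limit graph.  With the weight w(x) = 1 + 2k(1 - x)
the energy of a state f on the limit graph and a state y on the n-th graph is
the sum over all edges j of the integrals over [0, 1] of

    w |f_j - (E y)_j| + rho_j w |(E y)_j|,

where rho_j = 2^-m if m is the least number of steps leading from j to an edge
outside the n-th graph (and rho_j = 0 if there is none).  It has three
properties.

- It dominates the norm of f - E y, since w >= 1.

- If f and y evolve by the two transport equations, it grows at most like
  exp(2kMt).  In the interior of an edge the weight w costs the factor 2kM and
  produces at the end 0, through which the edges are left, a gain 1 + 2k against
  the loss 1 at the end 1.  At a vertex each edge feeds at most k edges, on which
  rho is at most twice as large, so that the inflow is at most 2k times the
  outflow.  The one place where the two equations differ, namely mass that leaves
  the n-th graph in the limit graph only, is paid for by the term with rho,
  because rho = 1 on the edges outside.  This is [energy_dissipative], resting on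
  [coordinate_transport_inequality] on each edge and [vertex_flux] at the
  vertices.  It is turned into exponential growth by [dissipative_growth]: for
  orbits starting in the domains this is a Gronwall argument for a right Dini
  derivative, and for the others it follows by density of the domains
  ([transport_op_dense]).

- On the pair (x, P x), where P cuts x off to the n-th graph, the two terms
  combine to the sum of rho_j times the weighted norm of x_j ([energy_cutoff]).
  As n grows, the n-th graph swallows every finite set of edges, such as the set of
  those within m steps of j.  Hence rho_j tends to 0 for every j ([decay_cvg0]), and
  the sum tends to 0 by dominated convergence ([wnorm_cvg0]).

Together these bound the error up to time b by exp(2kMb) times a null sequence. *)

(** * Real linear forms of Bochner integrals *)

Section RealForm.
Context {R : realType} {E : normedModType R[i]}.
Local Notation mu := (@lebesgue_measure R).

(** Real-linear forms that are dominated by the norm.  Scalar real integration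
theory applies after composition with such a form, and the forms Re (e a_j) with
|e| <= 1 separate the points of l^1; this is how all Bochner integrals below are
reduced to Lebesgue integrals. *)
Definition real_form (l : E -> R) :=
  (forall (r : R) a b, l (r%:C%C *: a + b) = r * l a + l b) /\
  (forall a, l a <= rnorm a).

(** The simple functions converging to f are mapped to real measurable functions
converging to g \o f. *)
Lemma lipschitz_measurable (D : set R) (f : R -> E) (g : E -> R) :
  measurable D -> (forall a b, `|g a - g b| <= rnorm (a - b)) ->
  strongly_measurable D f -> measurable_fun D (g \o f).
Proof.
move=> mD lipg [s [ss sf]].
apply: (@measurable_fun_cvg _ _ _ _ (fun n x => g (s n x))); last first.
  move=> x Dx; have /cvgrPdist_lt sfx := sf x Dx; apply/cvgrPdist_lt => e e0.
  have e0' : 0 < (e%:C)%C :> R[i] by rewrite ltcR.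
  move: (sfx _ e0'); apply: filterS => n; rewrite rnormE ltcR.
  by apply: le_lt_trans; exact: lipg.
move=> n; apply: measurable_funS (@subsetT _ _) _ => // _ B mB; rewrite setTI.
by rewrite (_ : _ @^-1` B = s n @^-1` [set y | B (g y)])//;
  exact: simple_fun_preimage.
Qed.

Lemma real_form0 l : real_form l -> l 0 = 0.
Proof.
case=> ll _; apply: (addrI (l 0)); rewrite addr0.
by have := ll 1 0 0; rewrite scaler0 addr0 mul1r.
Qed.

Lemma real_formZ l : real_form l -> forall (r : R) a, l (r%:C%C *: a) = r * l a.
Proof.
by move=> hl r a; rewrite -[_ *: _]addr0 hl.1 (real_form0 hl) addr0.
Qed.

Lemma real_formD l : real_form l -> forall a b, l (a + b) = l a + l b.
Proof. by move=> hl a b; rewrite -[a]scale1r hl.1 mul1r scale1r. Qed.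

Lemma real_formB l : real_form l -> forall a b, l (a - b) = l a - l b.
Proof.
move=> hl a b; rewrite -scaleN1r addrC.
by have := hl.1 (-1) b a; rewrite rmorphN1 mulN1r addrC => ->; rewrite addrC.
Qed.

Lemma real_form_abs l : real_form l -> forall a, `|l a| <= rnorm a.
Proof.
move=> hl a; rewrite ler_norml hl.2 andbT lerNl.
rewrite -(rnormN a); have := real_formB hl 0 a; rewrite (real_form0 hl) !sub0r.
by move=> <-; exact: hl.2.
Qed.

Lemma real_form_lip l : real_form l -> forall a b, `|l a - l b| <= rnorm (a - b).
Proof. by move=> hl a b; rewrite -real_formB// real_form_abs. Qed.

Lemma real_form_sum l (I : Type) (r : seq I) (F : I -> E) : real_form l ->
  l (\sum_(i <- r) F i) = \sum_(i <- r) l (F i).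
Proof.
move=> hl; elim: r => [|i r IH]; first by rewrite !big_nil real_form0.
by rewrite !big_cons real_formD// IH.
Qed.

Lemma simple_fun_indicE l (s : R -> E) : finite_set (range s) -> forall x,
  l (s x) = \sum_(y <- fset_set (range s)) l y * (\1_(s @^-1` [set y]) x : R).
Proof.
move=> fs x; rewrite (big_fsetD1 (s x))/=; last first.
  by rewrite in_fset_set// inE; exists x.
rewrite indicE mem_set//= mulr1 big_seq big1 ?addr0// => y.
rewrite !inE => /andP[/eqP ysx _].
by rewrite indicE memNset ?mulr0//= => h; apply: ysx.
Qed.

Lemma strongly_measurable_simple (D : set R) (s : R -> E) :
  simple_fun s -> strongly_measurable D s.
Proof. by move=> ss; exists (fun=> s); split => // x _; exact: cvg_cst. Qed.

Lemma integrable_cindic (k : R) (A B : set R) : measurable A -> measurable B ->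
  (mu A < +oo)%E -> mu.-integrable A (EFin \o (fun x => k * (\1_B x : R))).
Proof.
move=> mA mB muA; apply: measurable_bounded_integrable => //.
  by apply: measurable_funM => //; exact: measurable_indic.
exists `|k|; split; first exact: normr_real.
move=> M /ltW kM x _ /=; rewrite normrM indicE (le_trans _ kM)//.
by rewrite ler_piMr//; case: (_ \in _); rewrite /= ?normr1 ?normr0.
Qed.

Lemma integrable_simple l (A : set R) (s : R -> E) : measurable A ->
  (mu A < +oo)%E -> simple_fun s -> mu.-integrable A (EFin \o (l \o s)).
Proof.
move=> mA muA [fs ms].
rewrite (_ : _ \o _ = fun x => (\sum_(y <- fset_set (range s))
   (l y * (\1_(s @^-1` [set y]) x : R))%:E)%E); last first.
  by apply/funext => x /=; rewrite (simple_fun_indicE l fs) sumEFin.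
apply: integrable_sum => // y _.
exact: integrable_cindic.
Qed.

Lemma simple_integral_form l (A : set R) (s : R -> E) : real_form l ->
  measurable A -> (mu A < +oo)%E -> simple_fun s ->
  \int[mu]_(x in A) l (s x) = l (simple_integral A s).
Proof.
move=> hl mA muA [fs ms].
rewrite /simple_integral fsbig_finite//= real_form_sum//.
have iy y : mu.-integrable A (EFin \o (fun x => l y * (\1_(s @^-1` [set y]) x : R))).
  exact: integrable_cindic.
have iy1 y : mu.-integrable A (EFin \o (\1_(s @^-1` [set y]) : R -> R)).
  apply: eq_integrable (integrable_cindic 1 mA (ms y) muA) => // x _.
  by rewrite /= mul1r.
transitivity (fine (\int[mu]_(x in A) (\sum_(y <- fset_set (range s))
   (l y * (\1_(s @^-1` [set y]) x : R))%:E))%E).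
  congr fine; apply: eq_integral => x _.
  by rewrite (simple_fun_indicE l fs) sumEFin.
rewrite (@integral_sum _ _ _ mu A mA _ _ iy) -sum_fine; last by move=> y _; exact: (@integrable_fin_num _ _ _ mu A mA _ (iy y)).
apply: eq_bigr => y _; rewrite real_formZ// mulrC.
rewrite -[LHS]/(\int[mu]_(x in A) (l y * (\1_(s @^-1` [set y]) x : R))) RintegralZl//.
congr (_ * _); rewrite /Rintegral integral_indic//; last exact: ms.
by rewrite setIC.
Qed.

Lemma strongly_measurableB (D : set R) (f g : R -> E) :
  strongly_measurable D f -> strongly_measurable D g ->
  strongly_measurable D (fun x => f x - g x).
Proof.
move=> mf mg; rewrite (_ : (fun _ => _) = (-1) *: g + f).
  exact: strongly_measurable_lin.
by apply/funext => x; rewrite addrC; congr (_ + _); rewrite -scaleN1r.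
Qed.

Lemma integrable_form l (A : set R) (f : R -> E) : real_form l -> measurable A ->
  strongly_measurable A f -> mu.-integrable A (EFin \o (fun x => rnorm (f x))) ->
  mu.-integrable A (EFin \o (l \o f)).
Proof.
move=> hl mA mf intf; apply: le_integrable intf => //.
  by apply/measurable_EFinP; apply: lipschitz_measurable => //; exact: real_form_lip.
move=> x _ /=; rewrite lee_fin [leRHS]ger0_norm ?rnorm_ge0//.
exact: real_form_abs.
Qed.

(** Both sides are the limit of the integrals of l \o s_n, where the s_n are the
simple functions that define the Bochner integral: a form commutes with the
integral of a simple function and is dominated by the norm. *)
Lemma bochner_integral_form l (A : set R) (f : R -> E) v : real_form l ->
  measurable A -> (mu A < +oo)%E -> strongly_measurable A f ->
  mu.-integrable A (EFin \o (fun x => rnorm (f x))) ->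
  bochner_integral A f v -> \int[mu]_(x in A) l (f x) = l v.
Proof.
move=> hl mA muA mf intf [s [ss sf sv]].
have lsv : l (simple_integral A (s n)) @[n --> \oo] --> l v.
  move/cvgrPdist_lt: sv => sv; apply/cvgrPdist_lt => e e0.
  have e0' : 0 < (e%:C)%C :> R[i] by rewrite ltcR.
  move: (sv _ e0'); apply: filterS => n; rewrite rnormE ltcR.
  by apply: le_lt_trans; exact: real_form_lip.
suff h : l (simple_integral A (s n)) @[n --> \oo] --> \int[mu]_(x in A) l (f x).
  exact: (@cvg_unique _ (@Rhausdorff R) _ _ _ _ h lsv).
apply/cvgrPdist_lt => e e0.
have : \forall n \near \oo,
    (\int[mu]_(x in A) (rnorm (f x - s n x))%:E < e%:E)%E.
  have : nbhs (0%:E) [set y : \bar R | (y < e%:E)%E] by apply: (@nbhs_open_ereal_lt _ 0 (fun=> e)).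
  by move=> /sf.
apply: filterS => n.
set I := (\int[mu]_(x in A) _)%E => Ie.
have ms : strongly_measurable A (s n) by exact: strongly_measurable_simple.
have iB : mu.-integrable A (EFin \o (fun x => rnorm (f x - s n x))).
  apply/integrableP; split.
    by apply/measurable_EFinP; apply: measurable_rnorm => //; exact: strongly_measurableB.
  apply: le_lt_trans (lt_trans Ie (ltry _)).
  rewrite /I le_eqVlt; apply/orP; left; apply/eqP; apply: eq_integral => x _.
  by rewrite /= ger0_norm// rnorm_ge0.
rewrite -(simple_integral_form hl mA muA (ss n)) -RintegralB//; last 2 first.
  exact: integrable_form.
  exact: integrable_simple.
under eq_Rintegral do rewrite -real_formB//.
apply: le_lt_trans (le_normr_Rintegral _ _) _ => //.
  apply: (@integrable_form l A (fun x => f x - s n x)) => //.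
  exact: strongly_measurableB.
rewrite -lte_fin; apply: le_lt_trans Ie.
rewrite /I -[leRHS]fineK; last exact: (@integrable_fin_num _ _ _ mu A mA _ iB).
rewrite lee_fin; apply: le_Rintegral => //.
  have := integrable_abse (@integrable_form l A (fun x => f x - s n x) hl mA
    (strongly_measurableB mf ms) iB).
  by apply: eq_integrable.
by move=> x _; exact: real_form_abs.
Qed.

End RealForm.

(** * A scalar transport inequality *)

Section RealLemmas.
Context {R : realType}.
Local Notation mu := (@lebesgue_measure R).

Lemma within_itv_continuousP (G : R -> R) (a b : R) :
  {within `[a, b], continuous G} -> forall t, a <= t <= b -> forall e, 0 < e ->
  exists2 d, 0 < d & forall s, a <= s <= b -> `|s - t| < d -> `|G s - G t| < e.
Proof.
move=> /subspace_continuousP cG t tab e e0.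
have /= := cG t; rewrite in_itv/= tab => /(_ isT).
move/cvgrPdist_lt => /(_ e e0); rewrite /prop_near1 /within/= => -[d /= d0 dP].
exists d => // s sab st; rewrite distrC; apply: dP; last by rewrite /= in_itv.
by rewrite /= distrC.
Qed.

(** If G b exceeded G 0, then for a small slope e > 0 the set of t with
G t <= G 0 + e t would have a supremum below b; by continuity the supremum belongs
to the set, and the derivative bound there extends the set beyond it. *)
Lemma right_dini_nonincreasing (G : R -> R) (b : R) : 0 <= b ->
  {within `[0, b], continuous G} ->
  (forall t, 0 <= t < b -> forall e, 0 < e -> exists2 d, 0 < d &
    forall s, t < s < t + d -> s <= b -> G s <= G t + e * (s - t)) ->
  G b <= G 0.
Proof.
move=> b0 /within_itv_continuousP cG dG.
suff H e : 0 < e -> G b <= G 0 + e * b.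
  rewrite leNgt; apply/negP => GbG0.
  have e0 : 0 < (G b - G 0) / (b + 1) / 2.
    by rewrite divr_gt0// divr_gt0 ?subr_gt0// ltr_wpDl.
  have := H _ e0; apply/negP; rewrite -ltNge -ltrBrDl.
  rewrite mulrAC ltr_pdivrMr// mulrAC ltr_pdivrMr; last by rewrite ltr_wpDl.
  set x := G b - G 0; have x0 : 0 < x by rewrite subr_gt0.
  by nra.
move=> e0.
pose S := [set t | 0 <= t <= b /\ G t <= G 0 + e * t].
have S0 : S 0 by rewrite /S /= lexx b0 mulr0 addr0.
have uS : ubound S b by move=> t [/andP[]].
have hS : has_sup S by split; [exists 0|exists b].
set tau := sup S.
have tau0 : 0 <= tau by apply: (ub_le_sup hS.2).
have taub : tau <= b by apply: ge_sup => //; exists 0.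
have Stau : G tau <= G 0 + e * tau.
  rewrite leNgt; apply/negP => lt.
  (* continuity of G at tau gives a point of S just below tau where G is too large *)
  pose r := G tau - (G 0 + e * tau).
  have r0 : 0 < r by rewrite subr_gt0.
  have [d d0 dP] := cG tau (introT andP (conj tau0 taub)) _ r0.
  have [s [/andP[s0 sb] Ss] sd] := sup_adherent d0 hS.
  have stau : s <= tau by apply: (ub_le_sup hS.2); split => //; apply/andP.
  have := dP s (introT andP (conj s0 sb)).
  rewrite distrC ger0_norm ?subr_ge0// ltrBlDr -ltrBlDl => /(_ sd).
  rewrite /r ltr_norml => /andP[+ _].
  have : e * s <= e * tau by rewrite ler_pM2l.
  move: Ss; lra.
move: taub; rewrite le_eqVlt => /orP[/eqP <- //|taub].
have [d d0 dP] := dG tau (introT andP (conj tau0 taub)) e e0.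
pose s := Num.min (tau + d / 2) b.
have ts : tau < s by rewrite lt_min taub andbT ltrDl divr_gt0.
have sd : s < tau + d.
  by rewrite gt_min ltrD2l; apply/orP; left; rewrite ltr_pdivrMr// ltr_pMr// ltr1n.
have sb : s <= b by rewrite ge_min lexx orbT.
suff : s <= tau by rewrite leNgt ts.
apply: (ub_le_sup hS.2); split.
  by rewrite sb (le_trans tau0 (ltW ts)).
have := dP s (introT andP (conj ts sd)) sb.
move: Stau; rewrite mulrBr; lra.
Qed.

(** Multiplied by the decreasing weight w and integrated, a local bound for the
increase of p over short intervals becomes a bound between its values at 0 and 1.
For a transported quantity u one has p = |u| and g = |u - gam u'|, but p enters only
through the local bound, which takes the place of a derivative of |u|.  The function
G(x) = int_0^x (w - gam kap) p - int_0^x w g - gam w(x) p(x) has nonpositive right Dini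
derivative, and the claim is G 1 <= G 0. *)
Lemma transport_inequality (p g : R -> R) (gam kap : R) :
  0 <= gam -> 0 <= kap -> (forall x : R, 0 <= x <= 1 -> 0 <= p x) ->
  (forall x : R, 0 <= x <= 1 -> 0 <= g x) ->
  {within `[0, 1], continuous p} -> mu.-integrable `[0, 1] (EFin \o g) ->
  (forall a : R, 0 <= a < 1 -> forall e : R, 0 < e -> exists2 d : R, 0 < d &
    forall b : R, a < b < a + d -> b <= 1 ->
      (b - a + gam) * p a <=
      \int[mu]_(x in `]a, b]) g x + gam * p b + e * (b - a)) ->
  let w x := 1 + kap * (1 - x) in
  \int[mu]_(x in `[0, 1]) (w x * p x) + gam * (1 + kap) * p 0 <=
  \int[mu]_(x in `[0, 1]) (w x * g x) + gam * p 1
    + gam * kap * \int[mu]_(x in `[0, 1]) p x.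
Proof.
move=> gam0 kap0 p0 g0 cp ig H; set w := (fun x : R => 1 + kap * (1 - x)); cbv zeta.
have cw : continuous w.
  move=> x; apply: cvgD; first exact: cvg_cst.
  by apply: cvgMr; apply: cvgB; [exact: cvg_cst|exact: cvg_id].
have ip : mu.-integrable `[0, 1] (EFin \o p).
  by apply: continuous_compact_integrable => //; exact: segment_compact.
pose q x := (w x - gam * kap) * p x.
have cq : {within `[0, 1], continuous q}.
  move=> x; apply: (@cvgM R^o); last exact: cp.
  apply: cvgB; last exact: cvg_cst.
  exact: continuous_subspaceT.
have iq : mu.-integrable `[0, 1] (EFin \o q).
  by apply: continuous_compact_integrable => //; exact: segment_compact.
have mw : measurable_fun (`[0, 1]%classic : set R) w.
  by apply: measurable_funTS; exact: continuous_measurable_fun.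
have w01 x : 0 <= x <= 1 -> 1 <= w x <= 1 + kap.
  move=> /andP[x0 x1]; rewrite /w; apply/andP; split; nra.
have iwg : mu.-integrable `[0, 1] (EFin \o (fun x => w x * g x)).
  apply: (@le_integrable _ _ _ mu _ _ _ (EFin \o (fun x => (1 + kap) * g x))) => //.
  - apply/measurable_EFinP; apply: measurable_funM => //.
    by apply/measurable_EFinP; exact: (@measurable_int _ _ _ mu _ _ ig).
  - move=> x /=; rewrite in_itv/= => x01; rewrite lee_fin !normrM.
    have /andP[w1 w2] := w01 x x01.
    rewrite ler_wpM2r// ger0_norm ?(le_trans ler01)// ger0_norm//.
    by rewrite (le_trans _ w2)// (le_trans ler01).
  - apply: eq_integrable (@integrableZl _ _ _ mu _ _ (1 + kap) _ ig) => //.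
have iwp : mu.-integrable `[0, 1] (EFin \o (fun x => w x * p x)).
  apply: continuous_compact_integrable; first exact: segment_compact.
  by move=> x; apply: (@cvgM R^o); [exact: continuous_subspaceT|exact: cp].
pose G x := \int[mu]_(s in `[0, x]) q s - \int[mu]_(s in `[0, x]) (w s * g s)
  - gam * (w x * p x).
suff : G 1 <= G 0.
  rewrite /G set_itv1 !Rintegral_set1 /w !subrr subr0 mulr0 addr0 mul1r mulr1 sub0r.
  have -> : \int[mu]_(s in `[0, 1]) q s =
     \int[mu]_(x in `[0, 1]) (w x * p x) - gam * kap * \int[mu]_(x in `[0, 1]) p x.
    rewrite -RintegralZl// -RintegralB//; last first.
      exact: eq_integrable (@integrableZl _ _ _ mu _ _ (gam * kap) _ ip).
    by apply: eq_Rintegral => x _; rewrite /q mulrBl.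
  rewrite /w; lra.
apply: right_dini_nonincreasing => //.
  move=> x; apply: cvgB.
    by apply: cvgB; exact: parameterized_integral_continuous.
  apply: cvgMr; apply: (@cvgM R^o); [exact: continuous_subspaceT|exact: cp].
move=> a /andP[a0 a1] e0 e00.
have a01 : 0 <= a <= 1 by rewrite a0 ltW.
pose e := e0 / (3 + kap); have e_gt0 : 0 < e by rewrite divr_gt0// ltr_wpDr.
have [d1 d10 Hd1] := H a (introT andP (conj a0 a1)) e e_gt0.
have [d2 d20 Hd2] := within_itv_continuousP cq a01 e_gt0.
have pa0 := p0 a a01.
(* d3 makes the change kap (b - a) p(a) of the weighted value at most e *)
pose d3 := e / (kap * p a + 1).
have kpa : 0 < kap * p a + 1 by rewrite ltr_wpDl// mulr_ge0.
have d30 : 0 < d3 by rewrite divr_gt0.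
exists (Num.min d1 (Num.min d2 d3)); first by rewrite !lt_min d10 d20 d30.
move=> b /andP[ab bd] b1.
have b0 : 0 <= b by rewrite (le_trans a0)// ltW.
have b01 : 0 <= b <= 1 by rewrite b0.
move: bd; rewrite -ltrBlDl !lt_min => /and3P[bd1 bd2 bd3].
have subab : `]a, b] `<=` `[0, 1].
  by move=> x /=; rewrite !in_itv/= => /andP[ax xb]; rewrite (le_trans a0 (ltW ax)) (le_trans xb).
have split (f : R -> R) : mu.-integrable `[0, 1] (EFin \o f) ->
    \int[mu]_(s in `[0, b]) f s =
    \int[mu]_(s in `[0, a]) f s + \int[mu]_(s in `]a, b]) f s.
  move=> intf; have i0b : mu.-integrable `[0, b] (EFin \o f).
    apply: integrableS intf => //.
    by move=> x /=; rewrite !in_itv/= => /andP[-> xb]; rewrite (le_trans xb).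
  have <- := @Rintegral_itvB _ f (BLeft 0) (BRight b) a i0b.
  - by rewrite addrC subrK.
  - by rewrite bnd_simp.
  - by rewrite bnd_simp ltW.
have mab : fine (mu `]a, b]) = b - a.
  by rewrite lebesgue_measure_itv/= lte_fin ab.
have Iq : \int[mu]_(x in `]a, b]) q x <= (q a + e) * (b - a).
  rewrite -mab -Rintegral_cst//; apply: le_Rintegral => //.
  - exact: integrableS iq.
  - apply: integrableS (_ : mu.-integrable `[0, 1] _) => //.
    apply: continuous_compact_integrable; first exact: segment_compact.
    by move=> x; exact: cvg_cst.
  - move=> x; rewrite /= in_itv/= => /andP[ax xb].
    have /ltW : `|q x - q a| < e.
      apply: Hd2; first by rewrite (le_trans a0 (ltW ax)) (le_trans xb).
      by rewrite ger0_norm ?subr_ge0 ?(ltW ax)// (le_lt_trans _ bd2)// lerB.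
    by rewrite ler_norml => /andP[_]; rewrite lerBlDl.
have Ig : w b * \int[mu]_(x in `]a, b]) g x <= \int[mu]_(x in `]a, b]) (w x * g x).
  rewrite -RintegralZl//; last exact: integrableS ig.
  apply: le_Rintegral => //.
  - have igab : mu.-integrable `]a, b] (EFin \o g) by apply: integrableS ig.
    by apply: eq_integrable (@integrableZl _ _ _ mu _ _ (w b) _ igab).
  - exact: integrableS iwg.
  - move=> x xab; have := subab _ xab; move: xab; rewrite /= !in_itv/= => /andP[ax xb] x01.
    by rewrite ler_wpM2r ?g0// /w lerD2l ler_wpM2l// lerB.
have := Hd1 b; rewrite ab -ltrBlDl bd1 b1 => /(_ isT isT).
rewrite /G !split//.
have /andP[wb1 wb2] := w01 b b01.
set Q := \int[mu]_(x in `]a, b]) q x in Iq *.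
set W := \int[mu]_(x in `]a, b]) (w x * g x) in Ig *.
set J := \int[mu]_(x in `]a, b]) g x in Ig *.
move=> Hb.
have {}Hb : w b * ((b - a + gam) * p a) <= w b * (J + gam * p b + e * (b - a)).
  by rewrite ler_wpM2l// (le_trans ler01).
have kd3 : kap * (b - a) * p a <= e.
  have : (b - a) * (kap * p a + 1) <= e by rewrite -ler_pdivlMr// ltW.
  by move: ab; nra.
have kd : (kap * (b - a) * p a) * (b - a) <= e * (b - a).
  by rewrite ler_wpM2r// subr_ge0 ltW.
have we : w b * (e * (b - a)) <= (1 + kap) * (e * (b - a)).
  by rewrite ler_wpM2r// mulr_ge0 ?(ltW e_gt0)// subr_ge0 ltW.
have e0E : e0 = e * (3 + kap) by rewrite /e mulfVK// gt_eqF// ltr_wpDr.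
rewrite e0E.
have qaE : q a = (w b + kap * (b - a) - gam * kap) * p a.
  by rewrite /q /w; congr (_ * _); ring.
have waE : w a = w b + kap * (b - a) by rewrite /w; ring.
rewrite waE; rewrite qaE in Iq.
set X := \int[mu]_(s in `[0, a]) _; set Y := \int[mu]_(s in `[0, a]) _.
clearbody X Y Q W J w.
set A := w b in Iq Ig Hb we *.
nra.
Qed.

End RealLemmas.

(** * Countable sums and coordinates *)

Section Tonelli.
Context {R : realType} {J : countType}.
Local Notation mu := (@lebesgue_measure R).
Local Open Scope ereal_scope.

Lemma esum_count (a : J -> \bar R) : (forall j, 0 <= a j) ->
  \esum_(j in setT) a j = \sum_(n <oo) oapp a 0 (pickle_inv n : option J).
Proof.
move=> a0; rewrite nneseries_esumT; last by move=> n; case: (pickle_inv n : option J) => /=.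
transitivity (\esum_(n in range (@choice.pickle J)) oapp a 0 (pickle_inv n : option J)).
  rewrite (@reindex_esum _ _ _ setT (range (@choice.pickle J)) (@choice.pickle J))//.
    by apply: eq_esum => j _; rewrite pickleK_inv.
  by apply: inj_bij => x y _ _; exact: (pcan_inj pickleK_inv).
rewrite esum_mkcond; apply: eq_esum => n _; case: ifPn => //.
rewrite notin_setE => nr; case e : (pickle_inv n : option J) => [j|]//=.
by case: nr; exists j => //; have := @pickle_invK J n; rewrite e.
Qed.

(** Tonelli's theorem for a countable index type. *)
Lemma integral_esum (D : set R) (f : J -> R -> \bar R) : measurable D ->
  (forall j, measurable_fun D (f j)) -> (forall j x, 0 <= f j x) ->
  \int[mu]_(x in D) (\esum_(j in setT) f j x) =
  \esum_(j in setT) (\int[mu]_(x in D) f j x).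
Proof.
move=> mD mf f0; rewrite esum_count; last by move=> j; apply: integral_ge0.
under eq_integral do rewrite esum_count//.
pose g n x := oapp (f ^~ x) 0 (pickle_inv n : option J).
rewrite -[LHS]/(\int[mu]_(x in D) (\sum_(n <oo) g n x)).
rewrite (@integral_nneseries _ _ _ mu D mD g); last 2 first.
- move=> n; rewrite /g; case: (pickle_inv n : option J) => [j|]/=; first exact: mf.
  exact: measurable_cst.
- by move=> n x _; rewrite /g; case: (pickle_inv n : option J) => /=.
apply: eq_eseriesr => n _; rewrite /g; case: (pickle_inv n : option J) => [j|]//=.
by rewrite integral0.
Qed.

End Tonelli.

Section Coordinates.
Context {R : realType} {J : choiceType}.

Lemma rnorm_coord (a : ell1 R J) j : rnorm (a j) <= rnorm a.
Proof.
rewrite rnorm_ell1E -lee_fin ell1_normE; apply: esum_ge; exists [set j].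
  by split => //; exact: finite_set1.
by rewrite fsbig_set1.
Qed.

Lemma rnorm_lip {V : normedZmodType R[i]} (a b : V) :
  `|rnorm a - rnorm b| <= rnorm (a - b).
Proof.
rewrite ler_distl; apply/andP; split.
  by rewrite lerBlDr -(rnormN (a - b)) opprB; have := rnormD a (b - a); rewrite addrC subrK addrC.
by have := rnormD (a - b) b; rewrite subrK addrC.
Qed.

Lemma rnorm_coord_lip j (a b : ell1 R J) :
  `|rnorm (a j) - rnorm (b j)| <= rnorm (a - b).
Proof. by apply: le_trans (rnorm_lip _ _) _; exact: (rnorm_coord (a - b)). Qed.

Lemma Re_le_rnorm (z : R[i]) : complex.Re z <= rnorm z.
Proof.
rewrite /rnorm normc_def /= ; case: z => a b /=.
by rewrite (le_trans (ler_norm a))// -sqrtr_sqr ler_wsqrtr// lerDl sqr_ge0.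
Qed.

Lemma rnorm_real (r : R) : rnorm (r%:C%C : R[i]) = `|r|.
Proof. by rewrite /rnorm normc_def /= expr0n /= addr0 sqrtr_sqr. Qed.

(** The modulus of a complex number is attained by one of the forms Re (e z): take
the conjugate phase of z. *)
Lemma exists_phase (z : R[i]) :
  exists2 e : R[i], rnorm e <= 1 & complex.Re (e * z) = rnorm z.
Proof.
have [->|z0] := eqVneq z 0.
  by exists 0; rewrite ?rnorm0 ?mul0r.
have nz0 : `|z| != 0 by rewrite normr_eq0.
exists ((z^*)%C / `|z|).
  by rewrite /rnorm normrM normcJ normfV normr_id divff.
by rewrite /rnorm mulrAC [_ * z]mulrC -sqr_normc expr2 mulfK.
Qed.

Lemma coord_form (e : R[i]) j : rnorm e <= 1 ->
  real_form (fun a : ell1 R J => complex.Re (e * a j)).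
Proof.
move=> e1; split => [r a b|a].
  rewrite -[in LHS]/(complex.Re (e * (r%:C%C * a j + b j))) mulrDr mulrCA.
  rewrite raddfD /=; congr (_ + _).
  by case: (e * a j) => x y /=; rewrite mul0r subr0.
apply: le_trans (Re_le_rnorm _) _; rewrite rnormM (le_trans _ (rnorm_coord a j))//.
by rewrite ler_piMl// rnorm_ge0.
Qed.

End Coordinates.

Lemma L1fun_subE (R : realType) (V : normedModType R[i]) (p q : L1fun V) x :
  (p - q) x = p x - q x.
Proof. by []. Qed.

Lemma L1fun_scaleE (R : realType) (V : normedModType R[i]) (s : R[i]) (p : L1fun V) x :
  (s *: p) x = s *: p x.
Proof. by []. Qed.

Lemma ell1_subE (R : realType) (J : choiceType) (p q : ell1 R J) j :
  (p - q) j = p j - q j.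
Proof. by []. Qed.

Lemma ell1_scaleE (R : realType) (J : choiceType) (s : R[i]) (p : ell1 R J) j :
  (s *: p) j = s * p j.
Proof. by []. Qed.

(** * Coordinates of absolutely continuous functions *)

Section Increments.
Context {R : realType}.
Local Notation mu := (@lebesgue_measure R).

Lemma Rintegral_itv_increment (f : R -> R) (a b : R) : 0 <= a -> a <= b -> b <= 1 ->
  mu.-integrable `[0, 1] (EFin \o f) ->
  \int[mu]_(s in `[0, b]) f s - \int[mu]_(s in `[0, a]) f s =
  \int[mu]_(s in `]a, b]) f s.
Proof.
move=> a0 ab b1 intf; apply: (@Rintegral_itvB _ f (BLeft 0) (BRight b) a).
- apply: integrableS intf => //.
  by move=> x /=; rewrite !in_itv/= => /andP[-> xb]; rewrite (le_trans xb).
- by rewrite bnd_simp.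
- by rewrite bnd_simp.
Qed.

End Increments.

(** Here p and r stand for |u_j(a)| and |u_j(b)|, q for Re (z u_j(b)), d for b - a, and
A and B for the integrals of Re (z u_j) and of |g_j| over ]a, b]. *)
Lemma local_transport_bound (R : realType) (e gam d p q A B r : R) :
  A - gam * (q - p) <= B -> (p - e) * d <= A -> gam * q <= gam * r ->
  (d + gam) * p <= B + gam * r + e * d.
Proof. nra. Qed.

Section WeakPrimitive.
Context {R : realType} {J : choiceType}.
Local Notation mu := (@lebesgue_measure R).
Local Notation I01 := (`[0%R, 1%R]%classic : set R).
Implicit Types u h : L1fun (ell1 R J).

Let mI01 : measurable (I01 : set R).
Proof. exact: measurable_itv. Qed.

Lemma L1fun_integrable (E : normedModType R[i]) (f : L1fun E) :
  mu.-integrable I01 (EFin \o (fun x => rnorm (f x))).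
Proof.
apply/integrableP; split; first exact: (measurable_rnormE (L1fun_measurable f)).
apply: le_lt_trans (L1fun_lty f); rewrite le_eqVlt; apply/orP; left; apply/eqP.
by apply: eq_integral => x _ /=; rewrite ger0_norm// rnorm_ge0.
Qed.

Lemma coord_integrable (f : L1fun (ell1 R J)) j :
  mu.-integrable I01 (EFin \o (fun x => rnorm (f x j))).
Proof.
apply: le_integrable (L1fun_integrable f) => //.
  apply/measurable_EFinP.
  apply: (@lipschitz_measurable _ _ I01 f (fun a : ell1 R J => rnorm (a j))) => //.
    exact: rnorm_coord_lip.
  exact: L1fun_measurable.
move=> x _ /=; rewrite lee_fin !ger0_norm ?rnorm_ge0//.
exact: rnorm_coord.
Qed.

Lemma form_integrable (E : normedModType R[i]) (l : E -> R) (f : L1fun E) :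
  real_form l -> mu.-integrable I01 (EFin \o (l \o f)).
Proof.
move=> hl; apply: integrable_form => //; first exact: L1fun_measurable.
exact: L1fun_integrable.
Qed.

(** Each coordinate of u is a primitive of the same coordinate of h; complex
values are tested by the forms Re (e z).  In contrast to [W11_derivative], this is
evidently inherited by differences. *)
Definition weak_primitive u h := forall j (e : R[i]), rnorm e <= 1 ->
  forall x : R, 0 <= x <= 1 -> complex.Re (e * u x j) - complex.Re (e * u 0 j) =
    \int[mu]_(s in `[0, x]) complex.Re (e * h s j).

(** The integral of the derivative is a Bochner integral, which forms preserve. *)
Lemma W11_form (E : normedModType R[i]) (l : E -> R) (u h : L1fun E) :
  real_form l -> W11_derivative u h ->
  forall x : R, 0 <= x <= 1 -> l (u x) - l (u 0) = \int[mu]_(s in `[0, x]) l (h s).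
Proof.
move=> hl uh x /andP[x0 x1]; rewrite -real_formB//; apply/esym.
have s01 : `[0, x] `<=` I01.
  by move=> y /=; rewrite !in_itv/= => /andP[-> yx]; rewrite (le_trans yx).
apply: bochner_integral_form => //.
- by rewrite /= lebesgue_measure_itv/=; case: ifP => _; rewrite ?ltry// -EFinB ltry.
- have [s [ss sf]] := L1fun_measurable h; exists s; split => // y /s01.
  exact: sf.
- by apply: integrableS (L1fun_integrable h).
- by apply: uh; rewrite x0.
Qed.

Lemma weak_primitiveB u h u' h' : weak_primitive u h -> weak_primitive u' h' ->
  weak_primitive (u - u') (h - h').
Proof.
move=> uh uh' j e e1 x x01; have /andP[x0 x1] := x01.
have s01 : `[0, x] `<=` I01.
  by move=> y /=; rewrite !in_itv/= => /andP[-> yx]; rewrite (le_trans yx).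
have ReB (a b : R[i]) : complex.Re (e * (a - b)) = complex.Re (e * a) - complex.Re (e * b).
  by rewrite mulrBr raddfB.
under [RHS]eq_Rintegral do rewrite L1fun_subE ell1_subE ReB.
rewrite !L1fun_subE !ell1_subE !ReB RintegralB//.
- rewrite -uh// -uh'//.
  (* opaque names for the four values keep the ring normalization small *)
  move: (complex.Re _) (complex.Re _) (complex.Re _) (complex.Re _) => p1 p2 p3 p4.
  by ring.
- by apply: integrableS (form_integrable h (coord_form j e1)).
- by apply: integrableS (form_integrable h' (coord_form j e1)).
Qed.

Section Fixed.
Variables (u h : L1fun (ell1 R J)) (uh : weak_primitive u h) (j : J).

Let increment (e : R[i]) (a b : R) : rnorm e <= 1 -> 0 <= a -> a <= b -> b <= 1 ->
  complex.Re (e * u b j) - complex.Re (e * u a j) =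
  \int[mu]_(s in `]a, b]) complex.Re (e * h s j).
Proof.
move=> e1 a0 ab b1.
rewrite -(@Rintegral_itv_increment _ (fun s => complex.Re (e * h s j)))//.
  rewrite -!uh//; first ring.
    by rewrite a0 (le_trans ab).
  by rewrite (le_trans a0 ab).
exact: (form_integrable h (coord_form j e1)).
Qed.

Let mass x := \int[mu]_(s in `[0, x]) rnorm (h s j).

Let increment_le (a b : R) : 0 <= a -> a <= b -> b <= 1 ->
  rnorm (u b j - u a j) <= mass b - mass a.
Proof.
move=> a0 ab b1; have [e e1 <-] := exists_phase (u b j - u a j).
have s01 : `]a, b] `<=` I01.
  by move=> y /=; rewrite !in_itv/= => /andP[/ltW ay yb]; rewrite (le_trans a0 ay) (le_trans yb).
rewrite mulrBr raddfB /= increment// /mass (@Rintegral_itv_increment _ (fun s => rnorm (h s j)))//;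
  last exact: coord_integrable.
apply: le_Rintegral => //.
- by apply: integrableS (form_integrable h (coord_form j e1)).
- by apply: integrableS (coord_integrable h j).
- by move=> x _; rewrite (le_trans (Re_le_rnorm _))// rnormM ler_piMl// rnorm_ge0.
Qed.

Let close (t : R) (e : R) : 0 <= t <= 1 -> 0 < e ->
  exists2 d, 0 < d & forall s, 0 <= s <= 1 -> `|s - t| < d -> rnorm (u s j - u t j) < e.
Proof.
move=> t01 e0.
have cm : {within `[0, 1], continuous mass}.
  by apply: parameterized_integral_continuous => //; exact: coord_integrable.
have [d d0 dP] := within_itv_continuousP cm t01 e0.
exists d => // s s01 st; have := dP s s01 st.
have /andP[s0 s1] := s01; have /andP[t0 t1] := t01.
have [ts|/ltW st'] := leP t s.
  by apply: le_lt_trans; apply: le_trans (increment_le t0 ts s1) (ler_norm _).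
apply: le_lt_trans; rewrite -(rnormN (u s j - u t j)) opprB distrC.
exact: le_trans (increment_le s0 st' t1) (ler_norm _).
Qed.

(** This is [transport_inequality] for p = |u_j| and g = |u_j - gam h_j|.  For the
local bound at a, choose the phase z with Re (z u_j(a)) = |u_j(a)|: then |g| is at
least Re (z (u_j - gam h_j)), whose integral over ]a, b] is known because
Re (z u_j) is a primitive of Re (z h_j), and Re (z u_j(b)) <= |u_j(b)|. *)
Lemma coordinate_transport_inequality (gam kap : R) (g : L1fun (ell1 R J)) :
  0 <= gam -> 0 <= kap ->
  (forall x : R, 0 <= x <= 1 -> g x j = u x j - gam%:C%C * h x j) ->
  let w x := 1 + kap * (1 - x) in
  \int[mu]_(x in I01) (w x * rnorm (u x j)) + gam * (1 + kap) * rnorm (u 0 j) <=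
  \int[mu]_(x in I01) (w x * rnorm (g x j)) + gam * rnorm (u 1 j)
    + gam * kap * \int[mu]_(x in I01) (w x * rnorm (u x j)).
Proof.
move=> gam0 kap0 gE.
have cp : {within I01, continuous (fun x => rnorm (u x j))}.
  apply/subspace_continuousP => t /=; rewrite in_itv/= => t01.
  apply/cvgrPdist_lt => e e0; have [d d0 dP] := close t01 e0.
  rewrite /prop_near1 /within/=; exists d => //= s st; rewrite in_itv/= => s01.
  have {}st : `|s - t| < d by rewrite distrC.
  by rewrite distrC (le_lt_trans _ (dP s s01 st))//; exact: rnorm_lip.
have iu : mu.-integrable I01 (EFin \o (fun x => rnorm (u x j))) by exact: coord_integrable.
have := @transport_inequality _ (fun x => rnorm (u x j)) (fun x => rnorm (g x j))
  gam kap gam0 kap0 (fun x _ => rnorm_ge0 _) (fun x _ => rnorm_ge0 _) cp (coord_integrable g j).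
move=> H; cbv zeta in H; cbv zeta; apply: le_trans (H _) _; last first.
  rewrite lerD2l ler_wpM2l ?mulr_ge0//; apply: le_Rintegral => //.
    pose w (x : R) := 1 + kap * (1 - x); have cw : continuous w.
      move=> x; apply: cvgD; first exact: cvg_cst.
      by apply: cvgMr; apply: cvgB; [exact: cvg_cst|exact: cvg_id].
    rewrite -[X in _.-integrable _ X]/(EFin \o (fun x => w x * rnorm (u x j))).
    apply: continuous_compact_integrable; first exact: segment_compact.
    by move=> x; apply: (@cvgM R^o); [exact: continuous_subspaceT|exact: cp].
  move=> x; rewrite /= in_itv/= => /andP[x0 x1].
  by rewrite ler_peMl ?rnorm_ge0// lerDl mulr_ge0// subr_ge0.
move=> a /andP[a0 a1] e e0.
have a01 : 0 <= a <= 1 by rewrite a0 ltW.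
have [d d0 dP] := close a01 e0; exists d => // b /andP[ab bd] b1.
have [z z1 zE] := exists_phase (u a j).
have s01 : `]a, b] `<=` I01.
  by move=> y /=; rewrite !in_itv/= => /andP[/ltW ay yb]; rewrite (le_trans a0 ay) (le_trans yb).
have inc := increment z1 a0 (ltW ab) b1.
have mab : fine (mu `]a, b]) = b - a.
  by rewrite lebesgue_measure_itv/= lte_fin ab.
have iform (f : L1fun (ell1 R J)) :
    mu.-integrable `]a, b] (EFin \o (fun s => complex.Re (z * f s j))).
  by apply: integrableS (form_integrable f (coord_form j z1)).
have Ig : \int[mu]_(x in `]a, b]) complex.Re (z * g x j) <=
    \int[mu]_(x in `]a, b]) rnorm (g x j).
  apply: le_Rintegral => //.
  - by apply: integrableS (coord_integrable g j).
  - by move=> x _; rewrite (le_trans (Re_le_rnorm _))// rnormM ler_piMl// rnorm_ge0.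
have Eg : \int[mu]_(x in `]a, b]) complex.Re (z * g x j) =
    \int[mu]_(x in `]a, b]) complex.Re (z * u x j)
    - gam * \int[mu]_(x in `]a, b]) complex.Re (z * h x j).
  rewrite -RintegralZl// -RintegralB//; last first.
    by apply: eq_integrable (@integrableZl _ _ _ mu _ _ gam _ (iform h)).
  apply: eq_Rintegral => x; rewrite inE => /s01; rewrite /= in_itv/= => x01.
  rewrite gE// mulrBr mulrCA raddfB /=; congr (_ - _).
  by case: (z * h x j) => x' y' /=; rewrite mul0r subr0.
have Iu : (rnorm (u a j) - e) * (b - a) <= \int[mu]_(x in `]a, b]) complex.Re (z * u x j).
  rewrite -mab -Rintegral_cst//; apply: le_Rintegral => //.
    apply: (@integrableS _ _ _ mu _ _ _ mI01 _ s01) => //.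
    apply: continuous_compact_integrable; first exact: segment_compact.
    by move=> x; exact: cvg_cst.
  move=> x xab; have := s01 _ xab; move: xab; rewrite /= !in_itv/= => /andP[ax xb] x01.
  have := dP x x01; rewrite ger0_norm ?subr_ge0 ?(ltW ax)//.
  have xad : x - a < d by rewrite ltrBlDl (le_lt_trans xb).
  move=> /(_ xad) /ltW ux.
  have := Re_le_rnorm (z * (u a j - u x j)); rewrite mulrBr raddfB /= zE -mulrBr.
  have : rnorm (z * (u a j - u x j)) <= e.
    rewrite rnormM -(rnormN (_ - _)) opprB (le_trans _ ux)//.
    by rewrite ler_piMl// rnorm_ge0.
  by move=> B A; rewrite lerBlDr -lerBlDl; exact: le_trans A B.
have pb : complex.Re (z * u b j) <= rnorm (u b j).
  by rewrite (le_trans (Re_le_rnorm _))// rnormM ler_piMl// rnorm_ge0.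
rewrite Eg -inc zE in Ig.
have : gam * complex.Re (z * u b j) <= gam * rnorm (u b j) by rewrite ler_wpM2l.
move: Ig Iu.
set A := \int[mu]_(x in `]a, b]) complex.Re (z * u x j).
set B := \int[mu]_(x in `]a, b]) rnorm (g x j).
move=> Ig Iu ub; apply: (@local_transport_bound _ e gam (b - a) (rnorm (u a j)) (complex.Re (z * u b j)) A) => //.
Qed.

End Fixed.
End WeakPrimitive.

(** * Weighted norms on the space of integrable edge functions *)

Section WeakPrimitiveW11.
Context {R : realType}.
Local Notation mu := (@lebesgue_measure R).
Local Notation I01 := (`[0%R, 1%R]%classic : set R).

Lemma W11_weak_primitive (J : choiceType) (u h : L1fun (ell1 R J)) :
  W11_derivative u h -> weak_primitive u h.
Proof. by move=> uh j e e1 x x01; exact: (W11_form (coord_form j e1) uh x01). Qed.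

(** Extension by zero is contractive and linear, hence forms on the larger space
pull back to forms. *)
Lemma ext_weak_primitive (I J : choiceType) (i : I -> J) (inj_i : injective i)
    (u h : L1fun (ell1 R I)) : W11_derivative u h ->
  weak_primitive (L1fun_map (L := ext_ell1 inj_i) (rnorm_ext_ell1_le inj_i) u)
    (L1fun_map (L := ext_ell1 inj_i) (rnorm_ext_ell1_le inj_i) h).
Proof.
move=> uh j e e1 x x01.
have hl : real_form (fun a : ell1 R I => complex.Re (e * ext_ell1 inj_i a j)).
  have [l1 l2] := coord_form j e1; split => [r a b|a].
    by rewrite linearP; exact: l1.
  by apply: le_trans (l2 _) _; rewrite rnorm_ext_ell1.
exact: (W11_form hl uh x01).
Qed.

End WeakPrimitiveW11.

Section WeightedNorm.
Context {R : realType} {J : countType} (kap : R).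
Hypothesis kap0 : 0 <= kap.
Local Notation mu := (@lebesgue_measure R).
Local Notation I01 := (`[0%R, 1%R]%classic : set R).
Local Notation w := (fun x : R => 1 + kap * (1 - x)).
Implicit Types (f : L1fun (ell1 R J)) (p q : L1 (ell1 R J)) (rho : J -> R).

Let mI01 : measurable (I01 : set R).
Proof. exact: measurable_itv. Qed.

(** The weight decreases from 1 + kap at x = 0, where the edges are left, to 1 at
x = 1, where they are entered.  This makes up for the multiplication of mass at
the vertices, which the unweighted norm would feel as a jump of the semigroup
at time 0. *)
Definition wcoord q j : R :=
  \int[mu]_(x in I01) (w x * rnorm ((repr q : L1fun (ell1 R J)) x j)).

Let w_bounds (x : R) : I01 x -> 1 <= w x <= 1 + kap.
Proof.
rewrite /= in_itv/= => /andP[x0 x1]; rewrite lerDl mulr_ge0 ?subr_ge0//=.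
by rewrite lerD2l ler_piMr// gerBl.
Qed.

Let measurable_w (D : set R) : measurable D -> measurable_fun D w.
Proof.
move=> mD; apply: measurable_funTS; apply: continuous_measurable_fun => x.
apply: cvgD; first exact: cvg_cst.
by apply: cvgMr; apply: cvgB; [exact: cvg_cst|exact: cvg_id].
Qed.

Lemma measurable_coord f j : measurable_fun I01 (fun x => rnorm (f x j)).
Proof.
by apply/measurable_EFinP; exact: (@measurable_int _ _ _ mu _ _ (coord_integrable f j)).
Qed.

Lemma wcoord_integrable f j :
  mu.-integrable I01 (EFin \o (fun x => w x * rnorm (f x j))).
Proof.
apply: (@le_integrable _ _ _ mu _ _ _ (EFin \o (fun x => (1 + kap) * rnorm (f x j)))) => //.
- apply/measurable_EFinP; apply: measurable_funM; first exact: measurable_w.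
  exact: measurable_coord.
- move=> x /w_bounds/andP[w1 w2]; rewrite /= lee_fin !normrM.
  rewrite ler_wpM2r// ger0_norm ?(le_trans ler01)// ger0_norm//.
  by rewrite (le_trans _ w2)// (le_trans ler01).
- by apply: eq_integrable (@integrableZl _ _ _ mu _ _ (1 + kap) _ (coord_integrable f j)).
Qed.

Lemma wcoord_of f j :
  wcoord (L1_of f) j = \int[mu]_(x in I01) (w x * rnorm (f x j)).
Proof.
congr fine; apply: ae_eq_integral => //.
- exact: (@measurable_int _ _ _ mu _ _ (wcoord_integrable _ j)).
- exact: (@measurable_int _ _ _ mu _ _ (wcoord_integrable _ j)).
have /L1_ofP := L1_reprK (L1_of f).
by apply: (@filterS _ _ (ae_filter_ringOfSetsType mu)) => x /= h /h ->.
Qed.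

Lemma wcoord_ge0 q j : 0 <= wcoord q j.
Proof.
apply: Rintegral_ge0 => x /w_bounds/andP[w1 _].
by rewrite mulr_ge0 ?rnorm_ge0// (le_trans ler01).
Qed.

Lemma wcoordD p q j : wcoord (p + q) j <= wcoord p j + wcoord q j.
Proof.
rewrite -[p]L1_reprK -[q]L1_reprK; move: (repr p) (repr q) => f g.
rewrite -L1_ofD !wcoord_of -RintegralD//;
  try exact: wcoord_integrable.
apply: le_Rintegral => //; first exact: wcoord_integrable.
  exact: (@integrableD _ _ _ mu _ mI01 _ _ (wcoord_integrable _ _) (wcoord_integrable _ _)).
move=> x /w_bounds/andP[w1 _]; rewrite -mulrDr ler_wpM2l ?(le_trans ler01)//.
exact: (rnormD (f x j) (g x j)).
Qed.

Lemma esum_rnormE (k : R) (a : ell1 R J) : 0 <= k ->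
  \esum_(j in setT) (k * rnorm (a j))%:E = (k * rnorm a)%:E.
Proof.
move=> k0; transitivity (rnorm (k%:C%C *: a))%:E.
  rewrite rnorm_ell1E ell1_normE; apply: eq_esum => j _.
  by rewrite -[in RHS]/(k%:C%C * a j) rnormM rnorm_real ger0_norm.
by rewrite rnormZ rnorm_real ger0_norm.
Qed.

(** Summation over the edges and integration are exchanged, and the sum of the moduli
of the coordinates is the norm in l^1. *)
Lemma esum_wcoord f : \esum_(j in setT) (wcoord (L1_of f) j)%:E =
  (\int[mu]_(x in I01) (w x * rnorm (f x))%:E)%E.
Proof.
transitivity (\int[mu]_(x in I01) (\esum_(j in setT) (`|w x| * rnorm (f x j))%:E))%E;
  last by apply: eq_integral => x; rewrite inE => /w_bounds/andP[w1 _];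
    rewrite esum_rnormE// ger0_norm// (le_trans ler01).
rewrite integral_esum//.
- apply: eq_esum => j _; rewrite wcoord_of /Rintegral fineK.
    apply: eq_integral => x; rewrite inE => /w_bounds/andP[w1 _].
    by rewrite ger0_norm// (le_trans ler01).
  exact: (@integrable_fin_num _ _ _ mu _ mI01 _ (wcoord_integrable _ _)).
- move=> j; apply/measurable_EFinP; apply: measurable_funM; last exact: measurable_coord.
  by apply: measurableT_comp => //; exact: measurable_w.
- by move=> j x; rewrite lee_fin mulr_ge0// rnorm_ge0.
Qed.

Let measurable_wnorm f : measurable_fun I01 (fun x => (w x * rnorm (f x))%:E).
Proof.
apply/measurable_EFinP; apply: measurable_funM; first exact: measurable_w.
by apply: measurable_rnorm => //; exact: L1fun_measurable.
Qed.

Lemma rnorm_le_esum_wcoord q : ((rnorm q)%:E <= \esum_(j in setT) (wcoord q j)%:E)%E.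
Proof.
rewrite -[q]L1_reprK; move: (repr q) => f; rewrite rnorm_L1 esum_wcoord.
apply: ge0_le_integral => //.
- by move=> x _; rewrite lee_fin rnorm_ge0.
- exact: (measurable_rnormE (L1fun_measurable f)).
- exact: measurable_wnorm.
- by move=> x /w_bounds/andP[w1 _]; rewrite lee_fin ler_peMl// rnorm_ge0.
Qed.

Lemma esum_wcoord_le q :
  (\esum_(j in setT) (wcoord q j)%:E <= ((1 + kap) * rnorm q)%:E)%E.
Proof.
rewrite -[q]L1_reprK; move: (repr q) => f; rewrite EFinM rnorm_L1 esum_wcoord.
have mf := measurable_rnormE (L1fun_measurable f).
rewrite /norm_integral -ge0_integralZl_EFin//; last 2 first.
- by move=> x _; rewrite lee_fin rnorm_ge0.
- by rewrite addr_ge0.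
apply: ge0_le_integral => //.
- move=> x /w_bounds/andP[w1 _]; rewrite lee_fin mulr_ge0 ?rnorm_ge0//.
  exact: le_trans w1.
- exact: measurable_wnorm.
- exact: measurable_funeM.
- move=> x /w_bounds/andP[_ w2]; rewrite -EFinM lee_fin ler_wpM2r// rnorm_ge0//.
Qed.

(** Weighted L^1 seminorms, equivalent to the norm if rho = 1. *)
Definition wnorm rho q : R := fine (\esum_(j in setT) (rho j * wcoord q j)%:E).

Section Rho.
Variable rho : J -> R.
Hypothesis rho01 : forall j, 0 <= rho j <= 1.

Let rho_ge0 j : 0 <= rho j. Proof. by have /andP[] := rho01 j. Qed.

Lemma wnorm_esum_le q :
  (\esum_(j in setT) (rho j * wcoord q j)%:E <= ((1 + kap) * rnorm q)%:E)%E.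
Proof.
apply: le_trans (esum_wcoord_le q); apply: le_esum => j _.
by rewrite lee_fin ler_piMl ?wcoord_ge0//; have /andP[] := rho01 j.
Qed.

Lemma wnormE q : (wnorm rho q)%:E = \esum_(j in setT) (rho j * wcoord q j)%:E.
Proof.
rewrite fineK// ge0_fin_numE; first exact: le_lt_trans (wnorm_esum_le q) (ltry _).
by apply: esum_ge0 => j _; rewrite lee_fin mulr_ge0 ?wcoord_ge0.
Qed.

Lemma wnorm_ge0 q : 0 <= wnorm rho q.
Proof.
by rewrite fine_ge0//; apply: esum_ge0 => j _; rewrite lee_fin mulr_ge0 ?wcoord_ge0.
Qed.

Lemma wnorm_le q : wnorm rho q <= (1 + kap) * rnorm q.
Proof. by rewrite -lee_fin wnormE wnorm_esum_le. Qed.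

Lemma wnormD p q : wnorm rho (p + q) <= wnorm rho p + wnorm rho q.
Proof.
rewrite -lee_fin EFinD !wnormE -esumD; last 2 first.
- by move=> j _; rewrite lee_fin mulr_ge0 ?wcoord_ge0.
- by move=> j _; rewrite lee_fin mulr_ge0 ?wcoord_ge0.
by apply: le_esum => j _; rewrite -EFinD lee_fin -mulrDr ler_wpM2l// wcoordD.
Qed.

End Rho.

Lemma rnorm_le_wnorm q : rnorm q <= wnorm (fun=> 1) q.
Proof.
rewrite -lee_fin wnormE; last by move=> j; rewrite ler01 lexx.
by under eq_esum do rewrite mul1r; exact: rnorm_le_esum_wcoord.
Qed.

End WeightedNorm.

(** * The flux through the vertices *)

Section UnconditionalSums.
Context {R : realType}.
Local Notation totally := summability.totally.
Local Notation partial_sum := summability.partial_sum.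
#[local] Existing Instance summability.totally_filter.

Lemma partial_sumE (J : choiceType) (V : zmodType) (x : J -> V) (A : {fset J}) :
  partial_sum x A = \sum_(j <- A) x j.
Proof. by rewrite /partial_sum (big_seq_fsetE _ _ xpredT). Qed.

Lemma rnorm_sum (I : Type) (V : normedZmodType R[i]) (s : seq I) (F : I -> V) :
  rnorm (\sum_(i <- s) F i) <= \sum_(i <- s) rnorm (F i).
Proof.
elim: s => [|i s IH]; first by rewrite !big_nil rnorm0.
by rewrite !big_cons (le_trans (rnormD _ _))// lerD2l.
Qed.

(** The norm of a partial sum is at most the sum of the norms of all the terms. *)
Lemma rnorm_unconditional_sum_le (J : choiceType) (x : J -> R[i]) (l : R[i]) (r : R) :
  0 <= r -> partial_sum (fun j => x j : R[i]^o) @ totally --> (l : R[i]^o) ->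
  ((r * rnorm l)%:E <= \esum_(j in setT) (r * rnorm (x j))%:E)%E.
Proof.
move=> r0 /cvgrPdist_lt xl; apply/lee_addgt0Pr => e e0.
have e0' : 0 < ((e / (r + 1))%:C)%C :> R[i] by rewrite ltcR divr_gt0// ltr_wpDl.
have [A] := filter_ex (xl _ e0').
rewrite /= partial_sumE rnormE ltcR => lA.
have : (r * rnorm l <= \sum_(j <- A) r * rnorm (x j) + e)%R.
  rewrite -mulr_sumr.
  have : rnorm l <= \sum_(j <- A) rnorm (x j) + e / (r + 1).
    rewrite -[X in rnorm X](subrK (\sum_(j <- A) x j)) addrC.
    by rewrite (le_trans (rnormD _ _))// lerD ?rnorm_sum// ltW.
  move=> /(ler_wpM2l r0); rewrite mulrDr => /le_trans; apply.
  rewrite lerD2l mulrCA ler_piMr ?(ltW e0)// ler_pdivrMr ?mul1r ?lerDl//.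
  by rewrite ltr_wpDl.
rewrite -lee_fin EFinD => /le_trans; apply; rewrite leeD2r//.
apply: esum_ge; exists [set` A]; first by split => //; exact: finite_fset.
rewrite fsbig_finite//= set_fsetK -sumEFin//.
Qed.

(** A finite set B of indices and its preimage under i give the same partial sum, and
the preimage of a large set is large. *)
Lemma unconditional_sum_ext (I J : choiceType) (i : I -> J) (inj_i : injective i)
    (x : J -> R[i]) (y : I -> R[i]) (l : R[i]) :
  (forall k, x (i k) = y k) -> (forall j, ~ range i j -> x j = 0) ->
  partial_sum (fun k => y k : R[i]^o) @ totally --> (l : R[i]^o) ->
  partial_sum (fun j => x j : R[i]^o) @ totally --> (l : R[i]^o).
Proof.
move=> xy x0 yl U /yl[A _ AU]; exists [fset i k | k in A]%fset => //= B AB.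
pose A' := fset_set (i @^-1` [set` B]).
have fA' : finite_set (i @^-1` [set` B]).
  by apply: finite_preimage; [move=> a b _ _; exact: inj_i|exact: finite_fset].
suff E : partial_sum (fun j => x j : R[i]^o) B = partial_sum (fun k => y k : R[i]^o) A'.
  change (U (partial_sum (fun j => x j : R[i]^o) B)); rewrite E.
  apply: AU => /=; apply/fsubsetP => k kA; rewrite in_fset_set// inE /=.
  by apply: (fsubsetP AB); apply/imfsetP; exists k.
rewrite !partial_sumE.
rewrite -(@big_fset_incl _ _ _ _ [fset i k | k in A']%fset B).
- rewrite big_imfset/=; last by move=> a b _ _; exact: inj_i.
  by apply: eq_bigr => k _; exact: xy.
- apply/fsubsetP => j /imfsetP[k /= + ->].
  by rewrite in_fset_set// inE.
- move=> j jB jA'; apply: x0 => -[k _ kj]; move/negP: jA'; apply.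
  apply/imfsetP; exists k => //=; by rewrite in_fset_set// inE /= kj.
Qed.

Lemma unconditional_sumB (J : choiceType) (x y : J -> R[i]) (l l' : R[i]) :
  partial_sum (fun j => x j : R[i]^o) @ totally --> (l : R[i]^o) ->
  partial_sum (fun j => y j : R[i]^o) @ totally --> (l' : R[i]^o) ->
  partial_sum (fun j => x j - y j : R[i]^o) @ totally --> (l - l' : R[i]^o).
Proof.
move=> xl yl; rewrite (_ : partial_sum _ = fun A =>
    partial_sum (fun j => x j : R[i]^o) A - partial_sum (fun j => y j : R[i]^o) A).
  exact: (cvgB xl yl).
by apply/funext => A; rewrite !partial_sumE -sumrB.
Qed.

Lemma esum_swap (I J : choiceType) (a : I -> J -> \bar R) :
  (forall i j, 0 <= a i j)%E ->
  \esum_(i in setT) \esum_(j in setT) a i j = \esum_(j in setT) \esum_(i in setT) a i j.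
Proof.
move=> a0; rewrite !esum_esum//.
rewrite (@reindex_esum _ _ _ (setT `*`` fun=> setT) (setT `*`` fun=> setT)
  (fun k : J * I => (k.2, k.1)))//.
split => //; first by move=> [x y] [x' y'] _ _ /= [-> ->].
by move=> [x y] _; exists (y, x).
Qed.

Lemma esum_cst_card (J : choiceType) (A : set J) (k : nat) (t : R) : 0 <= t ->
  (A #<= `I_k)%card ->
  (\esum_(j in setT) (if j \in A then t else 0)%:E <= (k%:R * t)%:E)%E.
Proof.
move=> t0 Ak; have fA : finite_set A by apply/finite_set_leP; exists k.
have -> : \esum_(j in setT) (if j \in A then t else 0)%:E = \esum_(j in A) t%:E.
  by rewrite [RHS]esum_mkcond; apply: eq_esum => j _; case: ifP.
rewrite esum_fset//.
rewrite fsbig_finite//= sumEFin lee_fin big_const_seq count_predT iter_addr_0.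
by rewrite -[leLHS]mulr_natl ler_wpM2r// ler_nat; exact: geq_card_fset_set.
Qed.

End UnconditionalSums.

Section VertexFlux.
Local Notation head := Defs.head.
Context {R : realType} {H G : digraph} (f : embedding H G) (c : edge G -> R).
Variables (k : nat) (rho : edge G -> R).
Hypothesis c_gt0 : forall e, 0 < c e.
Hypothesis out_degree : forall v : G, ([set e : edge G | tail e = v] #<= `I_k)%card.
Hypothesis rho01 : forall e, 0 <= rho e <= 1.
Hypothesis rho_out : forall e, ~ range (edge_map f) e -> rho e = 1.
Hypothesis rho_step : forall e e', head e = tail e' -> rho e' <= 2 * rho e.
Variables (a b : ell1 R (edge G)) (a' b' : ell1 R (edge H)).
Hypothesis ab : matrix_apply (weighted_adjacency c) a b.
Hypothesis ab' :
  matrix_apply (weighted_adjacency (fun e => c (edge_map f e))) a' b'.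

Local Notation ext := (ext_ell1 (edge_map_inj (f := f))).
Let g := ext a'.
Let d := a - g.

Let rho_ge0 e : 0 <= rho e. Proof. by have /andP[] := rho01 e. Qed.

(** The factor c_i of the flux cancels the conjugation by diag(c) in row i. *)
Let entry (i j : edge G) (z : R[i]) :
  c i * rnorm (weighted_adjacency c i j * z) =
  if head j == tail i then c j * rnorm z else 0.
Proof.
rewrite /weighted_adjacency /line_adjacency; case: eqP => _; last first.
  by rewrite mulr0 !mul0r rnorm0 mulr0.
rewrite mulr1 -fmorphV -rmorphM /= rnormM rnorm_real ger0_norm; last first.
  by rewrite mulr_ge0 ?invr_ge0// ltW.
by rewrite !mulrA mulfV ?mul1r// gt_eqF.
Qed.

Let row_ext (i : edge H) : summability.partial_sum
    (fun j => weighted_adjacency c (edge_map f i) j * g j : R[i]^o)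
  @ summability.totally --> (b' i : R[i]^o).
Proof.
apply: (@unconditional_sum_ext R _ _ (edge_map f) (@edge_map_inj _ _ f)
  (fun j => weighted_adjacency c (edge_map f i) j * g j)
  (fun l => weighted_adjacency (fun e => c (edge_map f e)) i l * a' l) (b' i) _ _ (@ab' i)).
- move=> l; congr (_ * _); last exact: (ext_seqE (edge_map_inj (f := f))).
  rewrite /weighted_adjacency /line_adjacency; congr (_ * _%:R * _).
  by rewrite /head /tail /= (inj_eq (embedding_inj (e := f))).
- by move=> j nj; rewrite [X in _ * X](ext_seq0 _ nj) mulr0.
Qed.

(** Inside the subgraph both states satisfy the same row of the vertex condition,
so their difference does as well.  Outside, mass arrives in the large graph only:
the extension of b' vanishes and |a_j| <= |d_j| + |g_j|, which is covered by the
right-hand side because rho_i = 1. *)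
Let row_bound (i : edge G) :
  ((c i * (rnorm (b i - ext b' i) + rho i * rnorm (ext b' i)))%:E <=
   \esum_(j in setT) (if head j == tail i then c j * (rnorm (d j) + rho i * rnorm (g j))
      else 0)%:E)%E.
Proof.
have ci0 := ltW (c_gt0 i).
have splitE : \esum_(j in setT) (if head j == tail i then
      c j * (rnorm (d j) + rho i * rnorm (g j)) else 0)%:E =
    (\esum_(j in setT) (c i * rnorm (weighted_adjacency c i j * d j))%:E +
     \esum_(j in setT) (rho i * c i * rnorm (weighted_adjacency c i j * g j))%:E)%E.
  rewrite -esumD; last 2 first.
  - by move=> j _; rewrite lee_fin mulr_ge0 ?rnorm_ge0.
  - by move=> j _; rewrite lee_fin !mulr_ge0 ?rnorm_ge0.
  apply: eq_esum => j _; rewrite -EFinD -mulrA !entry; case: ifP => _.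
    by rewrite mulrDr mulrCA.
  by rewrite mulr0 addr0.
have [[i' _ ii']|ni] := pselect (range (edge_map f) i).
  rewrite splitE -ii'.
  have -> : ext b' (edge_map f i') = b' i' by exact: (ext_seqE (edge_map_inj (f := f))).
  rewrite mulrDr EFinD leeD//.
    apply: rnorm_unconditional_sum_le; first by rewrite ltW.
    rewrite (_ : (fun j => _ : R[i]^o) = (fun j => weighted_adjacency c (edge_map f i') j * a j
        - weighted_adjacency c (edge_map f i') j * g j)).
      exact: (unconditional_sumB (@ab (edge_map f i')) (@row_ext i')).
    by apply/funext => j; rewrite -mulrBr.
  rewrite mulrCA mulrA; apply: rnorm_unconditional_sum_le; last exact: row_ext.
  by rewrite mulr_ge0// ltW.
have -> : ext b' i = 0 by exact: (ext_seq0 _ ni).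
rewrite subr0 rnorm0 mulr0 addr0 rho_out//.
apply: le_trans (rnorm_unconditional_sum_le ci0 (@ab i)) _.
apply: le_esum => j _; rewrite lee_fin entry mul1r; case: ifP => // _.
rewrite ler_pM2l//; have := rnormD (d j) (g j).
by rewrite -[d j]/(a j - g j) subrK.
Qed.

(** The flux that enters edge i is at most the sum of the fluxes that leave the edges j
leading to i, by [row_bound].  Passing from j to i at most doubles rho,
and each j leads to at most k edges i. *)
Lemma vertex_flux :
  (\esum_(i in setT) (c i * (rnorm (b i - ext b' i) + rho i * rnorm (ext b' i)))%:E <=
   \esum_(j in setT) ((2 * k%:R) *
      (c j * (rnorm (a j - ext a' j) + rho j * rnorm (ext a' j))))%:E)%E.
Proof.
pose t j := c j * (rnorm (d j) + rho j * rnorm (g j)).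
have t0 j : 0 <= t j.
  by rewrite mulr_ge0 ?(ltW (c_gt0 j))// addr_ge0 ?mulr_ge0 ?rnorm_ge0.
apply: (@le_trans _ _ (\esum_(i in setT) \esum_(j in setT)
    (if head j == tail i then 2 * t j else 0)%:E)).
  apply: le_esum => i _; apply: le_trans (row_bound i) _; apply: le_esum => j _.
  rewrite lee_fin; case: ifP => // /eqP ji.
  rewrite /t mulrCA ler_pM2l//.
  have : rho i * rnorm (g j) <= 2 * rho j * rnorm (g j).
    by rewrite ler_wpM2r ?rnorm_ge0// rho_step.
  by have := rnorm_ge0 (d j); nra.
rewrite esum_swap; last first.
  by move=> i j; rewrite lee_fin; case: ifP => // _; rewrite mulr_ge0.
apply: le_esum => j _.
have -> : 2 * k%:R * t j = k%:R * (2 * t j) by ring.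
apply: (le_trans _ (esum_cst_card _ (out_degree (head j)))); last by rewrite mulr_ge0.
apply: le_esum => i _; rewrite lee_fin.
by case: ifP => [/eqP ji|_]; [rewrite mem_set|case: ifP => _ //; rewrite mulr_ge0].
Qed.

End VertexFlux.

(** * The energy of a pair of states is dissipated *)

Section L1MapTheory.
Context {R : realType} {E F : normedModType R[i]} (L : {linear E -> F})
  (cL : forall y, rnorm (L y) <= rnorm y).

Lemma L1_ofB (f g : L1fun E) : L1_of (f - g) = L1_of f - L1_of g.
Proof. by rewrite -scaleN1r L1_ofD L1_ofZ scaleN1r. Qed.

Lemma L1_mapD (p q : L1 E) : L1_map cL (p + q) = L1_map cL p + L1_map cL q.
Proof.
rewrite -[p]L1_reprK -[q]L1_reprK -L1_ofD !L1_map_of -L1_ofD; congr L1_of.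
by apply/val_inj/funext => x /=; rewrite -[LHS]/(L (_ + _)) linearD.
Qed.

Lemma rnorm_L1_map (q : L1 E) : rnorm (L1_map cL q) <= rnorm q.
Proof.
rewrite -lee_fin -[q]L1_reprK; move: (repr q) => f; rewrite L1_map_of !rnorm_L1.
apply: ge0_le_integral => //.
- by move=> x _; rewrite lee_fin rnorm_ge0.
- exact: (measurable_rnormE (L1fun_measurable (L1fun_map cL f))).
- exact: (measurable_rnormE (L1fun_measurable f)).
- by move=> x _; rewrite lee_fin cL.
Qed.

End L1MapTheory.

(** The inequality for r and for its inverse give the equality. *)
Lemma esumZ (R : realType) (J : choiceType) (r : R) (a : J -> R) : 0 <= r ->
  (forall j, 0 <= a j) ->
  \esum_(j in setT) (r * a j)%:E = (r%:E * \esum_(j in setT) (a j)%:E)%E.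
Proof.
have le (s : R) (b : J -> R) : 0 <= s -> (forall j, 0 <= b j) ->
    (\esum_(j in setT) (s * b j)%:E <= s%:E * \esum_(j in setT) (b j)%:E)%E.
  move=> s0 b0; apply: ge_ereal_sup => _ [X [finX XI]] <-.
  under eq_fsbigr do rewrite EFinM.
  rewrite -ge0_mule_fsumr//; rewrite lee_wpmul2l ?lee_fin//.
  by apply: ereal_sup_ubound; exists X.
rewrite le_eqVlt => /predU1P[<- a0|r0 a0].
  by rewrite mul0e esum1// => j _; rewrite mul0r.
have r0' := ltW r0.
apply/eqP; rewrite eq_le le//=.
have rV : 0 <= r^-1 by rewrite invr_ge0.
have ra0 j : 0 <= r * a j by rewrite mulr_ge0.
have := lee_wpmul2l (_ : 0 <= r%:E)%E (le r^-1 (fun j => r * a j) rV ra0).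
rewrite lee_fin => /(_ r0'); rewrite muleA -EFinM mulfV ?gt_eqF// mul1e.
by under eq_esum do rewrite mulKf ?gt_eqF//.
Qed.

(** The estimates for the two components of an edge, the second one weighted with r,
are added; c is replaced by M where it multiplies nonnegative terms. *)
Lemma weighted_pair_bound (R : realType) (K e r c M Wg WD Wgd WDd g0 g1 D0 D1 : R) :
  0 <= K -> 0 <= e -> 0 <= r -> 0 <= Wg -> 0 <= WD -> c <= M ->
  Wg + e * c * (1 + K) * g0 <= Wgd + e * c * g1 + e * c * K * Wg ->
  WD + e * c * (1 + K) * D0 <= WDd + e * c * D1 + e * c * K * WD ->
  WD + r * Wg + e * (1 + K) * (c * (D0 + r * g0)) <=
  WDd + r * Wgd + e * (c * (D1 + r * g1)) + e * (M * K) * (WD + r * Wg).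
Proof.
move=> K0 e0 r0 Wg0 WD0 cM Hg HD.
have : r * (Wg + e * c * (1 + K) * g0) <= r * (Wgd + e * c * g1 + e * c * K * Wg).
  by rewrite ler_wpM2l.
have : e * c * K * (WD + r * Wg) <= e * M * K * (WD + r * Wg).
  by rewrite ler_wpM2r ?addr_ge0 ?mulr_ge0// ler_wpM2r// ler_wpM2l.
move: HD; nra.
Qed.

(** The inflow Y is compensated by the outflow Z, which is finite and may therefore
be subtracted. *)
Lemma absorb_flux (R : realType) (A B K M eta : R) (Z Y : \bar R) :
  0 <= K -> 0 < eta -> (0 <= Z)%E -> (0 <= Y)%E -> (Z < +oo)%E -> (Y <= K%:E * Z)%E ->
  (A%:E + (eta * (1 + K))%:E * Z <= B%:E + eta%:E * Y + (eta * (M * K))%:E * A%:E)%E ->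
  A <= B + eta * (M * K * A).
Proof.
case: Z => [Z| |]// K0 eta0 Z0; case: Y => [Y| |]//.
rewrite -!EFinM -!EFinD !lee_fin => _ _ YZ S; rewrite lee_fin in Z0.
have : eta * Y <= eta * (K * Z) by rewrite ler_pM2l.
have : 0 <= eta * Z by rewrite mulr_ge0// ltW.
by move: S; lra.
Qed.

Section Energy.
Context {R : realType} {H G : digraph} (f : embedding H G).
Context (c : edge G -> R) (k : nat) (M : R) (rho : edge G -> R).
Local Notation head := Defs.head.
Hypothesis c_gt0 : forall e, 0 < c e.
Hypothesis c_le : forall e, c e <= M.
Hypothesis out_degree : forall v : G, ([set e : edge G | tail e = v] #<= `I_k)%card.
Hypothesis rho01 : forall e, 0 <= rho e <= 1.
Hypothesis rho_out : forall e, ~ range (edge_map f) e -> rho e = 1.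
Hypothesis rho_step : forall e e', head e = tail e' -> rho e' <= 2 * rho e.

Local Notation kap := (2 * k%:R : R).
Local Notation E := (extension_op f).

Definition extension_fun (v : L1fun (ell1 R (edge H))) : L1fun (ell1 R (edge G)) :=
  L1fun_map (L := ext_ell1 (edge_map_inj (f := f)))
    (rnorm_ext_ell1_le (edge_map_inj (f := f))) v.
Local Notation Em := extension_fun.

Lemma extension_op_of v : E (L1_of v) = L1_of (Em v).
Proof. exact: L1_map_of. Qed.

Lemma extension_funE (v : L1fun (ell1 R (edge H))) t j :
  Em v t j = ext_seq (edge_map f) (v t) j.
Proof. by []. Qed.

Let kap0 : 0 <= kap. Proof. by rewrite mulr_ge0. Qed.
Let one01 (e : edge G) : 0 <= (1 : R) <= 1. Proof. by rewrite ler01 lexx. Qed.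

(** The first term measures the error, the second one the mass of y, weighted by the
danger of leaving the subgraph soon. *)
Definition energy (x : L1 (ell1 R (edge G))) (y : L1 (ell1 R (edge H))) : R :=
  wnorm kap (fun=> 1) (x - E y) + wnorm kap rho (E y).

Lemma energy_ge0 x y : 0 <= energy x y.
Proof. by rewrite addr_ge0// wnorm_ge0. Qed.

Lemma energyD x x' y y' : energy (x + x') (y + y') <= energy x y + energy x' y'.
Proof.
rewrite /energy [E (y + y')]L1_mapD opprD addrACA [leRHS]addrACA.
by rewrite lerD// wnormD.
Qed.

Lemma energy_le x y : energy x y <= 2 * (1 + kap) * (rnorm x + rnorm y).
Proof.
have Ey : rnorm (E y) <= rnorm y by exact: rnorm_L1_map.
have h1 := wnorm_le kap0 one01 (x - E y).
have h2 := wnorm_le kap0 rho01 (E y).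
have h3 : rnorm (x - E y) <= rnorm x + rnorm (E y).
  by have := rnormD x (- E y); rewrite rnormN.
have := rnorm_ge0 x; have := rnorm_ge0 y; have := kap0.
rewrite /energy; move: h1 h2 h3 Ey.
set a := wnorm _ _ _; set b := wnorm _ _ _; set r1 := rnorm _; set r2 := rnorm _.
set r3 := rnorm _; set r4 := rnorm _; set K := 2 * _; clearbody a b r1 r2 r3 r4 K.
nra.
Qed.

Lemma rnorm_le_energy (x : L1 (ell1 R (edge G))) y : rnorm (E y - x) <= energy x y.
Proof.
rewrite -rnormN opprB (le_trans (rnorm_le_wnorm kap0 _))//.
by rewrite lerDl wnorm_ge0.
Qed.

(** On every edge, [coordinate_transport_inequality] bounds the weighted norm of a state
by that of the state minus eta times its derivative in time, and boundary terms.  Summed over the edges with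
weights 1 and rho, the boundary terms at 1 are absorbed by those at 0 by
[vertex_flux], because 2k <= 1 + 2k. *)
Lemma energy_dissipative x x' y y' (eta : R) : 0 < eta ->
  transport_op c x x' -> transport_op (fun e => c (edge_map f e)) y y' ->
  energy x y <= energy (x - eta%:C%C *: x') (y - eta%:C%C *: y')
    + eta * (M * kap * energy x y).
Proof.
move=> eta0 [u [h [kk [-> uh ub -> kkE]]]] [v [h' [kk' [-> vh vb -> kkE']]]].
pose g : L1fun (ell1 R (edge G)) := Em v; pose D : L1fun (ell1 R (edge G)) := u - g.
pose vd : L1fun (ell1 R (edge H)) := v - eta%:C%C *: kk'.
pose gd : L1fun (ell1 R (edge G)) := Em vd.
pose Dd : L1fun (ell1 R (edge G)) := (u - eta%:C%C *: kk) - gd.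
have E1 : L1_of u - E (L1_of v) = L1_of D by rewrite extension_op_of -L1_ofB.
have E2 : E (L1_of v) = L1_of g by rewrite extension_op_of.
have Evd : L1_of v - eta%:C%C *: L1_of kk' = L1_of vd by rewrite L1_ofB L1_ofZ.
have E4 : E (L1_of vd) = L1_of gd by exact: extension_op_of.
have E3 : L1_of u - eta%:C%C *: L1_of kk - E (L1_of vd) = L1_of Dd.
  by rewrite E4 -L1_ofZ -!L1_ofB.
rewrite Evd /energy E1 E2 E3 E4.
have gdE (t : R) j : 0 <= t <= 1 ->
    gd t j = g t j - (eta * c j)%:C%C * (Em h') t j.
  move=> t01.
  have -> : gd t j = g t j - eta%:C%C * (Em kk') t j.
    rewrite -[gd t j]/((ext_ell1 (edge_map_inj (f := f)) (v t - eta%:C%C *: kk' t)) j).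
    by rewrite linearB linearZ.
  rewrite rmorphM -mulrA; congr (_ - _ * _).
  rewrite !extension_funE.
  have [[l _ <-]|nj] := pselect (range (edge_map f) j).
    by rewrite !(ext_seqE (edge_map_inj (f := f))); exact: (kkE' t l t01).
  by rewrite !(ext_seq0 _ nj) mulr0.
have DdE (t : R) j : 0 <= t <= 1 ->
    Dd t j = D t j - (eta * c j)%:C%C * (h - Em h') t j.
  move=> t01.
  rewrite /Dd /D !L1fun_subE L1fun_scaleE !ell1_subE ell1_scaleE.
  rewrite gdE// (kkE t j t01) rmorphM.
  move: (u t j) (h t j) (g t j) (Em h' t j) (c j) => u' hj g' h'' cj.
  rewrite /=; ring.
have pg := ext_weak_primitive (edge_map_inj (f := f)) vh.
have pD := weak_primitiveB (W11_weak_primitive uh) pg.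
pose a j := wcoord kap (L1_of D) j + rho j * wcoord kap (L1_of g) j.
pose b j := wcoord kap (L1_of Dd) j + rho j * wcoord kap (L1_of gd) j.
pose ext (q : ell1 R (edge H)) : ell1 R (edge G) := ext_ell1 (edge_map_inj (f := f)) q.
(* weighted fluxes: z leaves the edges at 0, fl enters them at 1 *)
pose z j := c j * (rnorm (u 0 j - ext (v 0) j) + rho j * rnorm (ext (v 0) j)).
have DE t j : D t j = u t j - ext (v t) j by rewrite /D L1fun_subE ell1_subE.
have gE t j : g t j = ext (v t) j by [].
pose fl j := c j * (rnorm (u 1 j - ext (v 1) j) + rho j * rnorm (ext (v 1) j)).
have rho0 j : 0 <= rho j by have /andP[] := rho01 j.
have a0 j : 0 <= a j by rewrite addr_ge0 ?mulr_ge0 ?wcoord_ge0.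
have b0 j : 0 <= b j by rewrite addr_ge0 ?mulr_ge0 ?wcoord_ge0.
have c0 j : 0 <= c j by exact: ltW.
have z0 j : 0 <= z j by rewrite mulr_ge0 ?addr_ge0 ?mulr_ge0 ?rnorm_ge0.
have fl0 j : 0 <= fl j by rewrite mulr_ge0 ?addr_ge0 ?mulr_ge0 ?rnorm_ge0.
have e0 := ltW eta0.
have M0 (j : edge G) : 0 <= M by rewrite (le_trans (c0 j) (c_le j)).
have key j : a j + eta * (1 + kap) * z j <= b j + eta * fl j + eta * (M * kap) * a j.
  have ec0 : 0 <= eta * c j by rewrite mulr_ge0.
  have := @coordinate_transport_inequality _ _ _ _ pD j _ kap Dd ec0 kap0 (fun t => @DdE t j).
  have := @coordinate_transport_inequality _ _ _ _ pg j _ kap gd ec0 kap0 (fun t => @gdE t j).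
  cbv zeta; rewrite -!wcoord_of// !DE !gE /a /b /z /fl.
  have := wcoord_ge0 kap0 (L1_of D) j; have := wcoord_ge0 kap0 (L1_of g) j.
  set Wg := wcoord _ _ _; set WD := wcoord _ _ _.
  set Wgd := wcoord _ _ _; set WDd := wcoord _ _ _.
  set g0 := rnorm _; set g1 := rnorm _; set D0 := rnorm _; set D1 := rnorm _.
  move=> Wg0 WD0 Hg HD.
  exact: (weighted_pair_bound kap0 e0 (rho0 j) Wg0 WD0 (c_le j) Hg HD).
have aE : \esum_(j in setT) (a j)%:E =
    (wnorm kap (fun=> 1) (L1_of D) + wnorm kap rho (L1_of g))%:E.
  rewrite EFinD !wnormE// -esumD; last 2 first.
  - by move=> j _; rewrite lee_fin mul1r wcoord_ge0.
  - by move=> j _; rewrite lee_fin mulr_ge0 ?wcoord_ge0.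
  by apply: eq_esum => j _; rewrite -EFinD mul1r.
have bE : \esum_(j in setT) (b j)%:E =
    (wnorm kap (fun=> 1) (L1_of Dd) + wnorm kap rho (L1_of gd))%:E.
  rewrite EFinD !wnormE// -esumD; last 2 first.
  - by move=> j _; rewrite lee_fin mul1r wcoord_ge0.
  - by move=> j _; rewrite lee_fin mulr_ge0 ?wcoord_ge0.
  by apply: eq_esum => j _; rewrite -EFinD mul1r.
have Zfin : (\esum_(j in setT) (z j)%:E < +oo)%E.
  have rn (q : ell1 R (edge G)) : \esum_(j in setT) (M * rnorm (q j))%:E =
      (M * rnorm q)%:E.
    (* without an edge, the sign of M is unknown *)
    have [[j _]|nj] := pselect (exists j : edge G, True).
      by rewrite esum_rnormE//; exact: (M0 j).
    rewrite esum1 ?rnorm_ell1E; last by move=> j; case: nj; exists j.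
    rewrite EFinM ell1_normE esum1 ?mule0// => j; case: nj; by exists j.
  apply: (@le_lt_trans _ _ ((\esum_(j in setT) (M * rnorm (D 0 j))%:E) +
      \esum_(j in setT) (M * rnorm (g 0 j))%:E)%E); last first.
    by rewrite !rn -EFinD ltry.
  rewrite -esumD; last 2 first.
  - by move=> j _; rewrite lee_fin mulr_ge0 ?rnorm_ge0 ?(M0 j).
  - by move=> j _; rewrite lee_fin mulr_ge0 ?rnorm_ge0 ?(M0 j).
  apply: le_esum => j _; rewrite -EFinD lee_fin /z -DE -gE -mulrDr.
  rewrite ler_pM// ?addr_ge0 ?mulr_ge0 ?rnorm_ge0//.
  by rewrite lerD2l ler_piMl ?rnorm_ge0//; have /andP[] := rho01 j.
have YZ : (\esum_(j in setT) (fl j)%:E <= kap%:E * \esum_(j in setT) (z j)%:E)%E.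
  rewrite -esumZ//.
  exact: (vertex_flux c_gt0 out_degree rho01 rho_out rho_step ub vb).
have summed : ((\esum_(j in setT) (a j)%:E) + (eta * (1 + kap))%:E * (\esum_(j in setT) (z j)%:E)
   <= (\esum_(j in setT) (b j)%:E) + eta%:E * (\esum_(j in setT) (fl j)%:E)
     + (eta * (M * kap))%:E * \esum_(j in setT) (a j)%:E)%E.
  (* without an edge, the sign of M is unknown *)
  have [[j0 _]|nj] := pselect (exists j : edge G, True); last first.
    by rewrite !esum1 ?mule0 ?adde0// => j; case: nj; exists j.
  have M0' := M0 j0.
  have r1 : 0 <= eta * (1 + kap) by rewrite mulr_ge0// addr_ge0.
  have r2 : 0 <= eta * (M * kap) by rewrite !mulr_ge0.
  rewrite -(esumZ r1 z0) -(esumZ e0 fl0) -(esumZ r2 a0).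
  have pos (s : R) (q : edge G -> R) : 0 <= s -> (forall j, 0 <= q j) ->
      forall j : edge G, setT j -> (0 <= (s * q j)%:E)%E.
    by move=> s0 q0 j _; rewrite lee_fin mulr_ge0.
  have pz := pos _ _ r1 z0; have pf := pos _ _ e0 fl0; have pa := pos _ _ r2 a0.
  have pb (j : edge G) : setT j -> (0 <= (b j)%:E)%E by rewrite lee_fin.
  have pbf (j : edge G) : setT j -> (0 <= (b j)%:E + (eta * fl j)%:E)%E.
    by move=> jT; rewrite adde_ge0 ?pb ?pf.
  have paa (j : edge G) : setT j -> (0 <= (a j)%:E)%E by rewrite lee_fin.
  rewrite -(esumD paa pz) -(esumD pb pf) -(esumD pbf pa).
  by apply: le_esum => j _; rewrite -!EFinD lee_fin key.
move: summed YZ Zfin; rewrite aE bE.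
have Z0 : (0 <= \esum_(j in setT) (z j)%:E)%E by apply: esum_ge0 => j _; rewrite lee_fin.
have Y0 : (0 <= \esum_(j in setT) (fl j)%:E)%E by apply: esum_ge0 => j _; rewrite lee_fin.
move=> summed YZ Zfin; exact: (absorb_flux kap0 eta0 Z0 Y0 Zfin YZ summed).
Qed.

End Energy.

(** * Dissipativity bounds the growth of semigroups *)

Section Orbits.
Context {R : realType} {X : normedModType R[i]} (S : R -> X -> X).
Hypothesis SC : C0_semigroup S.

Let S_lin t : 0 <= t -> linear (S t). Proof. move=> t0; exact: (C0_linear SC t0). Qed.

Let SZ t (k : R[i]) x : 0 <= t -> S t (k *: x) = k *: S t x.
Proof.
move=> t0; have S0 : S t 0 = 0.
  have := S_lin t0 1 0 0; rewrite !scale1r addr0 => /eqP.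
  by rewrite -[X in X == _]addr0 (inj_eq (addrI _)) eq_sym => /eqP.
by have := S_lin t0 k x 0; rewrite addr0 S0 addr0.
Qed.

Lemma C0_semigroupB t x y : 0 <= t -> S t (x - y) = S t x - S t y.
Proof.
move=> t0; rewrite addrC; have := S_lin t0 (-1) y x.
by rewrite !scaleN1r => ->; rewrite addrC.
Qed.

Lemma rnorm_lt_cvgP (T : Type) (F : set_system T) (f : T -> X) (y : X) :
  Filter F -> f @ F --> y <-> forall e : R, 0 < e -> \forall t \near F, rnorm (y - f t) < e.
Proof.
move=> FF; split => [/cvgrPdist_lt fy e e0|H].
  have e0' : 0 < (e%:C)%C :> R[i] by rewrite ltcR.
  by move: (fy _ e0'); apply: filterS => t; rewrite rnormE ltcR.
apply/cvgrPdist_lt => e e0.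
have eE : e = (complex.Re e)%:C%C by apply/esym/RRe_real; rewrite gtr0_real.
rewrite eE ltcR in e0; move: (H _ e0); apply: filterS => t.
by rewrite rnormE eE ltcR.
Qed.

Lemma orbit_continuous x t : 0 <= t -> forall e, 0 < e ->
  exists2 d, 0 < d & forall s, 0 <= s -> `|s - t| < d -> rnorm (S s x - S t x) < e.
Proof.
move=> t0 e e0; have /subspace_continuousP/(_ t) := C0_continuous SC (x := x).
rewrite /= in_itv/= t0 => /(_ isT) /rnorm_lt_cvgP /(_ e e0).
rewrite /prop_near1 /within/= => -[d /= d0 dP].
exists d => // s s0 st; rewrite -rnormN opprB; apply: dP; last by rewrite /= in_itv/= s0.
by rewrite /= distrC.
Qed.

(** The operators S t are linear and continuous and commute with the semigroup, so they map
difference quotients to difference quotients. *)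
Lemma generator_orbit x y t : 0 <= t -> generator S x y -> generator S (S t x) (S t y).
Proof.
move=> t0 xy.
have ct : continuous (S t) by exact: (C0_bounded SC t0).
have := @cvg_comp _ _ _ _ _ _ _ _ xy (ct y).
apply: cvg_trans; apply: near_eq_cvg.
exists 1 => //= h _ h0.
rewrite /= SZ// C0_semigroupB//; congr (_ *: (_ - _)).
by rewrite -!(C0_comp SC)// ?(ltW h0)// addrC.
Qed.

Lemma generator_difference x y : generator S x y -> forall e, 0 < e ->
  exists2 d, 0 < d & forall h, 0 < h < d -> rnorm (S h x - x - h%:C%C *: y) <= e * h.
Proof.
move=> /rnorm_lt_cvgP xy e e0; have [d /= d0 dP] := xy e e0.
exists d => // h /andP[h0 hd].
have hb : ball_ [eta Num.Def.normr] 0 d h by rewrite /= sub0r normrN gtr0_norm.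
have := dP h hb h0; rewrite /= => lt.
have hC : h%:C%C != 0 :> R[i] by rewrite fmorph_eq0 gt_eqF.
have -> : S h x - x - h%:C%C *: y = - (h%:C%C *: (y - (h^-1)%:C%C *: (S h x - x))).
  by rewrite scalerBr opprB scalerA fmorphV mulfV// scale1r.
by rewrite rnormN rnormZ rnorm_real gtr0_norm// mulrC ler_pM2r// ltW.
Qed.

(** An implicit Euler step from s back to t.  It is compared with the explicit step at t,
and S s y with S t y by strong continuity. *)
Lemma orbit_backward_difference x y t : 0 <= t -> generator S x y -> forall e, 0 < e ->
  exists2 d, 0 < d & forall s, t < s < t + d ->
    rnorm (S s x - (s - t)%:C%C *: S s y - S t x) <= e * (s - t).
Proof.
move=> t0 xy e e0.
have e20 : 0 < e / 2 by rewrite divr_gt0.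
have [d1 d10 H1] := generator_difference (generator_orbit t0 xy) e20.
have [d2 d20 H2] := orbit_continuous y t0 e20.
exists (Num.min d1 d2); first by rewrite lt_min d10.
move=> s /andP[ts]; rewrite -ltrBlDl lt_min => /andP[sd1 sd2].
have h0 : 0 < s - t by rewrite subr_gt0.
have s0 : 0 <= s by rewrite (le_trans t0) ?ltW.
have := H1 (s - t); rewrite h0 sd1 => /(_ isT).
rewrite -(C0_comp SC) ?(ltW h0)// subrK => A1.
have A2 : rnorm ((s - t)%:C%C *: (S s y - S t y)) <= e / 2 * (s - t).
  rewrite rnormZ rnorm_real gtr0_norm// mulrC ler_pM2r// ltW// H2//.
  by rewrite gtr0_norm.
have -> : S s x - (s - t)%:C%C *: S s y - S t x =
    (S s x - S t x - (s - t)%:C%C *: S t y) - (s - t)%:C%C *: (S s y - S t y).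
  by rewrite scalerBr opprB addrA subrK addrAC.
have := rnormD (S s x - S t x - (s - t)%:C%C *: S t y) (- ((s - t)%:C%C *: (S s y - S t y))).
by rewrite rnormN; lra.
Qed.

End Orbits.

Section Growth.
Context {R : realType} {X Y : normedModType R[i]} (S : R -> X -> X) (S' : R -> Y -> Y).
Hypothesis SC : C0_semigroup S.
Hypothesis SC' : C0_semigroup S'.
Variables (P : X -> Y -> R) (K om : R).
Hypothesis om0 : 0 <= om.
Hypothesis K0 : 0 < K.
Hypothesis P0 : forall x y, 0 <= P x y.
Hypothesis PD : forall x x' y y', P (x + x') (y + y') <= P x y + P x' y'.
Hypothesis Pb : forall x y, P x y <= K * (rnorm x + rnorm y).
Hypothesis dissipative : forall x x' y y' (eta : R), 0 < eta ->
  generator S x x' -> generator S' y y' ->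
  P x y <= P (x - eta%:C%C *: x') (y - eta%:C%C *: y') + eta * (om * P x y).

Let P_le x y x' y' : P x y <= P x' y' + K * (rnorm (x - x') + rnorm (y - y')).
Proof.
rewrite -{1}(subrK x' x) -{1}(subrK y' y) addrC [X in P _ X]addrC.
by apply: le_trans (PD _ _ _ _) _; rewrite lerD2l Pb.
Qed.

(** By dissipativity at time s, applied with step s - t, the function
N s = P (S s x) (S' s y) satisfies N s <= N t + (s - t) (om N s + o(1)) as s decreases to t.
Hence exp (- om s) N s has nonpositive right Dini derivative. *)
Lemma growth_domain x x' y y' : generator S x x' -> generator S' y y' ->
  forall t, 0 <= t -> P (S t x) (S' t y) <= expR (om * t) * P x y.
Proof.
move=> xx' yy' b b0; pose N s := P (S s x) (S' s y).
pose G s := expR (- (om * s)) * N s.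
suff : G b <= G 0.
  rewrite /G /N mulr0 oppr0 expR0 mul1r !C0_id// expRN.
  by rewrite ler_pdivrMl ?expR_gt0.
have close t e : 0 <= t -> 0 < e -> exists2 d, 0 < d & forall s, 0 <= s ->
    `|s - t| < d -> `|N s - N t| < e.
  move=> t0 e0; have e'0 : 0 < e / K / 2 by rewrite !divr_gt0.
  have [d1 d10 H1] := orbit_continuous SC x t0 e'0.
  have [d2 d20 H2] := orbit_continuous SC' y t0 e'0.
  exists (Num.min d1 d2); first by rewrite lt_min d10.
  move=> s s0; rewrite lt_min => /andP[sd1 sd2].
  have h1 := H1 s s0 sd1; have h2 := H2 s s0 sd2.
  have e2 : K * (rnorm (S s x - S t x) + rnorm (S' s y - S' t y)) < e.
    by rewrite mulrC -ltr_pdivlMr//; rewrite (splitr (e / K)) ltrD.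
  have A := P_le (S s x) (S' s y) (S t x) (S' t y).
  have B := P_le (S t x) (S' t y) (S s x) (S' s y).
  rewrite -(rnormN (S t x - _)) opprB -(rnormN (S' t y - _)) opprB in B.
  rewrite ltr_norml /N; apply/andP; split; lra.
apply: right_dini_nonincreasing => //.
  apply/subspace_continuousP => t; rewrite /= in_itv/= => /andP[t0 tb].
  apply: cvgM; last first.
    apply/cvgrPdist_lt => e e0; have [d d0 dP] := close t e t0 e0.
    rewrite /prop_near1 /within/=; exists d => //= s st.
    by rewrite in_itv/= => /andP[s0 _]; rewrite distrC dP// distrC.
  apply: cvg_within_filter.
  have : continuous (fun s : R => expR (- (om * s))).
    move=> s; apply: (@continuous_comp _ _ _ (fun s : R => - (om * s)) expR); last exact: continuous_expR.
    by apply: cvgN; apply: cvgMr; exact: cvg_id.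
  exact.
move=> t /andP[t0 tb] e0 e00.
pose e := e0 / (2 * K + om + 1).
have den : 0 < 2 * K + om + 1 by rewrite ltr_wpDl// addr_ge0// mulr_ge0// ltW.
have e_gt0 : 0 < e by rewrite divr_gt0.
have [d1 d10 H1] := orbit_backward_difference SC t0 xx' e_gt0.
have [d2 d20 H2] := orbit_backward_difference SC' t0 yy' e_gt0.
have [d3 d30 H3] := close t e t0 e_gt0.
exists (Num.min d1 (Num.min d2 d3)); first by rewrite !lt_min d10 d20.
move=> s /andP[ts]; rewrite -ltrBlDl !lt_min => /and3P[sd1 sd2 sd3] sb.
have s0 : 0 <= s by rewrite (le_trans t0) ?ltW.
have h0 : 0 < s - t by rewrite subr_gt0.
have := H1 s; rewrite ts -ltrBlDl sd1 => /(_ isT) B1.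
have := H2 s; rewrite ts -ltrBlDl sd2 => /(_ isT) B2.
have := H3 s s0; rewrite gtr0_norm// => /(_ sd3); rewrite ltr_norml => /andP[_ B3].
have D := dissipative h0 (generator_orbit SC s0 xx') (generator_orbit SC' s0 yy').
have L := P_le (S s x - (s - t)%:C%C *: S s x') (S' s y - (s - t)%:C%C *: S' s y') (S t x) (S' t y).
have B4 : N s <= N t * (1 + om * (s - t)) + e0 * (s - t).
  have e0E : e0 = e * (2 * K + om + 1) by rewrite /e mulfVK// gt_eqF.
  have KB : K * (rnorm (S s x - (s - t)%:C%C *: S s x' - S t x)
      + rnorm (S' s y - (s - t)%:C%C *: S' s y' - S' t y)) <= K * (2 * e * (s - t)).
    by rewrite ler_pM2l//; move: B1 B2; lra.
  have NB : (s - t) * (om * N s) <= (s - t) * (om * (N t + e)).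
    by rewrite ler_pM2l// ler_wpM2l//; move: B3; lra.
  rewrite -/(N s) in D; rewrite -/(N t) in L; rewrite e0E.
  have eh : 0 <= e * (s - t) by rewrite mulr_ge0// ltW.
  move: D L KB NB eh; lra.
have E1 : 1 + om * (s - t) <= expR (om * (s - t)) by exact: expR_ge1Dx.
have ES : expR (- (om * t)) = expR (- (om * s)) * expR (om * (s - t)).
  by rewrite -expRD; congr expR; ring.
rewrite /G ES -mulrA.
have Es1 : expR (- (om * s)) <= 1 by rewrite -expR0 ler_expR oppr_le0 mulr_ge0.
have Es0 := expR_ge0 (- (om * s)).
apply: (@le_trans _ _ (expR (- (om * s)) * (N t * (1 + om * (s - t)) + e0 * (s - t)))).
  by rewrite ler_wpM2l.
rewrite mulrDr lerD//.
  by rewrite ler_wpM2l// mulrC ler_wpM2r// P0.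
by rewrite ler_piMl// mulr_ge0// ltW.
Qed.

Hypothesis dense : forall x e, 0 < e -> exists x0 x0', generator S x0 x0' /\ rnorm (x - x0) < e.
Hypothesis dense' : forall y e, 0 < e -> exists y0 y0', generator S' y0 y0' /\ rnorm (y - y0) < e.

Let continuity_at (Z : normedModType R[i]) (U : R -> Z -> Z) : C0_semigroup U ->
  forall t x, 0 <= t -> forall e, 0 < e -> exists2 d, 0 < d & forall x0,
    rnorm (x - x0) < d -> rnorm (U t x - U t x0) < e.
Proof.
move=> UC t x t0 e e0.
have /cvgrPdist_lt cU := C0_bounded UC t0 (x := x).
have e0' : 0 < (e%:C)%C :> R[i] by rewrite ltcR.
have /nbhs_ballP[d /= d0 dP] := cU _ e0'.
have dE : d = (complex.Re d)%:C%C by apply/esym/RRe_real; rewrite gtr0_real.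
exists (complex.Re d); first by rewrite -ltcR -dE.
move=> x0 xx0; have := dP x0; rewrite /= rnormE ltcR; apply.
by rewrite -ball_normE /= rnormE dE ltcR.
Qed.

(** For a fixed time both sides depend continuously on (x, y), so the estimate extends
from the domains by density. *)
Theorem dissipative_growth x y t : 0 <= t ->
  P (S t x) (S' t y) <= expR (om * t) * P x y.
Proof.
move=> t0; apply/ler_addgt0Pr => e e0.
pose E := expR (om * t); have E0 : 0 < E by exact: expR_gt0.
pose r := e / (2 * K * (1 + E)).
have den : 0 < 2 * K * (1 + E) by rewrite !mulr_gt0// addr_gt0.
have r0 : 0 < r by rewrite divr_gt0.
have [d d0 dP] := continuity_at SC x t0 r0.
have [d' d'0 dP'] := continuity_at SC' y t0 r0.
have m1 : 0 < Num.min d r by rewrite lt_min d0.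
have m2 : 0 < Num.min d' r by rewrite lt_min d'0.
have [x0 [x0' [gx xx0]]] := dense x m1.
have [y0 [y0' [gy yy0]]] := dense' y m2.
move: xx0 yy0; rewrite !lt_min => /andP[xx0 xr] /andP[yy0 yr].
have A := P_le (S t x) (S' t y) (S t x0) (S' t y0).
have B := growth_domain gx gy t0.
have C := P_le x0 y0 x y.
rewrite -(rnormN (x0 - x)) opprB -(rnormN (y0 - y)) opprB in C.
have h1 := dP _ xx0; have h2 := dP' _ yy0.
have A' : P (S t x) (S' t y) <= P (S t x0) (S' t y0) + K * (r + r).
  by apply: le_trans A _; rewrite lerD2l ler_pM2l// lerD// ltW.
have C' : P x0 y0 <= P x y + K * (r + r).
  by apply: le_trans C _; rewrite lerD2l ler_pM2l// lerD// ltW.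
have C'' : E * P x0 y0 <= E * (P x y + K * (r + r)) by rewrite ler_pM2l.
have eE : e = r * (2 * K * (1 + E)) by rewrite /r mulfVK// gt_eqF.
move: A' B C''; rewrite -/E eE; lra.
Qed.

End Growth.

(** * Forward averages of indicator functions *)

Section Averages.
Context {R : realType}.
Local Notation mu := (@lebesgue_measure R).
Local Notation I01 := (`[0%R, 1%R]%classic : set R).

Lemma measurable_translation (d : R) :
  measurable_fun setT (fun x : R => x + d).
Proof. by apply: measurable_funD => //; exact: measurable_cst. Qed.

(** The image of Lebesgue measure under a translation gives intervals their length. *)
Lemma lebesgue_measure_translation (d : R) (A : set R) : measurable A ->
  mu ((fun x => x + d) @^-1` A) = mu A.
Proof.
move=> mA; pose t : measurableTypeR R -> measurableTypeR R := fun x => x + d.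
have mt : measurable_fun setT t by exact: measurable_translation.
rewrite -[LHS]/(pushforward mu t A).
apply/esym/lebesgue_measure_unique => //= _ [[a b]] _ <-.
rewrite /pushforward.
have -> : t @^-1` `]a, b] = `]a - d, b - d]%classic.
  by apply/seteqP; split => x /=; rewrite !in_itv/= /t ltrBlDr lerBrDr.
rewrite /= !lebesgue_measure_itv/= !lte_fin ltrD2r.
by case: ifP => // _; rewrite -!EFinB; congr EFin; ring.
Qed.

Variable A : set R.
Hypothesis mA : measurable A.
Hypothesis A01 : A `<=` I01.

(** Cutting off ]0, d] makes the forward average vanish at 0. *)
Definition trim (d : R) : set R := A `&` `]d, 1].
(** A primitive of the indicator function of B. *)
Definition cumul (B : set R) (x : R) : R := fine (mu (B `&` `]-oo, x])).
(** The average of the indicator function of [trim d] over ]x, x + d].  It vanishes at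
0 and 1, and its derivative takes finitely many values, so that its multiples by
vectors lie in the domain of every transport operator. *)
Definition forward_average (d x : R) : R :=
  d^-1 * (cumul (trim d) (x + d) - cumul (trim d) x).

Lemma measurable_trim d : measurable (trim d).
Proof. by apply: measurableI => //; exact: measurable_itv. Qed.

Let fin_sub (B : set R) : measurable B -> B `<=` I01 -> mu B \is a fin_num.
Proof.
move=> mB B01; rewrite ge0_fin_numE//; apply: (@le_lt_trans _ _ (mu I01)).
  by apply: le_measure => //; rewrite inE//; exact: measurable_itv.
by rewrite lebesgue_measure_itv/= lte_fin ltr01 -EFinB ltry.
Qed.

Lemma cumul_diff (B : set R) (x y : R) : measurable B -> B `<=` I01 -> x <= y ->
  cumul B y - cumul B x = fine (mu (B `&` `]x, y])).
Proof.
move=> mB B01 xy; rewrite /cumul.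
have -> : B `&` `]-oo, y] = (B `&` `]-oo, x]) `|` (B `&` `]x, y]).
  rewrite -setIUr; congr (_ `&` _); apply/seteqP; split => z /=; rewrite !in_itv/=.
    by move=> zy; case: (leP z x) => ?; [left|right].
  by case=> [zx|/andP[//]]; exact: le_trans zx xy.
rewrite measureU//=.
- rewrite fineD; first by rewrite addrAC subrr add0r.
  + by apply: fin_sub; [apply: measurableI|move=> z [/B01]].
  + by apply: fin_sub; [apply: measurableI|move=> z [/B01]].
- by apply: measurableI.
- by apply: measurableI.
- apply/seteqP; split => // z [[_ /=]]; rewrite in_itv/= => zx [_] /=.
  by rewrite in_itv/= => /andP[]; rewrite ltNge zx.
Qed.

Lemma cumul_nondecreasing (B : set R) : measurable B -> B `<=` I01 ->
  nondecreasing_fun (cumul B).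
Proof.
move=> mB B01 x y xy; rewrite -subr_ge0 cumul_diff// fine_ge0//.
Qed.

Lemma cumul_lip (B : set R) (x y : R) : measurable B -> B `<=` I01 -> x <= y ->
  cumul B y - cumul B x <= y - x.
Proof.
move=> mB B01 xy; rewrite cumul_diff//.
have : (mu (B `&` `]x, y]) <= (y - x)%:E)%E.
  apply: (@le_trans _ _ (mu `]x, y])).
    by apply: le_measure; rewrite ?inE//; exact: measurableI.
  by rewrite lebesgue_measure_itv/= lte_fin; case: ltP => // ?; rewrite lee_fin subr_ge0.
rewrite -lee_fin fineK//; apply: fin_sub; first exact: measurableI.
by move=> z [/B01].
Qed.

Lemma trim01 d : trim d `<=` I01.
Proof. by move=> x [/A01]. Qed.

Lemma forward_average_bounds d x : 0 < d -> 0 <= forward_average d x <= 1.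
Proof.
move=> d0; have xd : x <= x + d by rewrite lerDl ltW.
have mc := measurable_trim d; have c01 := @trim01 d.
apply/andP; split.
  by rewrite mulr_ge0 ?invr_ge0 ?(ltW d0)// subr_ge0 cumul_nondecreasing.
rewrite -(mulVf (lt0r_neq0 d0)) ler_pM2l ?invr_gt0//.
by rewrite (le_trans (cumul_lip _ _ _))// addrAC subrr add0r.
Qed.

Lemma measurable_forward_average (D : set R) d : measurable D ->
  measurable_fun D (forward_average d).
Proof.
move=> mD; have nd := cumul_nondecreasing (measurable_trim d) (@trim01 d).
apply: measurable_funM; first exact: measurable_cst.
apply: measurable_funB; last exact: nondecreasing_measurable.
by apply: nondecreasing_measurable => // x y xy; rewrite nd// lerD2r.
Qed.

Lemma forward_average_at0 d : 0 < d -> forward_average d 0 = 0.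
Proof.
move=> d0; rewrite /forward_average add0r cumul_diff ?(ltW d0)//;
  [|exact: measurable_trim|exact: trim01].
rewrite (_ : _ `&` _ = set0) ?measure0 ?mulr0//; apply/seteqP; split => // x [[_ /=]].
by rewrite !in_itv/= => /andP[dx _] /andP[_]; rewrite leNgt dx.
Qed.

Lemma forward_average_at1 d : 0 < d -> forward_average d 1 = 0.
Proof.
move=> d0; rewrite /forward_average cumul_diff ?lerDl ?(ltW d0)//;
  [|exact: measurable_trim|exact: trim01].
rewrite (_ : _ `&` _ = set0) ?measure0 ?mulr0//; apply/seteqP; split => // x [[_ /=]].
by rewrite !in_itv/= => /andP[_ x1] /andP[]; rewrite ltNge x1.
Qed.

(** The shifted indicator function is integrated by translation invariance. *)
Lemma forward_average_primitive (d x : R) : 0 < d -> 0 <= x <= 1 ->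
  \int[mu]_(s in `[0, x]) (d^-1 * (\1_(trim d) (s + d) - \1_(trim d) s)) =
  forward_average d x.
Proof.
move=> d0 /andP[x0 x1]; have mc := measurable_trim d; have c01 := @trim01 d.
have m0x : (mu `[0%R, x]%classic < +oo)%E.
  by rewrite lebesgue_measure_itv/=; case: ifP => _; rewrite ?ltry// -EFinB ltry.
pose B := (fun s : R => s + d) @^-1` trim d.
have mB : measurable B.
  by rewrite -[B]setTI; exact: (@measurable_translation d).
have i1 C : measurable C -> mu.-integrable `[0, x] (EFin \o (\1_C : R -> R)).
  move=> mC; apply: eq_integrable (integrable_cindic 1 _ mC m0x) => //.
  by move=> s _; rewrite /= mul1r.
have I1 C : measurable C -> \int[mu]_(s in `[0, x]) (\1_C s : R) = fine (mu (C `&` `[0, x])).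
  by move=> mC; rewrite /Rintegral integral_indic.
under eq_Rintegral => s _ do rewrite -[\1_(trim d) (s + d)]/(\1_B s : R).
have iB := i1 _ mB; have ic := i1 _ mc.
rewrite RintegralZl//; last exact: (@integrableB _ _ _ mu _ _ _ _ iB ic).
rewrite RintegralB// !I1//; congr (_ * (_ - _)).
  rewrite /cumul; congr fine.
  rewrite -(@lebesgue_measure_translation d (trim d `&` `]-oo, x + d])); last exact: measurableI.
  congr (mu _); apply/seteqP; split => s /=; rewrite /B /= !in_itv/= => -[cs].
    by move=> /andP[_ sx]; split => //; rewrite lerD2r.
  rewrite lerD2r => sx; split => //; rewrite sx andbT.
  by move: cs => [_ /=]; rewrite in_itv/= -ltrBlDr subrr => /andP[/ltW].
rewrite /cumul; congr (fine (mu _)); apply/seteqP; split => s /=; rewrite !in_itv/= => -[cs].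
  by move=> /andP[].
by move=> sx; split => //; rewrite sx andbT; have := c01 _ cs; rewrite /= in_itv/= => /andP[].
Qed.

Let step (n : nat) : R := n.+1%:R^-1.

(** By Lebesgue's differentiation theorem the averages over ]x, x + d] tend to the
indicator function almost everywhere; for small d the removed set ]0, d] lies to the
left of x.  The averages are bounded by 1, so they converge in the mean as well. *)
Lemma forward_average_cvg :
  (\int[mu]_(x in I01) `|forward_average (step n) x - \1_A x|%:E)%E @[n --> \oo] --> 0%E.
Proof.
have mI : measurable I01 by exact: measurable_itv.
have step0 n : 0 < step n by rewrite invr_gt0.
have step_cvg : step @ \oo --> (0 : R) by exact: cvg_harmonic.
have ae : {ae mu, forall x, I01 x ->
    (forward_average (step n) x)%:E @[n --> \oo] --> (\1_A x : R)%:E}.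
  have iA y : mu.-integrable `]-oo, y] (EFin \o (\1_A : R -> R)).
    apply/integrableP; split; first by apply/measurable_EFinP; exact: measurable_indic.
    rewrite (@eq_integral _ _ _ mu _ (fun s => (\1_A s)%:E)); last first.
      by move=> s _; rewrite /= ger0_norm.
    rewrite integral_indic//; apply: (@le_lt_trans _ _ (mu A)).
      by apply: le_measure; rewrite ?inE//; exact: measurableI.
    by have := fin_sub mA A01; rewrite ge0_fin_numE.
  have lA : locally_integrable setT (\1_A : R -> R).
    by apply: locally_integrable_indic => //; exact: openT.
  have := FTC1Ny iA lA.
  have FE : (fun x => \int[mu]_(t in `]-oo, x]) (\1_A t : R)) = cumul A.
    by apply/funext => x; rewrite /Rintegral integral_indic.
  rewrite FE => H.
  have N0 : {ae mu, forall x, x != 0}.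
    exists [set 0]; split => //; first exact: lebesgue_measure_set1.
    by move=> x /= /negP; rewrite negbK => /eqP.
  apply: (@filterS2 _ _ (ae_filter_ringOfSetsType mu) _ _ _ _ H N0) => x [dF dFE] x0 /=.
  rewrite in_itv/= => /andP[x_ge0 x1].
  have xgt0 : 0 < x by rewrite lt_neqAle eq_sym x0.
  have quot : h^-1 *: (cumul A (h *: 1 + x) - cumul A x) @[h --> (0:R)^'] --> (\1_A x : R).
    by rewrite -dFE derive1E; exact: dF.
  have {}quot : (step n)^-1 *: (cumul A (step n *: 1 + x) - cumul A x) @[n --> \oo] --> (\1_A x : R).
    move/cvgr_dnbhsP: quot; apply; split => // n; by rewrite gt_eqF.
  apply: cvg_EFin; first exact: nearW.
  apply: cvg_trans quot; apply: near_eq_cvg.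
  have : \forall n \near \oo, step n < x.
    by move/cvgrPdist_lt: step_cvg => /(_ x xgt0); apply: filterS => n;
       rewrite sub0r normrN gtr0_norm.
  apply: filterS => n nx; rewrite /= /forward_average.
  have xs : x <= x + step n by rewrite lerDl ltW.
  rewrite -[_ *: 1]/(step n * 1) mulr1 (addrC (step n)) -[LHS]/(_^-1 * _).
  rewrite !cumul_diff//; [|exact: measurable_trim|exact: trim01].
  congr (_ * fine (mu _)); apply/seteqP; split => z /= [cz]; rewrite in_itv/= => /andP[xz zx].
    split; last by rewrite xz.
    split => //; rewrite /= in_itv/= (lt_trans nx xz)/=.
    by have := A01 cz; rewrite /= in_itv/= => /andP[].
  by split; [case: cz|rewrite xz].
have i1 : mu.-integrable I01 (EFin \o (cst 1 : R -> R)).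
  apply: continuous_compact_integrable; first exact: segment_compact.
  by move=> z; exact: cvg_cst.
have [] := @dominated_convergence _ _ _ mu _ mI
  (fun n x => (forward_average (step n) x)%:E) (fun x => (\1_A x)%:E) (EFin \o cst 1).
- by move=> n; apply/measurable_EFinP; exact: measurable_forward_average.
- by apply/measurable_EFinP; exact: measurable_indic.
- exact: ae.
- exact: i1.
- apply: aeW => x n _ /=; rewrite lee_fin; have /andP[f0 f1] := forward_average_bounds x (step0 n).
  by rewrite ger0_norm.
- by [].
Qed.

End Averages.

(** * Simple functions are dense *)

Section SimpleL1.
Import HBSimple.
Context {R : realType} {E : normedModType R[i]}.
Local Notation mu := (@lebesgue_measure R).
Local Notation I01 := (`[0%R, 1%R]%classic : set R).

Let mI01 : measurable (I01 : set R). Proof. exact: measurable_itv. Qed.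

Lemma lebesgue_itv01_lty : (mu I01 < +oo)%E.
Proof. by rewrite lebesgue_measure_itv/= lte_fin ltr01 -EFinB ltry. Qed.

Lemma simple_fun_L1 (s : R -> E) : simple_fun s -> s \in L1_pred.
Proof.
move=> ss; apply/asboolP; split; first exact: strongly_measurable_simple.
have /integrableP[_] := integrable_simple rnorm mI01 lebesgue_itv01_lty ss.
apply: le_lt_trans; rewrite le_eqVlt; apply/orP; left; apply/eqP.
by apply: eq_integral => x _; rewrite /= ger0_norm// rnorm_ge0.
Qed.

Definition simple_L1 (s : R -> E) (ss : simple_fun s) : L1fun E :=
  MkL1fun (simple_fun_L1 ss).

Lemma simple_fun_restr (s : R -> E) (B : set R) : measurable B -> simple_fun s ->
  simple_fun (fun x => if x \in B then s x else 0).
Proof.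
move=> mB [fs ms]; split.
  apply: (@sub_finite_set _ _ (range s `|` [set 0])).
    by move=> _ [x _ <-]; case: ifP => _; [left; exists x|right].
  by rewrite finite_setU; split => //; exact: finite_set1.
move=> y; rewrite (_ : _ @^-1` _ = (B `&` s @^-1` [set y]) `|`
    (~` B `&` (fun _ : R => (0 : E)) @^-1` [set y])).
  apply: measurableU; apply: measurableI => //; first exact: measurableC.
  by have [_] := @simple_fun_cst R E 0.
apply/seteqP; split => x /=.
  by case: ifPn => [|]; [rewrite inE|rewrite notin_setE] => xB h; [left|right].
by case=> -[xB h]; [rewrite mem_set|rewrite memNset].
Qed.

Definition charfun (A : set R) (y : E) : R -> E := fun x => if x \in A then y else 0.

Lemma simple_charfun A y : measurable A -> simple_fun (charfun A y).
Proof. by move=> mA; apply: simple_fun_restr => //; exact: simple_fun_cst. Qed.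

Lemma rnorm_L1_lt (f g : L1fun E) (e : R) :
  (\int[mu]_(x in I01) (rnorm (f x - g x))%:E < e%:E)%E -> rnorm (L1_of f - L1_of g) < e.
Proof.
move=> h; rewrite -lte_fin.
have -> : L1_of f - L1_of g = L1_of (f - g) by rewrite -scaleN1r -L1_ofZ -L1_ofD scaleN1r.
by rewrite rnorm_L1.
Qed.

(** Simple functions that converge pointwise to f are set to 0 where their norm
exceeds twice that of f; then 3 |f| dominates the error. *)
Lemma simple_dense (q : L1 E) (e : R) : 0 < e ->
  exists (s : R -> E) (ss : simple_fun s), rnorm (q - L1_of (simple_L1 ss)) < e.
Proof.
move=> e0; rewrite -[q]L1_reprK; move: (repr q) => f.
have mf := L1fun_measurable f; have [s [ss sf]] := mf.
pose B n := I01 `&` [set x | rnorm (s n x) <= 2 * rnorm (f x)].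
have mrf := measurable_rnorm mI01 mf.
have mB n : measurable (B n).
  have ms : measurable_fun I01 (fun x => rnorm (s n x)).
    by apply: measurable_rnorm => //; exact: strongly_measurable_simple.
  rewrite /B; apply: measurable_fun_le => //.
  exact: measurable_funM.
pose t n := fun x => if x \in B n then s n x else 0.
have st n : simple_fun (t n) by exact: simple_fun_restr.
have tf x : I01 x -> rnorm (f x - t n x) @[n --> \oo] --> 0.
  move=> xI; have rs := sf x xI.
  have cs : rnorm (f x - s n x) @[n --> \oo] --> 0.
    by rewrite -(@rnorm0 R E) -(subrr (f x)); apply: cvg_rnorm; apply: cvgB => //; exact: cvg_cst.
  have [f0|f0] := eqVneq (f x) 0.
    rewrite (_ : (fun n => rnorm (f x - t n x)) = fun=> 0); first exact: cvg_cst.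
    apply/funext => n; rewrite f0 sub0r rnormN /t; case: ifP => //; last by rewrite rnorm0.
    rewrite inE => -[_ /=]; rewrite f0 rnorm0 mulr0 => s0.
    by apply/eqP; rewrite eq_le s0 rnorm_ge0.
  apply: cvg_trans cs; apply: near_eq_cvg.
  have f0' : 0 < rnorm (f x).
    rewrite lt_neqAle rnorm_ge0 andbT eq_sym; apply: contra_neq f0.
    exact: rnorm_eq0.
  have /cvgrPdist_lt/(_ _ f0') := cvg_rnorm rs.
  apply: filterS => n; rewrite ltr_distlC => /andP[_ lt].
  rewrite /t mem_set//; split => //=.
  by rewrite mulr_natl mulr2n ltW.
have [] := @dominated_convergence _ _ _ mu _ mI01
  (fun n x => (rnorm (f x - t n x))%:E) (cst 0%E) (fun x => (3 * rnorm (f x))%:E).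
- move=> n; apply/measurable_EFinP; apply: measurable_rnorm => //.
  by apply: strongly_measurableB => //; exact: strongly_measurable_simple.
- exact: measurable_cst.
- by apply: aeW => x xI; apply: cvg_EFin; [exact: nearW|exact: tf].
- by apply: eq_integrable (@integrableZl _ _ _ mu _ _ 3 _ (L1fun_integrable f)).
- apply: aeW => x n xI /=; rewrite lee_fin ger0_norm ?rnorm_ge0//.
  have := rnormD (f x) (- t n x); rewrite rnormN => /le_trans; apply.
  have -> : 3 * rnorm (f x) = rnorm (f x) + 2 * rnorm (f x) by ring.
  rewrite lerD2l /t; case: ifP; first by rewrite inE => -[].
  by rewrite rnorm0 mulr_ge0 ?rnorm_ge0.
move=> _ cv _.
have : \forall n \near \oo,
    (\int[mu]_(x in I01) `|(rnorm (f x - t n x))%:E - 0| < e%:E)%E.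
  have : nbhs (0%:E) [set y : \bar R | (y < e%:E)%E].
    by apply: (@nbhs_open_ereal_lt _ 0 (fun=> e)).
  by move=> /cv.
move=> /filter_ex[n hn]; exists (t n), (st n).
apply: rnorm_L1_lt; apply: le_lt_trans hn; rewrite le_eqVlt; apply/orP; left; apply/eqP.
by apply: eq_integral => x _; rewrite sube0 gee0_abs// lee_fin rnorm_ge0.
Qed.

Definition approximable (D : set (L1 E)) (q : L1 E) :=
  forall e : R, 0 < e -> exists2 p, D p & rnorm (q - p) < e.

Lemma approximableD (D : set (L1 E)) p q : (forall x y, D x -> D y -> D (x + y)) ->
  approximable D p -> approximable D q -> approximable D (p + q).
Proof.
move=> DD ap aq e e0; have e20 : 0 < e / 2 by rewrite divr_gt0.
have [p' Dp' pp'] := ap _ e20; have [q' Dq' qq'] := aq _ e20.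
exists (p' + q'); first exact: DD.
rewrite opprD addrACA; have := rnormD (p - p') (q - q').
by rewrite [X in _ < X](splitr e) => /le_lt_trans; apply; rewrite ltrD.
Qed.

(** A simple function is a finite sum of vectors times indicator functions. *)
Lemma approximable_all (D : set (L1 E)) : D 0 ->
  (forall x y, D x -> D y -> D (x + y)) ->
  (forall (A : set R) (mA : measurable A) y, A `<=` I01 ->
    approximable D (L1_of (simple_L1 (simple_charfun y mA)))) ->
  forall q, approximable D q.
Proof.
move=> D0 DD Dind q e e0; have e20 : 0 < e / 2 by rewrite divr_gt0.
have [s [ss qs]] := simple_dense q e20.
suff as_ : approximable D (L1_of (simple_L1 ss)).
  have [p Dp sp] := as_ _ e20; exists p => //.
  have := rnormD (q - L1_of (simple_L1 ss)) (L1_of (simple_L1 ss) - p).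
  rewrite addrA subrK => /le_lt_trans; apply.
  by rewrite (splitr e) ltrD.
have [fs ms] := ss.
have mA y : measurable (I01 `&` s @^-1` [set y]) by exact: measurableI.
have -> : L1_of (simple_L1 ss) =
    \sum_(y <- fset_set (range s)) L1_of (simple_L1 (simple_charfun y (mA y))).
  transitivity (L1_of (\sum_(y <- fset_set (range s)) simple_L1 (simple_charfun y (mA y)))).
    apply/L1_ofP; apply: aeW => x xI.
    have sumE (r : seq E) (F : E -> L1fun E) : (\sum_(y <- r) F y) x = \sum_(y <- r) F y x.
      by elim: r => [|a r IH]; rewrite ?big_nil// !big_cons -IH.
    rewrite sumE (big_fsetD1 (s x))/=; last by rewrite in_fset_set// inE; exists x.
    rewrite /charfun mem_set//= big_seq big1 ?addr0// => y.
    rewrite !inE => /andP[/eqP ysx _]; rewrite memNset// => -[_ /= h].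
    by apply: ysx.
  elim: (enum_fset (fset_set (range s))) => [|a r IH]; first by rewrite !big_nil /L1_of piE.
  by rewrite !big_cons L1_ofD IH.
elim: (enum_fset (fset_set (range s))) => [|a r IH].
  by rewrite big_nil => e' e'0; exists 0 => //; rewrite subrr rnorm0.
by rewrite big_cons; apply: approximableD => //; exact: Dind.
Qed.

Lemma strongly_measurable_tensor (D : set R) (phi : R -> R) (y : E) : measurable D ->
  measurable_fun D phi -> strongly_measurable D (fun x => (phi x)%:C%C *: y).
Proof.
move=> mD mphi.
have [g gphi] := approximation_sfun mD ((measurable_EFinP _ _).2 mphi).
exists (fun n x => (g n x)%:C%C *: y); split.
  move=> n; split.
    apply: (@sub_finite_set _ _ ((fun r : R => r%:C%C *: y) @` range (g n))).
      by move=> _ [x _ <-]; exists (g n x) => //; exists x.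
    by apply: finite_image; exact: fimfunP.
  move=> z; rewrite (_ : _ @^-1` _ = g n @^-1` [set r : R | r%:C%C *: y = z])//.
  rewrite (_ : _ @^-1` _ = \bigcup_(r in range (g n) `&` [set r : R | r%:C%C *: y = z])
      (g n @^-1` [set r])).
    apply: fin_bigcup_measurable => [|r _]; first by apply: finite_setIl; exact: fimfunP.
    exact: measurable_sfunP.
  apply/seteqP; split => [x h|x [r [_ /= h] /= xr]]; last by rewrite xr.
  by exists (g n x) => //; split => //; exists x.
move=> x Dx; apply: cvgZl.
have := gphi x Dx => /fine_cvgP[_ cg].
apply/cvgrPdist_lt => e e0.
have eE : e = (complex.Re e)%:C%C by apply/esym/RRe_real; rewrite gtr0_real.
rewrite eE ltcR in e0; have /cvgrPdist_lt/(_ _ e0) := cg; apply: filterS => n /=.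
by rewrite -rmorphB eE rnormE ltcR rnorm_real.
Qed.

End SimpleL1.

(** * The domain of a transport operator is dense *)

(** Apply the hypothesis to the phase of z - z'. *)
Lemma complex_eq_forms (R : realType) (z z' : R[i]) :
  (forall e : R[i], rnorm e <= 1 -> complex.Re (e * z) = complex.Re (e * z')) -> z = z'.
Proof.
move=> H; apply/eqP; rewrite -subr_eq0; apply/eqP; apply: rnorm_eq0.
have [e e1 <-] := exists_phase (z - z').
by rewrite mulrBr raddfB /= H// subrr.
Qed.

Section Diag.
Context {R : realType} {J : choiceType} (c : J -> R) (M : R).
Hypothesis c_bounds : forall j, 0 <= c j <= M.

Lemma diag_ell1_subproof (a : ell1 R J) : (fun j => (c j)%:C%C * a j) \in ell1_pred.
Proof.
apply/ell1P; have [[j0 _]|nj] := pselect (exists j : J, True); last first.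
  by rewrite esum1 ?ltry// => j; case: nj; exists j.
have M0 : 0 <= M by have /andP[c0 cM] := c_bounds j0; exact: le_trans c0 cM.
have fa : (\esum_(j in setT) (rnorm ((M%:C%C *: a : ell1 R J) j))%:E < +oo)%E.
  by apply/ell1P; exact: valP.
apply: le_lt_trans fa; apply: le_esum => j _; rewrite lee_fin.
rewrite -[X in _ <= rnorm X]/(M%:C%C * a j) !rnormM !rnorm_real.
have /andP[c0 cM] := c_bounds j.
by rewrite ler_wpM2r ?rnorm_ge0// !ger0_norm.
Qed.

Definition diag_ell1 (a : ell1 R J) : ell1 R J := Ell1 (diag_ell1_subproof a).

End Diag.

Section TransportDomain.
Context {R : realType} {G : digraph} (c : edge G -> R) (M : R).
Hypothesis c_bounds : forall j, 0 <= c j <= M.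
Local Notation mu := (@lebesgue_measure R).
Local Notation I01 := (`[0%R, 1%R]%classic : set R).
Local Notation V := (ell1 R (edge G)).

Let mI01 : measurable (I01 : set R). Proof. exact: measurable_itv. Qed.

Variables (A : set R) (y : V).
Hypothesis mA : measurable A.
Hypothesis A01 : A `<=` I01.
Variable d : R.
Hypothesis d0 : 0 < d.

Let phi := forward_average A d.
Let B := (fun s : R => s + d) @^-1` trim A d.

Let mB : measurable B.
Proof.
rewrite -[B]setTI; apply: (@measurable_translation R d) => //.
exact: measurable_trim.
Qed.

Let tensor_L1 : (fun x => (phi x)%:C%C *: y) \in L1_pred.
Proof.
have mphi : measurable_fun I01 phi by exact: measurable_forward_average.
apply/asboolP; split; first exact: strongly_measurable_tensor.
apply: (@le_lt_trans _ _ (\int[mu]_(x in I01) (rnorm y)%:E)%E).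
  apply: ge0_le_integral => //.
  - by move=> x _; rewrite lee_fin rnorm_ge0.
  - by apply: measurable_rnormE; exact: strongly_measurable_tensor.
  - move=> x _; rewrite lee_fin rnormZ rnorm_real.
    have /andP[f0 f1] := forward_average_bounds mA A01 x d0.
    by rewrite ger0_norm// ler_piMl// rnorm_ge0.
rewrite integral_cst// lte_mul_pinfty ?lee_fin ?rnorm_ge0//.
exact: lebesgue_itv01_lty.
Qed.

Definition ramp : L1fun V := MkL1fun tensor_L1.

Let slope (z : V) : R -> V := (d^-1)%:C%C *: (charfun B z - charfun (trim A d) z).

Let simple_slope z : simple_fun (slope z).
Proof.
have s0 : simple_fun (0 : R -> V) by exact: simple_fun_cst.
rewrite /slope -[_ *: _]addr0; apply: simple_fun_lin => //.
rewrite addrC -scaleN1r; apply: simple_fun_lin; apply: simple_charfun => //.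
exact: measurable_trim.
Qed.

Let slopeE (z : V) s j : slope z s j =
  (d^-1 * (\1_(trim A d) (s + d) - \1_(trim A d) s))%:C%C * z j.
Proof.
have -> : slope z s j = (d^-1)%:C%C * (charfun B z s j - charfun (trim A d) z s j) by [].
rewrite rmorphM -mulrA; congr (_ * _); rewrite rmorphB mulrBl /charfun !indicE.
have -> : (s \in B) = (s + d \in trim A d) by [].
by congr (_ - _); case: (_ \in _); rewrite ?mul1r ?mul0r.
Qed.

(** The derivative of a ramp is a simple function, hence the constant sequence
witnesses that it is Bochner integrable. *)
Lemma ramp_W11 : W11_derivative ramp (simple_L1 (simple_slope y)).
Proof.
move=> x x01; exists (fun=> slope y); split; first by move=> n; exact: simple_slope.
  apply: (@cvg_trans _ ((cst 0%E : nat -> \bar R) @ \oo)); last exact: cvg_cst.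
  apply: near_eq_cvg; apply: nearW => n; apply/esym.
  by rewrite (eq_integral (cst 0%E)) ?integral0// => s _; rewrite subrr rnorm0.
suff -> : simple_integral `[0, x] (slope y) = ramp x - ramp 0 by exact: cvg_cst.
have m0x : (mu `[0%R, x]%classic < +oo)%E.
  by rewrite lebesgue_measure_itv/=; case: ifP => _; rewrite ?ltry// -EFinB ltry.
apply/val_inj/funext => j; apply: complex_eq_forms => e e1 /=.
rewrite -(simple_integral_form (coord_form j e1) (measurable_itv _) m0x (simple_slope y)).
have rampE : (ramp x - ramp 0 : V) j = (phi x)%:C%C * y j.
  rewrite -[LHS]/((phi x)%:C%C * y j - (phi 0)%:C%C * y j).
  by rewrite /phi [forward_average A d 0]forward_average_at0// rmorph0 mul0r subr0.
have ReZ (r : R) (z : R[i]) : complex.Re (e * (r%:C%C * z)) = r * complex.Re (e * z).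
  by rewrite mulrCA; case: (e * z) => p q /=; rewrite mul0r subr0.
transitivity (phi x * complex.Re (e * y j)); last by rewrite -ReZ -rampE.
transitivity (\int[mu]_(s in `[0, x])
    (d^-1 * (\1_(trim A d) (s + d) - \1_(trim A d) s) * complex.Re (e * y j))).
  by apply: eq_Rintegral => s _; rewrite slopeE ReZ.
rewrite RintegralZr//; first by rewrite forward_average_primitive.
have i1 C : measurable C -> mu.-integrable `[0, x] (EFin \o (\1_C : R -> R)).
  move=> mC; apply: eq_integrable (integrable_cindic 1 _ mC m0x) => //.
  by move=> s _; rewrite /= mul1r.
have iB := i1 _ mB; have ic := i1 _ (measurable_trim mA d).
have iD := @integrableB _ _ _ mu _ (measurable_itv _) _ _ iB ic.
exact: (@integrableZl _ _ _ mu _ (measurable_itv _) d^-1 _ iD).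
Qed.

(** A ramp vanishes at both ends and therefore satisfies every vertex condition. *)
Lemma ramp_transport_op : exists x', transport_op c (L1_of ramp) x'.
Proof.
pose k := simple_L1 (simple_slope (diag_ell1 c_bounds y)).
exists (L1_of k), ramp, (simple_L1 (simple_slope y)), k; split => //.
- exact: ramp_W11.
- have r0 : ramp 0 = 0.
    by rewrite /= /phi forward_average_at0// rmorph0 scale0r.
  have r1 : ramp 1 = 0.
    by rewrite /= /phi forward_average_at1// rmorph0 scale0r.
  rewrite r0 r1 => i; rewrite (_ : summability.partial_sum _ = fun=> (0 : R[i]^o)).
    exact: (@cvg_cst _ (0 : R[i]^o) _ _ (summability.totally_filter)).
  apply/funext => F; rewrite /summability.partial_sum big1// => j _.
  by rewrite -[X in _ * X]/(0 : R[i]) mulr0.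
- move=> x j _; rewrite -[LHS]/(slope (diag_ell1 c_bounds y) x j).
  rewrite -[X in _ = _ * X]/(slope y x j) !slopeE.
  by rewrite -[diag_ell1 _ _ j]/((c j)%:C%C * y j) mulrCA.
Qed.

End TransportDomain.

Section TransportDense.
Context {R : realType} {G : digraph} (c : edge G -> R) (M : R).
Hypothesis c_bounds : forall j, 0 <= c j <= M.
Local Notation mu := (@lebesgue_measure R).
Local Notation I01 := (`[0%R, 1%R]%classic : set R).
Local Notation V := (ell1 R (edge G)).

(** Ramps approximate the products of vectors and indicator functions, from which
every integrable function is approximated by finite sums. *)
Lemma transport_op_dense (D : set (L1 V)) :
  (forall x x', transport_op c x x' -> D x) ->
  (forall x y, D x -> D y -> D (x + y)) ->
  forall q, approximable D q.
Proof.
move=> cD DD; have mI01 : measurable I01 by exact: measurable_itv.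
have H (A : set R) (mA : measurable A) y : A `<=` I01 ->
    approximable D (L1_of (simple_L1 (simple_charfun y mA))).
  move=> A01 e e0.
  have e'0 : 0 < e / (rnorm y + 1) by rewrite divr_gt0// ltr_wpDl// rnorm_ge0.
  have : \forall n \near \oo, (\int[mu]_(x in I01)
      `|forward_average A n.+1%:R^-1 x - \1_A x|%:E < (e / (rnorm y + 1))%:E)%E.
    have nb : nbhs (0%:E) [set z : \bar R | (z < (e / (rnorm y + 1))%:E)%E].
      by apply: (@nbhs_open_ereal_lt _ 0 (fun=> e / (rnorm y + 1))).
    exact: (forward_average_cvg mA A01 nb).
  move=> /filter_ex[n hn]; have d0 : 0 < n.+1%:R^-1 :> R by rewrite invr_gt0.
  exists (L1_of (ramp y mA A01 d0)).
    by have [x' /cD] := ramp_transport_op c_bounds y mA A01 d0.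
  apply: rnorm_L1_lt.
  apply: (@le_lt_trans _ _ (\int[mu]_(x in I01)
      ((rnorm y)%:E * `|forward_average A n.+1%:R^-1 x - \1_A x|%:E))%E).
    rewrite le_eqVlt; apply/orP; left; apply/eqP; apply: eq_integral => x _.
    rewrite -EFinM; congr EFin.
    have -> : simple_L1 (simple_charfun y mA) x - ramp y mA A01 d0 x =
        (\1_A x - forward_average A n.+1%:R^-1 x)%:C%C *: y.
      rewrite rmorphB scalerBl; congr (_ - _).
      by rewrite /= /charfun indicE; case: (_ \in _); rewrite ?scale1r ?scale0r.
    by rewrite rnormZ rnorm_real distrC mulrC.
  rewrite ge0_integralZl_EFin//; last 2 first.
  - apply/measurable_EFinP; apply: measurableT_comp => //; apply: measurable_funB.
      exact: measurable_forward_average.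
    exact: measurable_indic.
  - exact: rnorm_ge0.
  apply: (@le_lt_trans _ _ ((rnorm y)%:E * (e / (rnorm y + 1))%:E)%E).
    by rewrite lee_wpmul2l ?lee_fin ?rnorm_ge0// ltW.
  rewrite -EFinM lte_fin mulrCA gtr_pMr// ltr_pdivrMr ?ltr_wpDl ?rnorm_ge0//.
  by rewrite mul1r ltrDl.
apply: approximable_all => //.
have m0 : measurable (set0 : set R) by [].
have [|p Dp _] := H set0 m0 0 _ 1 ltr01; first exact: sub0set.
have [x' tx'] := ramp_transport_op c_bounds 0 m0 (@sub0set _ _) ltr01.
apply: (cD _ x'); suff <- : L1_of (ramp (0 : V) m0 (@sub0set _ I01) ltr01) = 0 by [].
have -> : (0 : L1 V) = L1_of 0 by rewrite /L1_of piE.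
by apply/L1_ofP; apply: aeW => z _ /=; rewrite scaler0.
Qed.

End TransportDense.

(** * Exhaustion of the limit graph and distance to its unexplored part *)

Section Exhaustion.
Local Notation arc := Defs.arc.
Variables (Gs : nat -> digraph) (phi : forall n, embedding (Gs n) (Gs n.+1)).
Variables (G : digraph) (psi : forall n, embedding (Gs n) G).
Hypothesis limit_G : direct_limit phi psi.

Let union_arc : rel G := fun v w =>
  `[< exists n a b, [/\ arc a b, psi n a = v & psi n b = w] >].

Let union_graph := Digraph union_arc.

(** The union of the images of the graphs, with all vertices of G but only the images of
arcs, is itself a cocone.  The induced map from G to it is the identity, by the
uniqueness of maps out of the colimit, and preserves arcs. *)
Lemma direct_limit_arc v w : arc v w ->
  exists n a b, [/\ arc a b, psi n a = v & psi n b = w].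
Proof.
move=> vw; have [comm univ] := limit_G.
have [u [[uhom upsi] _]] := univ union_graph (fun n => psi n)
  (fun n a b ab => asboolT (ex_intro _ n (ex_intro _ a (ex_intro _ b
     (And3 ab (erefl (psi n a)) (erefl (psi n b))))))) comm.
have sub a b : @arc union_graph a b -> @arc G a b.
  by move=> /asboolP[n [x [y [xy <- <-]]]]; exact: (embedding_hom (psi n)).
have [i [_ iuniq]] := univ G (fun n => psi n) (fun n => embedding_hom (psi n)) comm.
have uid z : (u z : G) = z.
  have iu : i = u by apply: iuniq; split => // a b ab; exact/sub/uhom.
  have iid : i = id by apply: iuniq; split.
  by rewrite -iu iid.
by have /asboolP := uhom v w vw; rewrite !uid.
Qed.

Lemma eventually_edge (e : edge G) :
  \forall n \near \oo, range (edge_map (psi n)) e.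
Proof.
have [comm _] := limit_G.
have [n0 [a [b [ab av bw]]]] := direct_limit_arc (valP e).
exists n0 => // n /= n0n; rewrite -(subnK n0n); elim: (n - n0)%N => [|k [e' _ e'E]].
  exists (exist _ (a, b) ab) => //; apply/val_inj => /=.
  by rewrite [RHS]surjective_pairing -av -bw.
rewrite addSn; exists (edge_map (phi (k + n0)) e') => //.
rewrite -e'E; apply/val_inj => /=; congr pair; exact: comm.
Qed.

End Exhaustion.

Section Decay.
Context {R : realType} {G : digraph}.
Local Notation head := Defs.head.
Implicit Types (S : set (edge G)) (e : edge G).

Fixpoint escapes S (m : nat) e : Prop :=
  if m is m'.+1 then escapes S m' e \/ exists2 e', head e = tail e' & escapes S m' e'
  else ~ S e.

Lemma escapes_le S m m' e : (m <= m')%N -> escapes S m e -> escapes S m' e.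
Proof.
by move=> mm'; rewrite -(subnK mm'); elim: (m' - m)%N => // k IH /IH; left.
Qed.

(** Two to the power minus the distance to the complement of S, and 0 if it is
infinite. *)
Definition decay S e : R :=
  if pselect (exists m, `[< escapes S m e >]) is left h then 2^-1 ^+ (ex_minn h) else 0.

Let half01 : 0 <= (2^-1 : R) <= 1.
Proof. by rewrite invr_ge0 ler0n invf_le1 ?ltr0n// ler1n. Qed.

Lemma decay01 S e : 0 <= decay S e <= 1.
Proof.
have /andP[h0 h1] := half01.
rewrite /decay; case: pselect => [h|_]; last by rewrite lexx ler01.
by rewrite exprn_ge0//= exprn_ile1.
Qed.

Lemma decay_out S e : ~ S e -> decay S e = 1.
Proof.
move=> nS; have E0 : escapes S 0 e by [].
rewrite /decay; case: pselect => [h|[]]; last by exists 0%N; exact/asboolP.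
by case: ex_minnP => m _ /(_ 0%N (asboolT E0)); rewrite leqn0 => /eqP ->.
Qed.

(** A successor of e is at most one step closer to the complement. *)
Lemma decay_step S e e' : head e = tail e' -> decay S e' <= 2 * decay S e.
Proof.
have /andP[h0 h1] := half01.
move=> ee'; have /andP[d0 d1] := decay01 S e.
rewrite {1}/decay; case: pselect => [h|_]; last by rewrite mulr_ge0.
case: ex_minnP => m /asboolP Em _.
have Em1 : escapes S m.+1 e by right; exists e'.
rewrite /decay; case: pselect => [h'|[]]; last by exists m.+1; exact/asboolP.
case: ex_minnP => m1 _ /(_ m.+1 (asboolT Em1)) m1m.
have : (2^-1 : R) ^+ m.+1 <= 2^-1 ^+ m1 by rewrite ler_wiXn2l.
by move=> /(ler_wpM2l (ler0n R 2)); rewrite exprS mulrA mulfV ?mul1r// pnatr_eq0.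
Qed.

Lemma decay_le S m e : ~ escapes S m e -> decay S e <= 2^-1 ^+ m.
Proof.
have /andP[h0 h1] := half01; move=> nE.
rewrite /decay; case: pselect => [h|_]; last by rewrite exprn_ge0.
case: ex_minnP => m1 /asboolP Em1 _; rewrite ler_wiXn2l//.
rewrite leqNgt; apply/negP => m1m; apply: nE; apply: escapes_le Em1; exact: ltnW.
Qed.

(** An edge has finitely many successors in m steps, and eventually all of them lie
in S n; from then on the distance exceeds m. *)
Lemma decay_cvg0 (S : nat -> set (edge G)) :
  (forall e, \forall n \near \oo, S n e) ->
  (forall v : G, finite_set [set e : edge G | tail e = v]) ->
  forall e, decay (S n) e @[n --> \oo] --> 0.
Proof.
move=> Sev fin e; have E m e1 : \forall n \near \oo, ~ escapes (S n) m e1.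
  elim: m e1 => [|m IH] e1; first by apply: filterS (Sev e1) => n Sn; exact.
  pose succ := [set e2 : edge G | tail e2 = head e1].
  have fs : finite_set succ by exact: fin.
  have : \forall n \near \oo, (\bigcap_(e2 in [set` fset_set succ])
      [set n | ~ escapes (S n) m e2]) n.
    by apply: filter_bigI => e2 _; exact: IH.
  apply: filterS2 (IH e1) => n nm nsucc [//|[e2 e12 Ee2]].
  by apply: (nsucc e2) => //=; rewrite in_fset_set// inE /succ /=.
apply/cvgrPdist_lt => r r0.
have half : `|2^-1 : R| < 1 by rewrite ger0_norm ?invr_ge0// invf_lt1// ltr1n.
have /cvgrPdist_lt/(_ r r0)/filter_ex[m] := cvg_geometric 1 half.
rewrite /geometric /= mul1r sub0r normrN ger0_norm ?exprn_ge0 ?invr_ge0// => mr.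
apply: filterS (E m e) => n /decay_le dn.
rewrite sub0r normrN ger0_norm; first exact: le_lt_trans mr.
by have /andP[] := decay01 (S n) e.
Qed.

End Decay.

(** * Convergence *)

Lemma generatorD (R : realType) (X : normedModType R[i]) (S : R -> X -> X) x x' y y' :
  C0_semigroup S -> generator S x x' -> generator S y y' ->
  generator S (x + y) (x' + y').
Proof.
rewrite /generator => SC xx yy; apply: (cvg_trans _ (cvgD xx yy)); apply: near_eq_cvg.
exists 1 => //= h _ h0.
have Sl := C0_linear SC (ltW h0).
have -> : S h (x + y) = S h x + S h y by have := Sl 1 x y; rewrite !scale1r.
rewrite -[LHS]/(_ *: _ + _ *: _) -scalerDr; congr (_ *: _).
by rewrite opprD addrACA.
Qed.

Lemma generator_dense (R : realType) (G : digraph) (c : edge G -> R) (M : R)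
    (T : R -> L1 (ell1 R (edge G)) -> L1 (ell1 R (edge G))) :
  (forall j, 0 <= c j <= M) -> generates (transport_op c) T ->
  forall x e, 0 < e -> exists x0 x0', generator T x0 x0' /\ rnorm (x - x0) < e.
Proof.
move=> cM [TC gen] x e e0.
have [|x1 y1 [x1' gx] [y1' gy]|x0 [x0' gx0] xx0] :=
    @transport_op_dense R G c M cM [set x | exists x', generator T x x'] _ _ x e e0.
- by move=> x1 x1' /gen g1; exists x1'.
- by exists (x1' + y1'); exact: generatorD.
- by exists x0, x0'.
Qed.

Section WnormLimit.
Context {R : realType} {J : countType} (kap : R).
Hypothesis kap0 : 0 <= kap.

(** All but a finite part of the convergent sum of the weighted norms is small,
uniformly in rho; on the finite part rho tends to 0. *)
Lemma wnorm_cvg0 (rho : nat -> J -> R) (q : L1 (ell1 R J)) :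
  (forall n j, 0 <= rho n j <= 1) -> (forall j, rho n j @[n --> \oo] --> 0) ->
  wnorm kap (rho n) q @[n --> \oo] --> 0.
Proof.
move=> rho01 rho0; apply/cvgrPdist_lt => e e0.
have e20 : 0 < e / 2 by rewrite divr_gt0.
pose a j := wcoord kap q j.
have a0 j : 0 <= a j by exact: wcoord_ge0.
have one01 (j : J) : 0 <= (1 : R) <= 1 by rewrite ler01 lexx.
have aE : \esum_(j in setT) (a j)%:E = (wnorm kap (fun=> 1) q)%:E.
  by rewrite wnormE//; apply: eq_esum => j _; rewrite mul1r.
have lt : ((wnorm kap (fun=> 1) q - e / 2)%:E < \esum_(j in setT) (a j)%:E)%E.
  by rewrite aE lte_fin ltrBlDr ltrDl.
have [_ [F [finF _] <-] Flt] := @ereal_sup_gt _ _ _ lt.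
pose r := fset_set F.
have sumF (b : J -> R) : (\sum_(j \in F) (b j)%:E)%E = (\sum_(j <- r) b j)%:E.
  by rewrite fsbig_finite//= sumEFin.
rewrite sumF lte_fin in Flt.
have split (b : J -> R) : (forall j, 0 <= b j) -> (\esum_(j in setT) (b j)%:E =
    (\sum_(j <- r) b j)%:E + \esum_(j in ~` F) (b j)%:E)%E.
  move=> b0; rewrite (esumID F) ?setTI; last by move=> j _; rewrite lee_fin.
  by rewrite esum_fset ?sumF// => j _; rewrite lee_fin.
have tail_lt : (\esum_(j in ~` F) (a j)%:E <= (e / 2)%:E)%E.
  have := split a a0; rewrite aE; case: (\esum_(j in ~` F) _) => [t| |]//.
    by rewrite -EFinD => -[] h; move/ltW: Flt; rewrite h lerBlDr lerD2l lee_fin.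
have sum0 : \sum_(j <- r) rho n j * a j @[n --> \oo] --> 0.
  elim: (enum_fset r) => [|j s IH].
    by under eq_fun do rewrite big_nil; exact: cvg_cst.
  under eq_fun do rewrite big_cons.
  have h : rho n j * a j @[n --> \oo] --> 0 * a j.
    by apply: cvgMl; exact: rho0.
  have h2 := cvgD h IH; rewrite mul0r addr0 in h2; exact: h2.
have /cvgrPdist_lt/(_ _ e20) := sum0; apply: filterS => n.
have rho_ge0 j : 0 <= rho n j by have /andP[] := rho01 n j.
rewrite !sub0r !normrN ger0_norm ?sumr_ge0//; last by move=> j _; rewrite mulr_ge0.
move=> sn; rewrite ger0_norm ?wnorm_ge0// -lte_fin wnormE//.
rewrite (split (fun j => rho n j * a j)); last by move=> j; rewrite mulr_ge0.
apply: (@le_lt_trans _ _ ((\sum_(j <- r) rho n j * a j)%:E + (e / 2)%:E)%E).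
  rewrite leeD2l//; apply: le_trans tail_lt; apply: le_esum => j _.
  by rewrite lee_fin ler_piMl//; have /andP[] := rho01 n j.
by rewrite -EFinD lte_fin [ltRHS](splitr e) ltrD2r.
Qed.

End WnormLimit.

Section InitialEnergy.
Context {R : realType} {H G : digraph} (f : embedding H G) (k : nat).
Variable rho : edge G -> R.
Hypothesis rho01 : forall e, 0 <= rho e <= 1.
Hypothesis rho_out : forall e, ~ range (edge_map f) e -> rho e = 1.
Local Notation kap := (2 * k%:R : R).

(** On an edge of the subgraph, x and its cut-off agree, and the second term of the
energy contributes rho_j; on the other edges the first one contributes 1,
which is rho_j. *)
Lemma energy_cutoff (x : L1 (ell1 R (edge G))) :
  energy f k rho x (cutoff_op f x) = wnorm kap rho x.
Proof.
have kap0 : 0 <= kap by rewrite mulr_ge0.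
have one01 (j : edge G) : 0 <= (1 : R) <= 1 by rewrite ler01 lexx.
rewrite -[x]L1_reprK; move: (repr x) => u.
have cE : cutoff_op f (L1_of u) = L1_of (L1fun_map (L := restr_ell1 (edge_map_inj (f := f)))
  (rnorm_restr_ell1 _) u) by exact: L1_map_of.
rewrite cE; set v := L1fun_map _ _.
have vE t l : v t l = u t (edge_map f l) by [].
rewrite /energy extension_op_of -L1_ofB.
apply/EFin_inj; rewrite EFinD !wnormE// -esumD; last 2 first.
- by move=> j _; rewrite lee_fin mul1r wcoord_ge0.
- by move=> j _; rewrite lee_fin mulr_ge0 ?wcoord_ge0//; have /andP[] := rho01 j.
apply: eq_esum => j _; rewrite -EFinD; congr EFin; rewrite mul1r !wcoord_of//.
have [[l _ lj]|nj] := pselect (range (edge_map f) j).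
  have Ej t : extension_fun f v t j = u t j.
    by rewrite extension_funE -lj (ext_seqE (edge_map_inj (f := f))) vE.
  rewrite (@eq_Rintegral _ _ _ _ _ (fun=> 0)); last first.
    by move=> t _; rewrite L1fun_subE ell1_subE Ej subrr rnorm0 mulr0.
  rewrite Rintegral_cst; last exact: measurable_itv.
  rewrite mul0r add0r; congr (_ * _).
  by apply: eq_Rintegral => t _; rewrite Ej.
have Ej t : extension_fun f v t j = 0.
  by rewrite extension_funE (ext_seq0 _ nj).
rewrite rho_out// !mul1r [X in _ + X](_ : _ = 0) ?addr0.
  by apply: eq_Rintegral => t _; rewrite L1fun_subE ell1_subE Ej subr0.
rewrite (@eq_Rintegral _ _ _ _ _ (fun=> 0)); last first.
  by move=> t _; rewrite Ej rnorm0 mulr0.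
by rewrite Rintegral_cst ?mul0r//; exact: measurable_itv.
Qed.

End InitialEnergy.

(** The energy is dissipated at the rate 2kM, and both domains are dense. *)
Lemma energy_growth (R : realType) (H G : digraph) (f : embedding H G) (c : edge G -> R)
    (k : nat) (M : R) (rho : edge G -> R)
    (S : R -> L1 (ell1 R (edge H)) -> L1 (ell1 R (edge H)))
    (T : R -> L1 (ell1 R (edge G)) -> L1 (ell1 R (edge G))) :
  (forall e, 0 < c e <= M) -> 0 <= M ->
  (forall v : G, ([set e : edge G | tail e = v] #<= `I_k)%card) ->
  (forall e, 0 <= rho e <= 1) ->
  (forall e, ~ range (edge_map f) e -> rho e = 1) ->
  (forall e e', Defs.head e = tail e' -> rho e' <= 2 * rho e) ->
  generates (transport_op (fun e => c (edge_map f e))) S ->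
  generates (transport_op c) T ->
  forall x y t, 0 <= t ->
    energy f k rho (T t x) (S t y) <= expR (M * (2 * k%:R) * t) * energy f k rho x y.
Proof.
move=> cM M0 outk rho01 rho_out rho_step genS genT x y t t0.
have c_gt0 e : 0 < c e by have /andP[] := cM e.
have c_le e : c e <= M by have /andP[] := cM e.
have c_bd e : 0 <= c e <= M by rewrite c_le ltW.
have K0 : (0 : R) < 2 * (1 + 2 * k%:R) by rewrite mulr_gt0// ltr_pwDl// mulr_ge0.
apply: (dissipative_growth genT.1 genS.1 (P := energy f k rho) (K := 2 * (1 + 2 * k%:R))) => //.
- by rewrite !mulr_ge0.
- by move=> *; exact: energy_ge0.
- by move=> *; exact: energyD.
- by move=> *; exact: energy_le.
- move=> x1 x1' y1 y1' eta eta0 /genT.2 gx /genS.2 gy.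
  exact: energy_dissipative gx gy.
- exact: generator_dense genT.
- apply: (@generator_dense _ _ _ M) genS.
  by move=> e; exact: c_bd.
Qed.

Theorem proposition2p4 (R : realType)
    (Gs : nat -> digraph) (phi : forall n, embedding (Gs n) (Gs n.+1))
    (G : digraph) (psi : forall n, embedding (Gs n) G)
    (finite_Gs : forall n, finite_digraph (Gs n))
    (simple_Gs : forall n, simple_digraph (Gs n))
    (limit_G : direct_limit phi psi)
    (simple_G : simple_digraph G)
    (ulf_G : uniformly_locally_finite G)
    (c : edge G -> R) (m M : R) (m_gt0 : 0 < m) (M_gt0 : 0 < M)
    (c_bounds : forall j, m <= c j <= M)
    (Tn : forall n, R -> L1 (ell1 R (edge (Gs n))) -> L1 (ell1 R (edge (Gs n))))
    (T : R -> L1 (ell1 R (edge G)) -> L1 (ell1 R (edge G)))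
    (gen_Tn : forall n,
      generates (transport_op (fun e => c (edge_map (psi n) e))) (Tn n))
    (gen_T : generates (transport_op c) T)
    (x : L1 (ell1 R (edge G))) :
  let err n t :=
    rnorm (extension_op (psi n) (Tn n t (cutoff_op (psi n) x)) - T t x) in
  (forall t, 0 <= t -> err n t @[n --> \oo] --> (0 : R)) /\
  (forall b eps : R, 0 < eps ->
    \forall n \near \oo, forall t, 0 <= t <= b -> err n t < eps).
Proof.
move=> err; have [k outk] := ulf_G.
pose rho n : edge G -> R := decay (range (edge_map (psi n))).
have rho01 n e : 0 <= rho n e <= 1 by exact: decay01.
have cM e : 0 < c e <= M.
  by have /andP[mc ->] := c_bounds e; rewrite (lt_le_trans m_gt0 mc).
have kap0 : (0 : R) <= 2 * k%:R by rewrite mulr_ge0.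
have om0 : 0 <= M * (2 * k%:R) by rewrite mulr_ge0// ltW.
have en0 : wnorm (2 * k%:R) (rho n) x @[n --> \oo] --> 0.
  apply: wnorm_cvg0 => //; apply: decay_cvg0.
    exact: eventually_edge limit_G.
  by move=> v; apply/finite_set_leP; exists k.
have bound n t : 0 <= t ->
    err n t <= expR (M * (2 * k%:R) * t) * wnorm (2 * k%:R) (rho n) x.
  move=> t0; rewrite -(@energy_cutoff R _ _ (psi n) k (rho n))//; last first.
    by move=> e; exact: decay_out.
  apply: (le_trans (rnorm_le_energy (psi n) k (rho01 n) (T t x) (Tn n t (cutoff_op (psi n) x)))).
  apply: (energy_growth cM) => //.
  - exact: ltW.
  - by move=> e; exact: decay_out.
  - by move=> e e'; exact: decay_step.
have unif b eps : 0 < eps -> \forall n \near \oo, forall t, 0 <= t <= b -> err n t < eps.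
  move=> eps0; have e0 : 0 < eps / expR (M * (2 * k%:R) * b) by rewrite divr_gt0// expR_gt0.
  have /cvgrPdist_lt/(_ _ e0) := en0; apply: filterS => n.
  rewrite sub0r normrN ger0_norm ?wnorm_ge0// ltr_pdivlMr ?expR_gt0// => lt t /andP[t0 tb].
  apply: le_lt_trans (bound n t t0) _; apply: le_lt_trans lt; rewrite mulrC.
  by rewrite ler_wpM2l ?wnorm_ge0// ler_expR ler_wpM2l.
split => // t t0; apply/cvgrPdist_lt => eps eps0.
apply: filterS (unif t eps eps0) => n /(_ t); rewrite t0 lexx => /(_ isT).
by rewrite sub0r normrN ger0_norm// rnorm_ge0.
Qed.
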